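(* Let $\bar c_D=\sup_{x\in D}c(x)$. Assume that there are a strictly positive function $\psi:D\to(0,+\infty)$ and a $\sigma$-finite Borel measure $\nu$ on $D$ such that the minorization condition $M(\bar c_D,\psi,\nu)$ holds, i.e. $R^D_{\bar c_D}f(x)\ge\psi(x)\int_D f\,d\nu$ for all $x\in D$ and $f\in B_b^+(D)$. 1) Suppose that $\mathrm{supp}\,\nu=D$ and that $u\in\mathcal U_c^+$ is non-constant and continuous in $D$. Then there exists $a>0$ such that $$\bar u_{D_S}-u(x)\ge a\,\psi(x),\qquad x\in D.$$ 2) Let $m$ be a non-trivial $\sigma$-finite positive Borel measure on $D$. Suppose that $m\ll\nu$ and that $u\in\mathcal U_c^+$ is non-constant $m$-a.e. in $D$ (i.e. $u$ is not $m$-a.e. equal to a constant on $D$). Then there exists $a>0$ such that $\bar u_{D_S}-u(x)\ge a\,\psi(x)$ for all $x\in D$.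
   Context: Setting and standing assumptions. $D\subset\mathbb R^d$ is a domain (open connected set). $B_b(E)$ (resp. $B_b^+(E)$) denotes the bounded (resp. non-negative bounded) Borel functions on $E$; $\mu\ll\nu$ means absolute continuity. $A$ is the operator $$Au(x)=\tfrac12\mathrm{Tr}(\mathbf Q(x)\nabla^2u(x))+b(x)\cdot\nabla u(x)+\int_{\mathbb R^d}\Big(u(x+y)-u(x)-\frac{y\cdot\nabla u(x)}{1+|y|^2}\Big)N(x,dy).$$ (A1) The entries of the symmetric non-negative definite matrix $\mathbf Q(x)$ and of the vector $b(x)$ are bounded Borel functions on $\mathbb R^d$. (A2) $N(x,dy)$ is a kernel of $\sigma$-finite Borel measures on $\mathbb R^d\setminus\{0\}$ with $\sup_x\int\min\{1,|y|^2\}N(x,dy)<\infty$. (A3) $c:D\to[0,\infty)$ is bounded and Borel. (A4) There is a strong Markovian solution $(P_x)_{x\in\mathbb R^d}$ of the martingale problem for $A$, which is fixed: Borel probability measures on the Skorokhod space of càdlàg paths $[0,\infty)\to\mathbb R^d$ with canonical process $X_t$ and natural filtration $(\mathcal F_t)$, such that $P_x(X_0=x)=1$; for each $f\in C_b^2(\mathbb R^d)$ the process $f(X_t)-f(X_0)-\int_0^tAf(X_r)dr$ is a $P_x$-martingale; $x\mapsto P_x[C]$ is measurable for Borel $C$; $X$ is strong Markov; and $P_\mu=\int P_x\,\mu(dx)$ solves the martingale problem with initial law $\mu$ for every Borel probability measure $\mu$. $\mathbb E_x$ is expectation under $P_x$. Let $\tau_D=\inf\{t>0:X_t\notin D\}$.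 (ET) $P_x(\tau_D<\infty)=1$ for all $x\in D$. Semigroup and resolvent: $P^D_tf(x)=\mathbb E_x[f(X_t);\,t<\tau_D]$, $R^D_\alpha f(x)=\int_0^\infty e^{-\alpha t}P^D_tf(x)\,dt$ for $\alpha\ge0$. Extended closure: $\mathcal S(D)=\bigcup_{x\in D}(x+\mathrm{supp}\,N(x,\cdot))$, $\partial_SD=\partial D\cup(\mathcal S(D)\setminus D)$, $D_S=D\cup\partial_SD$; $\bar u_B=\sup_Bu$. Subsolutions: with $e_c(t)=\exp\{-\int_0^tc(X_r)dr\}$, $u\in B_b(\mathbb R^d)$ is a weak subsolution of $(-A+c)v=0$ in $D$ if $u(x)\le\mathbb E_x[e_c(\tau_D\wedge t)u(X_{\tau_D\wedge t})]$ for all $x\in D$, $t\ge0$. $\mathcal U_c^+$ is the set of such $u$ with $\bar u_{D_S}\ge0$. *)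

(* Defs.v *)
From HB Require Import structures.
From mathcomp Require Import all_boot all_order all_algebra.
From mathcomp Require Import all_classical all_reals all_analysis.

Set Implicit Arguments.
Unset Strict Implicit.
Unset Printing Implicit Defensive.

Import Order.TTheory GRing.Theory Num.Theory.
Import numFieldNormedType.Exports.

Local Open Scope classical_set_scope.
Local Open Scope ring_scope.

(** * Euclidean space with its Borel sigma-algebra *)

Section borel_rV.
Context {R : realType} {n : nat}.

HB.instance Definition _ := @isMeasurable.Build
  (sigma_display (@open 'rV[R]_n)) 'rV[R]_n <<s @open 'rV[R]_n >>
  (@sigma_algebra0 _ setT (@open 'rV[R]_n)) (@sigma_algebraC _ _)
  (@sigma_algebra_bigcup _ setT (@open 'rV[R]_n)).

End borel_rV.

Section euclidean.
Context {R : realType} {n : nat}.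
Implicit Types (x y : 'rV[R]_n) (D : set 'rV[R]_n) (f : 'rV[R]_n -> R).

Definition dotp x y : R := \sum_i x 0 i * y 0 i.

(* The squared Euclidean norm; the library norm [`|x|] on row vectors is the
   maximum norm, which defines the same topology. *)
Definition sqnorm x : R := dotp x x.

Definition is_domain D := open D /\ connected D.

Definition boundary D : set 'rV[R]_n := closure D `\` interior D.

Definition bounded_borel D f :=
  measurable_fun D f /\ exists M : R, forall x, D x -> `|f x| <= M.

Definition sup_on D f : R := sup (f @` D).

(* Real functions on [D] are total functions whose values off [D] are
   irrelevant; they are evaluated along paths through this extension by 0. *)
Definition extend0 D f : 'rV[R]_n -> R := patch (fun=> 0) D f.

Definition msupp (mu : {measure set 'rV[R]_n -> \bar R}) : set 'rV[R]_n :=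
  [set x | forall U, open U -> U x -> (0 < mu U)%E].

(* Measures on [D] are encoded as measures on the whole space that do not
   charge the complement of [D]. *)
Definition sigma_finite_on D (mu : {measure set 'rV[R]_n -> \bar R}) :=
  sigma_finite setT mu /\ mu (~` D) = 0%E.

Definition partial (i : 'I_n) f x : R := 'D_(delta_mx 0 i) f x.

Definition grad f x : 'rV[R]_n := \row_i partial i f x.

Definition hess f x : 'M[R]_n := \matrix_(i, j) partial i (partial j f) x.

Definition bounded_continuous f :=
  continuous f /\ exists M : R, forall x, `|f x| <= M.

Definition Cb2 f :=
  [/\ bounded_continuous f,
      forall i, (forall x, derivable f x (delta_mx 0 i)) /\
                bounded_continuous (partial i f)
    & forall i j, (forall x, derivable (partial j f) x (delta_mx 0 i)) /\
                  bounded_continuous (partial i (partial j f))].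

End euclidean.

(** * The operator *)

Section operator.
Context {R : realType} {n : nat}.
Variables (Q : 'rV[R]_n -> 'M[R]_n) (b : 'rV[R]_n -> 'rV[R]_n).
Variable N : R.-ker 'rV[R]_n ~> 'rV[R]_n.

Definition diffusion_coefficient :=
  [/\ forall x, (Q x)^T = Q x,
      forall x (v : 'rV[R]_n), 0 <= (v *m Q x *m v^T) 0 0
    & forall i j, bounded_borel setT (fun x => Q x i j)].

Definition drift_coefficient := forall i, bounded_borel setT (fun x => b x 0 i).

(* A measure on the punctured space is encoded as a measure on the whole space
   without mass at 0. *)
Definition levy_kernel :=
  (forall x, sigma_finite_on (~` [set 0]) (N x)) /\
  (ereal_sup [set \int[N x]_y (Num.min 1 (sqnorm y))%:E | x in setT] < +oo)%E.

Definition generator (u : 'rV[R]_n -> R) (x : 'rV[R]_n) : R :=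
  2^-1 * \tr (Q x *m hess u x) + dotp (b x) (grad u x)
  + \int[N x]_y (u (x + y) - u x - dotp y (grad u x) / (1 + sqnorm y)).

Variable D : set 'rV[R]_n.

Definition jump_range : set 'rV[R]_n :=
  \bigcup_(x in D) [set x + y | y in msupp (N x)].

Definition ext_boundary : set 'rV[R]_n :=
  boundary D `|` (jump_range `\` D).

Definition ext_closure : set 'rV[R]_n := D `|` ext_boundary.

End operator.

(** * Skorokhod space *)

(* Paths on [0, +oo[ are functions on [R] that are constant on ]-oo, 0], so
   that Leibniz equality of paths is equality on [0, +oo[. *)
Definition cadlag {R : realType} {n : nat} (w : R -> 'rV[R]_n) :=
  [/\ forall t, t < 0 -> w t = w 0,
      forall t, 0 <= t -> w s @[s --> t^'+] --> w t
    & forall t, 0 < t -> cvg (w s @[s --> t^'-])].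

Record cadlag_path (R : realType) (n : nat) := Path {
  path_fun :> R -> 'rV[R]_n;
  path_cadlag : cadlag path_fun }.

Section skorokhod.
Context {R : realType} {n : nat}.

Lemma cadlag_cst (x : 'rV[R]_n) : cadlag (fun _ : R => x).
Proof.
split=> [//|t _|t _]; first exact: cvg_cst.
by apply/cvg_ex; exists x; exact: cvg_cst.
Qed.

HB.instance Definition _ := gen_eqMixin (cadlag_path R n).
HB.instance Definition _ := gen_choiceMixin (cadlag_path R n).
HB.instance Definition _ := isPointed.Build (cadlag_path R n) (Path (cadlag_cst 0)).

Definition time_change (lam : R -> R) :=
  set_bij `[0, +oo[ `[0, +oo[ lam /\
  {in `[0, +oo[ &, {homo lam : s t / s < t}}.

(* [skorokhod_nbhs w k (k^-1)] for [k] in [nat] is a base of neighbourhoods of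
   [w] for the usual (J1) topology: w_k --> w if and only if, for all T, there
   are time changes lam_k with sup_(t <= T) |lam_k t - t| --> 0 and
   sup_(t <= T) |w_k t - w (lam_k t)| --> 0. *)
Definition skorokhod_nbhs (w : cadlag_path R n) (T e : R) : set (cadlag_path R n) :=
  [set w' : cadlag_path R n | exists2 lam : R -> R, time_change lam &
     forall t : R, 0 <= t <= T -> `|lam t - t| < e /\ `|w' t - w (lam t)| < e].

Definition skorokhod_open (U : set (cadlag_path R n)) :=
  forall w, U w -> exists T e, 0 < e /\ skorokhod_nbhs w T e `<=` U.

HB.instance Definition _ := @isMeasurable.Build
  (sigma_display skorokhod_open) (cadlag_path R n) <<s skorokhod_open >>
  (@sigma_algebra0 _ setT skorokhod_open) (@sigma_algebraC _ _)
  (@sigma_algebra_bigcup _ setT skorokhod_open).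

(* The sigma-algebra generated by the coordinates up to time t. *)
Definition filtration (t : R) : set (set (cadlag_path R n)) :=
  <<s [set C | exists (s : R) (B : set 'rV[R]_n),
         [/\ 0 <= s <= t, measurable B & C = [set w : cadlag_path R n | B (w s)]]] >>.

Definition martingale (P : {measure set (cadlag_path R n) -> \bar R})
    (M : R -> cadlag_path R n -> R) :=
  [/\ forall (t : R) (B : set R), 0 <= t -> measurable B -> filtration t (M t @^-1` B),
      forall t : R, 0 <= t -> P.-integrable setT (EFin \o M t)
    & forall (s t : R) C, 0 <= s <= t -> filtration s C ->
        (\int[P]_(w in C) (M t w)%:E = \int[P]_(w in C) (M s w)%:E)%E].

Definition stopping_time (T : cadlag_path R n -> \bar R) :=
  (forall w, 0 <= T w)%E /\
  forall t, 0 <= t -> filtration t [set w | (T w <= t%:E)%E].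

Definition stopped_sigma_algebra (T : cadlag_path R n -> \bar R) :
    set (set (cadlag_path R n)) :=
  [set C | measurable C /\
     forall t, 0 <= t -> filtration t (C `&` [set w | (T w <= t%:E)%E])].

(* inf {t > 0 : X_t \notin D} *)
Definition exit_time (D : set 'rV[R]_n) (w : cadlag_path R n) : \bar R :=
  ereal_inf [set t%:E | t in [set t | 0 < t /\ ~ D (w t)]].

End skorokhod.

(** * The martingale problem *)

Section martingale_problem.
Context {R : realType} {n : nat}.
Variable A : ('rV[R]_n -> R) -> 'rV[R]_n -> R.

Definition solves_martingale_problem
    (mu : {measure set 'rV[R]_n -> \bar R})
    (P : {measure set (cadlag_path R n) -> \bar R}) :=
  [/\ P setT = 1%E,
      forall B, measurable B -> P [set w : cadlag_path R n | B (w 0)] = mu B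
    & forall f, Cb2 f -> martingale P (fun t w =>
        f (w t) - f (w 0)
        - \int[lebesgue_measure]_(r in `[0, t]) A f (w r))].

Variable P : R.-pker 'rV[R]_n ~> cadlag_path R n.

Definition strong_markov :=
  forall (x : 'rV[R]_n) (T : cadlag_path R n -> \bar R) (C : set (cadlag_path R n)) (h : R)
    (f : 'rV[R]_n -> R),
  stopping_time T -> stopped_sigma_algebra T C -> 0 <= h ->
  bounded_borel setT f ->
  (\int[P x]_(w in C `&` [set w | T w < +oo]) (f (w (fine (T w) + h)%R))%:E =
   \int[P x]_(w in C `&` [set w | T w < +oo])
     \int[P (w (fine (T w)))]_w' (f (w' h))%:E)%E.

(* Measurability of x |-> P x C is part of the type of [P]. In the last clause
   [Pmu] is the mixture of the [P x] with respect to [mu]. *)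
Definition strong_markov_solution :=
  [/\ forall x, P x [set w : cadlag_path R n | w 0 = x] = 1%E,
      forall x, solves_martingale_problem \d_x (P x),
      strong_markov
    & forall (mu : probability 'rV[R]_n R)
        (Pmu : {measure set (cadlag_path R n) -> \bar R}),
      (forall C, measurable C -> Pmu C = (\int[mu]_x P x C)%E) ->
      solves_martingale_problem mu Pmu].

End martingale_problem.

(** * Killed process, minorization, subsolutions *)

(* The integral of a non-negative function is the sup_on of the integrals of
   the measurable simple functions below it. Hence the events and functions
   built below from the exit time, which are a priori measurable only with
   respect to the completion of [P x], have the same integrals as with respect
   to that completion. *)
Section killed.
Context {R : realType} {n : nat}.
Variable P : R.-pker 'rV[R]_n ~> cadlag_path R n.
Variable D : set 'rV[R]_n.

Definition finite_exit_time :=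
  forall x, D x -> {ae P x, forall w, (exit_time D w < +oo)%E}.

Definition semigroup (t : R) (f : 'rV[R]_n -> R) (x : 'rV[R]_n) : \bar R :=
  (\int[P x]_(w in [set w | t%:E < exit_time D w]) (extend0 D f (w t))%:E)%E.

Definition resolvent (alpha : R) (f : 'rV[R]_n -> R) (x : 'rV[R]_n) : \bar R :=
  (\int[lebesgue_measure]_(t in `[0%R, +oo[)
     ((expR (- (alpha * t)))%:E * semigroup t f x))%E.

Definition minorization (alpha : R) (psi : 'rV[R]_n -> R)
    (nu : {measure set 'rV[R]_n -> \bar R}) :=
  forall f, bounded_borel D f -> (forall x, D x -> 0 <= f x) ->
  forall x, D x ->
    ((psi x)%:E * \int[nu]_(y in D) (f y)%:E <= resolvent alpha f x)%E.

Variable c : 'rV[R]_n -> R.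

Definition killing_rate :=
  bounded_borel D c /\ forall x, D x -> 0 <= c x.

Definition killing (t : R) (w : cadlag_path R n) : R :=
  expR (- \int[lebesgue_measure]_(r in `[0, t]) extend0 D c (w r)).

Definition weak_subsolution (u : 'rV[R]_n -> R) :=
  bounded_borel setT u /\
  forall (x : 'rV[R]_n) (t : R), D x -> 0 <= t ->
    ((u x)%:E <= \int[P x]_w
       (let s := fine (Order.min (exit_time D w) t%:E) in
        (killing s w * u (w s))%:E))%E.

Definition nonneg_sup_subsolution (N : R.-ker 'rV[R]_n ~> 'rV[R]_n)
    (u : 'rV[R]_n -> R) :=
  weak_subsolution u /\ 0 <= sup_on (ext_closure N D) u.

End killed.

(* Main.v *)
Require Import Defs.
From HB Require Import structures.
From mathcomp Require Import all_boot all_order all_algebra.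
From mathcomp Require Import all_classical all_reals all_analysis.
From mathcomp Require Import measurable_realfun.
From mathcomp Require Import ring lra.

(** Let [M] be the supremum of [u] over the extended closure, [alpha] that of [c],
   [v = M - u >= 0] and [(P_t)] the semigroup killed off [D]. Since the process
   leaves [D] at a point where [u <= M], and [M >= 0], the subsolution property
   makes [v] supermedian: [f_t = v - exp (- alpha t) P_t v >= 0]. The function
   [s |-> exp (- alpha s) P_s v] is then nonincreasing, so that the resolvent of
   [f_t] telescopes and is at most [2 t v]; by minorization,
   [psi * \int f_t d nu <= 2 t v]. Either some integral is positive, which gives
   [a], or [v = exp (- alpha t) P_t v] holds [nu]-a.e. for [t = 1, 2, ...], and
   [v = 0] [nu]-a.e. because [P_t v] tends to 0 with the probability of survival.

   That the process exits through the extended closure follows from the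
   martingale problem: with Dynkin's formula for bump functions supported in [D],
   the exit position is a.s. not in [D]; with bump functions supported in a box
   off [D], the law of the exit position there is the expected integral of the
   jump rate, which vanishes off the supports of the Levy measures. *)

Set Implicit Arguments.
Unset Strict Implicit.
Unset Printing Implicit Defensive.

Import Order.TTheory GRing.Theory Num.Theory.
Import numFieldNormedType.Exports.

Local Open Scope classical_set_scope.
Local Open Scope ring_scope.

(** The filtration of the path space is raw, neither completed nor made right-continuous, and the
    exit time need not be measurable for it. The work is therefore done with [survives], which is
    adapted and splits exactly at intermediate times; results are carried over to [exit_time] off a
    null set, with integrals compared without measurability. Path regularity alone does not give
    this transfer: the left limit may reach the boundary of [D] while the path jumps back into [D]
    at that very instant. Such paths are excluded by a form of quasi-left-continuity, obtained from
    Dynkin's formula at the times [level_time] that announce the end of survival.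

    A second obstacle is that [strong_markov] concerns the position at one later time, whereas
    killing depends on the whole path; hence the approximation of survival by products of indicators
    on a grid.

    The rate alpha may be 0, so the decay of the semigroup has to come from the finiteness of the
    exit time. The constant is a = I / (2 t), where I is the integral of f_t for an integer t that
    makes it positive; I is finite because psi is positive at one point of [D]. *)

Section integral_off_null.
Context d (T : measurableType d) (R : realType) (mu : {measure set T -> \bar R}).
Local Open Scope ereal_scope.
Import HBNNSimple.

(* No measurability is needed: the integral is a supremum over the simple
   functions below the integrand, whose values on [Z] do not matter. *)
Lemma integral_le_off_null (Z D1 D2 : set T) (f g : T -> \bar R) :
  measurable Z -> mu Z = 0 ->
  (forall x, ~ Z x -> (f \_ D1) x <= (g \_ D2) x) ->
  \int[mu]_(x in D1) f x <= \int[mu]_(x in D2) g x.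
Proof.
move=> mZ Z0 fg.
have key (p q : T -> \bar R) : (forall x, 0 <= q x) ->
    (forall x, ~ Z x -> p x <= q x) ->
    ereal_sup [set sintegral mu h |
      h in [set h : {nnsfun T >-> R} | forall x, (h x)%:E <= p x]] <=
    ereal_sup [set sintegral mu h |
      h in [set h : {nnsfun T >-> R} | forall x, (h x)%:E <= q x]].
  move=> q0 pq; apply: ge_ereal_sup => _ [h /= hp <-].
  have pE x : proj_nnsfun h (measurableC mZ) x = (h \_ (~` Z)) x :> R.
    by rewrite (mrestrict h (measurableC mZ)).
  apply: ereal_sup_ubound; exists (proj_nnsfun h (measurableC mZ)); rewrite /mkset.
    move=> x; rewrite pE patchE; case: ifPn => // xZ.
    by rewrite (le_trans (hp x))// pq//; rewrite inE in xZ.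
  rewrite -!integralT_nnsfun; apply: ge0_ae_eq_integral => //.
  - exact/measurable_EFinP.
  - exact/measurable_EFinP.
  - by move=> x _; rewrite lee_fin pE patchE; case: ifPn => // _; exact: fun_ge0.
  - by move=> x _ /=; rewrite lee_fin; exact: fun_ge0.
  exists Z; split => // x; apply: contra_notP => xZ _.
  by rewrite pE patchE mem_set.
rewrite /integral; apply: leeB; apply: key => x.
- by [].
- by move=> xZ; rewrite funeposE [leRHS]funeposE ge_max !le_max fg// lexx orbT.
- by [].
- by move=> xZ; rewrite funenegE [leRHS]funenegE ge_max !le_max leeN2 fg// lexx orbT.
Qed.

Lemma integral_eq_off_null (Z D1 D2 : set T) (f g : T -> \bar R) :
  measurable Z -> mu Z = 0 ->
  (forall x, ~ Z x -> (f \_ D1) x = (g \_ D2) x) ->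
  \int[mu]_(x in D1) f x = \int[mu]_(x in D2) g x.
Proof.
move=> mZ Z0 fg; apply/eqP; rewrite eq_le.
by rewrite !(@integral_le_off_null Z)// => x xZ; rewrite fg.
Qed.

Lemma le_integral_nonmeas (D : set T) (f g : T -> \bar R) :
  (forall x, D x -> f x <= g x) ->
  \int[mu]_(x in D) f x <= \int[mu]_(x in D) g x.
Proof.
move=> fg; apply: (@integral_le_off_null set0) => // x _.
by rewrite /patch; case: ifPn => //; rewrite inE => /fg.
Qed.

End integral_off_null.

Lemma lip1_continuous {R : realType} (V : normedModType R) (f : V -> R) :
  (forall x y, `|f x - f y| <= `|x - y|) -> continuous f.
Proof.
move=> fl x; apply/cvgrPdist_le => e e0; near=> y.
apply: le_trans (fl _ _) _.
by near: y; apply: cvgr_dist_le => //; exact: cvg_id.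
Unshelve. all: by end_near. Qed.

(** * Borel sets and the Skorokhod space *)

Section borel_rV.
Context {R : realType} {n : nat}.
Implicit Types (a b x y : 'rV[R]_n) (U : set 'rV[R]_n).

Definition box a b : set 'rV[R]_n := [set x | forall i, a 0 i < x 0 i < b 0 i].

Lemma ball_rV x y (e : R) : 0 < e -> ball x e y <-> forall i, `|x 0 i - y 0 i| < e.
Proof.
move=> e0; rewrite mx_norm_ball /ball_ /=; split=> [xy i|xy].
  have -> : x 0 i - y 0 i = (x - y) 0 i by rewrite !mxE.
  apply: le_lt_trans xy; rewrite [leRHS]mx_normrE.
  exact: (le_bigmax _ (fun j : 'I_1 * 'I_n => `|(x - y) j.1 j.2|) (0, i)).
rewrite [ltLHS]mx_normrE (bigmax_lt _ _)// => -[i j] _ /=.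
by rewrite ord1 !mxE xy.
Qed.

Definition ratbox (q : 'rV[rat]_n * 'rV[rat]_n) : set 'rV[R]_n :=
  box (map_mx ratr q.1) (map_mx ratr q.2).

(* The margin [e] makes the box shrink strictly inside the ball. *)
Lemma ratbox_ball x (e : R) : 0 < e -> exists q, ratbox q x /\
  forall y, (forall i, ratr (q.1 0 i) <= y 0 i <= ratr (q.2 0 i)) -> ball x e y.
Proof.
move=> e0.
have H1 i : exists r : rat, x 0 i - e < ratr r < x 0 i.
  by have [|r] := @rat_in_itvoo R (x 0 i - e) (x 0 i); [lra|rewrite in_itv/=; exists r].
have H2 i : exists r : rat, x 0 i < ratr r < x 0 i + e.
  by have [|r] := @rat_in_itvoo R (x 0 i) (x 0 i + e); [lra|rewrite in_itv/=; exists r].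
have {H1}[f1 H1] := choice H1; have {H2}[f2 H2] := choice H2.
exists (\row_i f1 i, \row_i f2 i); split.
  by move=> i; rewrite !mxE; have := H1 i; have := H2 i; lra.
move=> y /= H; apply/ball_rV => // i.
have := H i; rewrite !mxE ltr_norml; have := H1 i; have := H2 i; lra.
Qed.

Lemma box_open a b : open (box a b).
Proof.
rewrite openE => x bx; apply: (@filter_forall _ _ (fun i (y : 'rV[R]_n) => a 0 i < y 0 i < b 0 i) (nbhs x)) => i.
have : open_nbhs (x 0 i) `]a 0 i, b 0 i[%classic.
  by split; [exact: itv_open|rewrite /= in_itv/=; exact: bx].
by move=> /open_nbhs_nbhs; exact: (@coord_continuous R 1 n 0 i x).
Qed.

Lemma open_ratbox U : open U ->
  U = \bigcup_(q in [set q | ratbox q `<=` U]) ratbox q.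
Proof.
move=> oU; apply/seteqP; split=> [x Ux|x [q /= qU /qU//]].
have [/= e e0 eU] := (nbhs_ballP _ _).1 (open_nbhs_nbhs (conj oU Ux)).
have [q [qx qe]] := ratbox_ball x e0.
exists q => //= y qy; apply: eU; apply: qe => i.
by have := qy i; rewrite !mxE => /andP[/ltW-> /ltW->].
Qed.

Lemma open_rV_measurable U : open U -> measurable U.
Proof. by move=> oU; exact: sub_sigma_algebra. Qed.

Lemma closed_rV_measurable U : closed U -> measurable U.
Proof.
move=> cU; rewrite -(setCK U); apply: measurableC; apply: open_rV_measurable.
exact: closed_openC.
Qed.

Lemma measurable_ratbox_sub d (T : measurableType d) (F : 'rV[rat]_n * 'rV[rat]_n -> set T)
   (P : set ('rV[rat]_n * 'rV[rat]_n)) :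
  (forall q, measurable (F q)) -> measurable (\bigcup_(q in P) F q).
Proof. by move=> mF; rewrite bigcup_mkcond; apply: countable_bigcupT_measurable => // q; case: ifP. Qed.

(** Open sets are countable unions of rational boxes, and the preimage of a box is a finite
    intersection of coordinate preimages. *)
Lemma measurable_fun_rV d (T : measurableType d) (f : T -> 'rV[R]_n) :
  (forall i, measurable_fun setT (fun t => f t 0 i)) <-> measurable_fun setT f.
Proof.
split=> mf; last first.
  move=> i; apply: (@measurability _ _ _ _ _ _ (@RGenOInfty.G R)).
    exact: RGenOInfty.measurableE.
  move=> _ [_ [r ->] <-]; rewrite setTI.
  have := mf measurableT ((fun x : 'rV[R]_n => x 0 i) @^-1` `]r, +oo[); rewrite setTI; apply.
  apply: open_rV_measurable; apply: open_comp; last exact: rray_open.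
  by move=> x _; exact: coord_continuous.
apply: (@measurability _ _ _ _ _ _ (@open 'rV[R]_n)) => //.
move=> _ [U oU <-]; rewrite setTI (open_ratbox oU) preimage_bigcup.
apply: measurable_ratbox_sub => q.
rewrite (_ : _ @^-1` _ = \bigcap_(i in [set: 'I_n])
    ((fun t => f t 0 i) @^-1` `](map_mx ratr q.1 : 'rV[R]_n) 0 i, (map_mx ratr q.2 : 'rV[R]_n) 0 i[)).
  apply: fin_bigcap_measurable; first exact: finite_finset.
  by move=> i _; rewrite -[X in measurable X]setTI; exact: mf.
by apply/seteqP; split=> [x bx i _|x bx i]; have := bx i; rewrite /= in_itv/=; auto.
Qed.

Lemma continuous_rV_measurable (f : 'rV[R]_n -> R) :
  continuous f -> measurable_fun setT f.
Proof.
move=> cf; apply: (@measurability _ _ _ _ _ _ (@RGenOInfty.G R)).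
  exact: RGenOInfty.measurableE.
move=> _ [_ [r ->] <-]; rewrite setTI.
apply: open_rV_measurable; apply: open_comp; last exact: rray_open.
by move=> x _; exact: cf.
Qed.

End borel_rV.

(** * Coordinates, hitting events and the filtration on the path space *)

Section paths.
Context {R : realType} {n : nat}.
Implicit Types (w : cadlag_path R n) (t s : R) (G : set 'rV[R]_n).

Lemma path_neg w t : t < 0 -> w t = w 0.
Proof. by case: (path_cadlag w) => h _ _; exact: h. Qed.

Lemma path_right w t (e : R) : 0 < e ->
  exists2 d, 0 < d & forall s, t <= s < t + d -> ball (w t) e (w s).
Proof.
move=> e0; have [t0|t0] := leP 0 t; last first.
  exists (- t); first by lra.
  move=> s /andP[ts st]; rewrite (path_neg w t0) path_neg; last by lra.
  exact: ballxx.
have [_ /(_ _ t0) h _] := path_cadlag w.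
have /h : nbhs (w t) (ball (w t) e) by exact: nbhsx_ballx.
rewrite /= /at_right withinE/= => -[B [/= d d0 dB] BE].
exists d => // s /andP[]; rewrite le_eqVlt => /orP[/eqP<-|ts sd]; first by move=> _; exact: ballxx.
have : (B `&` [set x | t < x]) s.
  by split=> //; apply: dB => /=; rewrite ltr_norml; lra.
by rewrite -BE => -[].
Qed.

Lemma skorokhod_open_hit (a b : R) G : 0 <= a -> open G ->
  skorokhod_open [set w : cadlag_path R n | exists r, a < r < b /\ G (w r)].
Proof.
move=> a0 oG w [r [/andP[ar rb] Gr]].
have [e1 /= e10 Ge1] := (nbhs_ballP _ _).1 (open_nbhs_nbhs (conj oG Gr)).
(* The margins [r - a] and [b - r] keep the matching time of the perturbed path in ]a, b[. *)
pose e := Num.min e1 (Num.min (r - a) (b - r)).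
have e0 : 0 < e by rewrite !lt_min; apply/and3P; split=> //; lra.
exists (r + e), e; split=> // w' [lam [[lamf lami lams] lamm] H].
have [t] : exists2 t, t \in `[0, +oo[ & lam t = r.
  have : `[0, +oo[%classic r by rewrite /= in_itv/= andbT; lra.
  by move=> /lams[t t0 <-]; exists t.
rewrite in_itv/= andbT => t0 lamt.
(* Closeness is only granted up to time [r + e]. A preimage [t] beyond it would give
   [lam (r + e) < r], a displacement larger than [e]. *)
have tr : t <= r + e.
  rewrite leNgt; apply/negP => tr.
  have [] := H (r + e); first by lra.
  have := lamm (r + e) t; rewrite !in_itv/= !andbT t0 lamt.
  have -> : 0 <= r + e by lra.
  move=> /(_ isT isT tr); rewrite ltr_norml; lra.
have [] := H t; first by rewrite t0 tr.
have : e <= r - a /\ e <= b - r /\ e <= e1.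
  by rewrite /e; rewrite !ge_min !lexx !orbT.
move=> [ea [eb ee1]]; rewrite lamt ltr_norml => h1 h2.
exists t; split; first by lra.
apply: Ge1; apply: (le_ball ee1); rewrite mx_norm_ball /ball_/= distrC //.
Qed.

Lemma measurable_hit (a b : R) G : 0 <= a -> open G ->
  measurable [set w : cadlag_path R n | exists r, a < r < b /\ G (w r)].
Proof. by move=> a0 oG; apply: sub_sigma_algebra; exact: skorokhod_open_hit. Qed.

(** Evaluation at a fixed time is not continuous for the Skorokhod topology. The value at [t] is
    recovered from hitting events just after [t]: by right-continuity a coordinate exceeds [r] at
    [t] if and only if, for some margin, it exceeds [r] by that margin at times arbitrarily close
    after [t]. *)
Lemma measurable_coord t : 0 <= t ->
  measurable_fun setT (fun w : cadlag_path R n => w t).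
Proof.
move=> t0; apply/measurable_fun_rV => i.
apply: (@measurability _ _ _ _ _ _ (@RGenOInfty.G R)).
  exact: RGenOInfty.measurableE.
move=> _ [_ [r ->] <-]; rewrite setTI.
pose G (q : R) := (fun x : 'rV[R]_n => x 0 i) @^-1` `]q, +oo[.
have oG q : open (G q).
  apply: open_comp; last exact: rray_open.
  by move=> x _; exact: coord_continuous.
rewrite (_ : _ @^-1` _ = \bigcup_k \bigcap_m [set w : cadlag_path R n |
   exists s, t < s < t + m.+1%:R^-1 /\ G (r + k.+1%:R^-1) (w s)]).
  by apply: bigcupT_measurable => k; apply: bigcapT_measurable => m; exact: measurable_hit.
apply/seteqP; split=> [w /=|w [k _ h] /=]; rewrite in_itv/= andbT.
  move=> rw; pose e := w t 0 i - r; have e0 : 0 < e by rewrite /e; lra.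
  have e20 : 0 < e / 2 by lra.
  have [d d0 wd] := path_right w t e20.
  have [k _ ke] := near_infty_natSinv_lt (PosNum e20).
  exists k => // m _ /=.
  have : 0 < m.+1%:R^-1 :> R by rewrite invr_gt0.
  move: (m.+1%:R^-1) => u u0; pose s := Num.min (d / 2) (u / 2).
  have s0 : 0 < s by rewrite lt_min !divr_gt0.
  have sm : s <= u / 2 by rewrite /s ge_min lexx orbT.
  have sd : s <= d / 2 by rewrite /s ge_min lexx.
  exists (t + s); split; first by lra.
  rewrite /G/= in_itv/= andbT.
  have /(ball_rV _ _ e20)/(_ i) : ball (w t) (e / 2) (w (t + s)) by apply: wd; lra.
  have := ke k (leqnn k); rewrite /= ltr_norml /e; move: (k.+1%:R^-1) => v; lra.
apply/negP; move/negP; rewrite -leNgt => wr.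
have k0 : 0 < k.+1%:R^-1 :> R by rewrite invr_gt0.
have [d d0 wd] := path_right w t k0.
have [m _ md] := near_infty_natSinv_lt (PosNum d0).
have [s [sm]] := h m I; rewrite /G/= in_itv/= andbT => Gs.
have /(ball_rV _ _ k0)/(_ i) : ball (w t) k.+1%:R^-1 (w s).
  clear wr; by apply: wd; have := md m (leqnn m); move: sm; rewrite /=; move: (m.+1%:R^-1) => u; lra.
rewrite ltr_norml; move: k0 Gs wr; move: (k.+1%:R^-1) => u; lra.
Qed.

Lemma filtration_measurable t (C : set (cadlag_path R n)) : filtration t C -> measurable C.
Proof.
apply: smallest_sub; first exact: sigma_algebra_measurable.
move=> _ [s [B [/andP[s0 _] mB ->]]].
by have := measurable_coord s0 measurableT mB; rewrite setTI.
Qed.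

Lemma filtration_mono s t (C : set (cadlag_path R n)) : s <= t -> filtration s C -> filtration t C.
Proof.
move=> st; apply: sub_sigma_algebra2 => _ [r [B [/andP[r0 rs] mB ->]]].
by exists r, B; rewrite r0 (le_trans rs).
Qed.

Lemma filtration_coord s t B : 0 <= s <= t -> measurable B ->
  filtration t [set w : cadlag_path R n | B (w s)].
Proof. by move=> st mB; apply: sub_sigma_algebra; exists s, B. Qed.

Lemma filtrationT t : filtration t (@setT (cadlag_path R n)).
Proof. by rewrite -setC0; apply: sigma_algebraC; exact: sigma_algebra0. Qed.

Lemma filtration_bigcup t (F : (set (cadlag_path R n))^nat) :
  (forall k, filtration t (F k)) -> filtration t (\bigcup_k F k).
Proof. by move=> mF; apply: sigma_algebra_bigcup. Qed.

Lemma filtration_bigcap t (F : (set (cadlag_path R n))^nat) :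
  (forall k, filtration t (F k)) -> filtration t (\bigcap_k F k).
Proof.
move=> mF; rewrite -[\bigcap_k _]setCK setC_bigcap; apply: sigma_algebraC.
by apply: filtration_bigcup => k; apply: sigma_algebraC; exact: mF.
Qed.

Lemma filtrationI t (A B : set (cadlag_path R n)) :
  filtration t A -> filtration t B -> filtration t (A `&` B).
Proof.
move=> mA mB; rewrite (_ : A `&` B = \bigcap_k (if k is 0%N then A else B)).
  by apply: filtration_bigcap => -[|k].
apply/seteqP; split=> [w [Aw Bw]|w h]; first by move=> [|k] _.
by split; [exact: (h 0%N)|exact: (h 1%N)].
Qed.

Lemma filtration_bigcap_rat t (F : rat -> set (cadlag_path R n)) :
  (forall q, filtration t (F q)) -> filtration t (\bigcap_q F q).
Proof.
move=> mF; rewrite (_ : \bigcap_q F q =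
    \bigcap_k (if unpickle k is Some q then F q else setT)).
  by apply: filtration_bigcap => k; case: unpickle => // ; exact: filtrationT.
apply/seteqP; split=> [w h k _|w h q _]; last by have := h (pickle q) I; rewrite pickleK.
by case: unpickle => // q; exact: h.
Qed.

End paths.

(** * Measurability of right-continuous functions of time *)

Section right_continuous.
Context {R : realType}.

Lemma right_continuous_measurable (f : R -> R) :
  (forall t e, 0 < e -> exists2 d, 0 < d & forall s, t <= s < t + d -> `|f t - f s| < e) ->
  measurable_fun setT f.
Proof.
move=> rf.
(* The multiple of [1 / (k + 1)] strictly after [t]: it tends to [t] from the right, and [f \o g k]
   is constant on each of countably many half-open intervals. *)
pose g k (t : R) : R := ((Num.floor (t * k.+1%:R) + 1)%:~R) / k.+1%:R.
have gE k t : t < g k t <= t + k.+1%:R^-1.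
  rewrite /g ltr_pdivlMr// ler_pdivrMr// mulrDl mulVf//.
  by rewrite floorD1_gt// intrD lerD2r floor_le_tmp.
apply: (@measurable_fun_cvg _ _ _ _ (fun k => f \o g k)).
  move=> k _ B mB; rewrite setTI.
  rewrite (_ : _ @^-1` _ = \bigcup_(z in [set z : int | B (f ((z + 1)%:~R / k.+1%:R))])
    `[z%:~R / k.+1%:R, (z + 1)%:~R / k.+1%:R[%classic).
    by rewrite bigcup_mkcond; apply: countable_bigcupT_measurable => // q; case: ifP.
  apply/seteqP; split => [t /= Bt|t [z /= Bz]].
    exists (Num.floor (t * k.+1%:R)) => //=; rewrite in_itv/=.
    by rewrite ler_pdivrMr// ltr_pdivlMr// floorD1_gt// floor_le_tmp.
  rewrite in_itv/= ler_pdivrMr// ltr_pdivlMr// => h.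
  by rewrite /g (floor_def h).
move=> t _; apply/cvgrPdist_lt => e e0; have [d d0 fd] := rf t e e0.
have [k _ kd] := near_infty_natSinv_lt (PosNum d0).
exists k => // m km /=; apply: fd.
by have := gE m t; have := kd m km; rewrite /=; move: (m.+1%:R^-1) => u; lra.
Qed.

Lemma path_measurable n (w : cadlag_path R n) : measurable_fun setT (w : R -> 'rV[R]_n).
Proof.
apply/measurable_fun_rV => i; apply: right_continuous_measurable => t e e0.
by have [d d0 h] := path_right w t e0; exists d => // s /h /(ball_rV _ _ e0)/(_ i).
Qed.
End right_continuous.

(** * The truncated distance to a set and its closed levels *)

Section gap.
Context {R : realType} {n : nat}.
Implicit Types (F : set 'rV[R]_n) (x y : 'rV[R]_n).

(* The constant 1 covers the case where [F] is empty. *)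
Definition gap F x : R := inf ([set `|x - y| | y in F] `|` [set 1]).

Lemma gap_lb F x : lbound ([set `|x - y| | y in F] `|` [set 1]) 0.
Proof. by move=> _ [[y _ <-]|->] /=. Qed.

Lemma gap_lip F x y : gap F x <= gap F y + `|x - y|.
Proof.
rewrite -lerBlDr; apply: lb_le_inf; first by exists 1; right.
move=> _ [[z Fz <-]|->]; rewrite lerBlDr.
  apply: (@le_trans _ _ `|x - z|).
    by apply: ge_inf; [exists 0; exact: gap_lb|left; exists z].
  by rewrite [leRHS]addrC -(subrKA y x (- z)) ler_normD.
apply: (@le_trans _ _ 1); last by rewrite lerDl.
by apply: ge_inf; [exists 0; exact: gap_lb|right].
Qed.

Lemma gap_continuous F : continuous (gap F).
Proof.
apply: lip1_continuous => x y; have := gap_lip F x y; have := gap_lip F y x.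
by rewrite (distrC y x) ler_norml; lra.
Qed.

Lemma gap_gt0 F x : closed F -> (0 < gap F x) <-> ~ F x.
Proof.
move=> cF; split=> [g0 Fx|nFx].
  suff : gap F x <= 0 by move=> /(lt_le_trans g0); rewrite ltxx.
  apply: ge_inf; [exists 0; exact: gap_lb|left; exists x => //].
  by rewrite subrr normr0.
have oF : open (~` F) by exact: closed_openC.
have [/= e e0 eF] := (nbhs_ballP _ _).1 (open_nbhs_nbhs (conj oF nFx)).
apply: (@lt_le_trans _ _ (Num.min e 1)); first by rewrite lt_min e0 ltr01.
apply: lb_le_inf; first by exists 1; right.
move=> _ [[y Fy <-]|->]; last by rewrite ge_min lexx orbT.
rewrite ge_min leNgt; apply/orP; left; apply/negP => xy.
by apply: (eF y) => //; rewrite mx_norm_ball.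
Qed.

Definition gap_ge F (k : nat) : set 'rV[R]_n := [set x | k.+1%:R^-1 <= gap F x].

Lemma gap_ge_mono F k m : (k <= m)%N -> gap_ge F k `<=` gap_ge F m.
Proof. by move=> km x; apply: le_trans; rewrite lef_pV2 ?posrE// ler_nat. Qed.

Lemma gap_ge_closed F k : closed (gap_ge F k).
Proof.
rewrite (_ : gap_ge F k = gap F @^-1` [set r | k.+1%:R^-1 <= r]).
  by apply: closed_comp; [move=> x _; exact: gap_continuous|exact: closed_ge].
by [].
Qed.

End gap.

(** * The time up to which a property persists *)

Section life.
Context {R : realType}.
Implicit Types (P : R -> Prop) (s t : R).

(** The strict bound [r < s] makes the supremum attained, whence the exact equivalence [life_geP];
    the property may fail at the time [life P t] itself. *)
Definition life P t : R := sup [set s | 0 <= s <= t /\ forall r, 0 <= r < s -> P r].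

Lemma life_has_sup P t : 0 <= t ->
  has_sup [set s | 0 <= s <= t /\ forall r, 0 <= r < s -> P r].
Proof.
move=> t0; split; last by exists t => s [/andP[]].
exists 0; split; first by rewrite lexx.
by move=> r; lra.
Qed.

Lemma life_itv P t : 0 <= t -> 0 <= life P t <= t.
Proof.
move=> t0; have [h1 h2] := life_has_sup P t0; apply/andP; split.
  by apply: ub_le_sup => //; split; [rewrite lexx|move=> r; lra].
by apply: ge_sup => // s [/andP[]].
Qed.

Lemma life_geP P s t : 0 <= s <= t ->
  s <= life P t <-> forall r, 0 <= r < s -> P r.
Proof.
move=> /andP[s0 st]; have t0 := le_trans s0 st.
have [h1 h2] := life_has_sup P t0; split=> [sl r /andP[r0 rs]|h].
  have [s' [_ h] rs'] := sup_gt h1 (lt_le_trans rs sl).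
  by apply: h; rewrite r0.
by apply: ub_le_sup => //; split=> //; rewrite s0.
Qed.

End life.

(** * Survival events and the times that announce the exit *)

Section exit.
Context {R : realType} {n : nat}.
Variable D : set 'rV[R]_n.
Implicit Types (w : cadlag_path R n) (s t : R) (k : nat).

(* The path and its left limits stay in [D] on [0, t]. Unlike
   [t%:E < exit_time D w], this event belongs to the filtration. *)
Definition survives t : set (cadlag_path R n) :=
  [set w | exists k, forall r, 0 <= r <= t -> gap_ge (~` D) k (w r)].

Definition level_time k t w := life (fun r => gap_ge (~` D) k (w r)) t.

(** The first time, capped at [t], at which the path or its left limit meets the complement of [D].
    The times [level_time k t w] approach it from below. *)
Definition survival_time t w := life (fun r => survives r w) t.

(** Rational times suffice: as the complement of [K] is open, a right-continuous path out of [K] at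
    some [r < s] is still out of it at a rational time in ]r, s[. *)
Lemma filtration_before (K : set 'rV[R]_n) s : 0 <= s -> closed K ->
  filtration s [set w : cadlag_path R n | forall r, 0 <= r < s -> K (w r)].
Proof.
move=> s0 cK.
pose F (q : rat) := if 0 <= (ratr q : R) < s then
   [set w : cadlag_path R n | K (w (ratr q))] else setT.
suff -> : [set w : cadlag_path R n | forall r, 0 <= r < s -> K (w r)] = \bigcap_q F q.
  rewrite /F; apply: filtration_bigcap_rat => q; case: ifP => [/andP[q0 qs]|_].
    by apply: filtration_coord; [rewrite q0 ltW|exact: closed_rV_measurable].
  exact: filtrationT.
apply/seteqP; split=> [w /= h q _|w h r /andP[r0 rs]].
  by rewrite /F; case: ifPn => // qs; exact: h.
rewrite -(setCK K) => nK.
have [/= e e0 eK] := (nbhs_ballP _ _).1 (open_nbhs_nbhs (conj (closed_openC cK) nK)).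
have [d d0 wd] := path_right w r e0.
have [|q] := @rat_in_itvoo R r (Num.min (r + d) s).
  by rewrite lt_min rs andbT; lra.
rewrite in_itv/= lt_min => /and3P[rq qd qs].
have qs' : 0 <= (ratr q : R) < s by rewrite qs andbT; lra.
have := h q I; rewrite /F qs' /= => Kq.
by apply: (eK (w (ratr q))) => //; apply: wd; rewrite qd ltW.
Qed.

Lemma filtration_survives t : 0 <= t -> filtration t (survives t).
Proof.
move=> t0; rewrite (_ : survives t = \bigcup_k
   ([set w : cadlag_path R n | forall r, 0 <= r < t -> gap_ge (~` D) k (w r)] `&`
   [set w : cadlag_path R n | gap_ge (~` D) k (w t)])).
  apply: filtration_bigcup => k; apply: filtrationI.
    by apply: filtration_before => //; exact: gap_ge_closed.
  apply: filtration_coord; first by rewrite t0 lexx.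
  by apply: closed_rV_measurable; exact: gap_ge_closed.
apply/seteqP; split=> [w [k h]|w [k _ [h1 h2]]].
  exists k => //; split=> [r /= /andP[r0 rt]|/=]; apply: h; first by rewrite r0 ltW.
  by rewrite t0 lexx.
exists k => r /andP[r0]; rewrite le_eqVlt => /predU1P[->//|rt].
by apply: h1; rewrite r0.
Qed.

Lemma survives_mono s t : s <= t -> survives t `<=` survives s.
Proof. by move=> st w [k h]; exists k => r /andP[r0 rs]; apply: h; rewrite r0 (le_trans rs). Qed.

Lemma filtration_level_time k s t : 0 <= s <= t ->
  filtration s [set w | s <= level_time k t w].
Proof.
move=> st; have s0 : 0 <= s by case/andP: st.
rewrite [X in filtration s X](_ : _ = [set w : cadlag_path R n | forall r, 0 <= r < s -> gap_ge (~` D) k (w r)]).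
  by apply: filtration_before => //; exact: gap_ge_closed.
by apply/seteqP; split=> w /=; rewrite (life_geP _ st).
Qed.

(** Only survival strictly before [s] matters, so no right-continuity of the filtration is involved.
    Events of this form are what the optional stopping argument below asks for. *)
Lemma filtration_survival_time s t : 0 <= s <= t ->
  filtration s [set w | s <= survival_time t w].
Proof.
move=> st; have s0 : 0 <= s by case/andP: st.
pose F (q : rat) := if 0 <= (ratr q : R) < s then survives (ratr q) else setT.
suff -> : [set w | s <= survival_time t w] = \bigcap_q F q.
  rewrite /F; apply: filtration_bigcap_rat => q; case: ifP => [/andP[q0 qs]|_]; last exact: filtrationT.
  by apply: (filtration_mono (ltW qs)); exact: filtration_survives.
apply/seteqP; split=> w /=; rewrite (life_geP _ st) => h.
  by move=> q _; rewrite /F; case: ifPn => // qs; exact: h.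
move=> r /andP[r0 rs]; have [q] := @rat_in_itvoo R r s rs.
rewrite in_itv/= => /andP[rq qs]; apply: (survives_mono (ltW rq)).
have qs' : 0 <= (ratr q : R) < s by rewrite qs andbT; lra.
by have := h q I; rewrite /F qs'.
Qed.

Lemma level_time_le k t w : 0 <= t -> level_time k t w <= survival_time t w.
Proof.
move=> t0; apply/life_geP; first exact: life_itv.
move=> r /andP[r0 rl]; exists k => q /andP[q0 qr].
have lt := life_itv (fun r => gap_ge (~` D) k (w r)) t0.
by apply: ((life_geP _ lt).1 (lexx _)); rewrite q0 (le_lt_trans qr).
Qed.

Lemma cvg_level_time t w : 0 <= t ->
  level_time k t w @[k --> \oo] --> survival_time t w.
Proof.
move=> t0; apply/cvgrPdist_lt => e e0.
have lt := life_itv (fun r => survives r w) t0.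
have h := (life_geP _ lt).1 (lexx _).
rewrite -/(survival_time t w) in lt h; case/andP: lt => l0 lt.
have [le|el] := ltP (survival_time t w) e.
  exists 0%N => // k _ /=; have := level_time_le k w t0.
  have /andP[] := life_itv (fun r => gap_ge (~` D) k (w r)) t0.
  by rewrite -/(level_time k t w) ltr_norml; lra.
(* Survival is only known strictly before the survival time, hence the retreat by [e / 2]; one level
   then serves on the whole of [0, r]. *)
pose r := survival_time t w - e / 2.
have [|k hk] := h r; first by rewrite /r; lra.
exists k => // m /= km; have := level_time_le m w t0.
have : r <= level_time m t w.
  apply/life_geP; first by rewrite /r; lra.
  by move=> q /andP[q0 qr]; apply: (gap_ge_mono km); apply: hk; rewrite q0 ltW.
by rewrite ltr_norml /r; lra.
Qed.

Hypothesis oD : open D.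

Lemma gap_gt0D x : (0 < gap (~` D) x) <-> D x.
Proof.
have [h1 h2] := gap_gt0 x (open_closedC oD).
split=> [/h1/contrapT//|Dx]; apply: h2 => nDx; exact: nDx Dx.
Qed.

Lemma gap_geD k : gap_ge (~` D) k `<=` D.
Proof. by move=> x h; apply/gap_gt0D; apply: lt_le_trans h; rewrite invr_gt0. Qed.

Lemma survives_extend k w t : 0 <= t -> k.+1%:R^-1 < gap (~` D) (w t) ->
  (forall r, 0 <= r < t -> gap_ge (~` D) k (w r)) ->
  exists2 d, 0 < d & forall r, 0 <= r < t + d -> gap_ge (~` D) k (w r).
Proof.
move=> t0 kt h; pose e := gap (~` D) (w t) - k.+1%:R^-1.
have e0 : 0 < e by rewrite /e subr_gt0.
have [d d0 wd] := path_right w t e0; exists d => // r /andP[r0 rd].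
have [rt|tr] := ltP r t; first by apply: h; rewrite r0.
have : ball (w t) e (w r) by apply: wd; rewrite tr.
rewrite mx_norm_ball /ball_/= /gap_ge/= /e; have := gap_lip (~` D) (w t) (w r).
by move: kt; move: (k.+1%:R^-1) => u; lra.
Qed.

(** With a larger gap at that time, [survives_extend] would prolong the stay in the level, either
    past its supremum or up to [t], which would be survival. *)
Lemma level_time_gap k t w : 0 <= t -> ~ survives t w ->
  gap (~` D) (w (level_time k t w)) <= k.+1%:R^-1.
Proof.
move=> t0 nA; rewrite leNgt; apply/negP => g.
have lt := life_itv (fun r => gap_ge (~` D) k (w r)) t0.
have h := (life_geP _ lt).1 (lexx _); rewrite -/(level_time k t w) in lt h.
have l0 : 0 <= level_time k t w by case/andP: lt.
have [d d0 hd] := survives_extend l0 g h.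
have [lk|kl] := leP t (level_time k t w).
  apply: nA; exists k => r /andP[r0 rt]; apply: hd; rewrite r0/=; lra.
pose s := Num.min t (level_time k t w + d).
have : s <= level_time k t w.
  apply/life_geP; first by rewrite le_min t0 ge_min lexx/= andbT; lra.
  move=> r; rewrite lt_min => /and3P[r0 rt rd]; apply: hd; lra.
by rewrite leNgt lt_min kl/=; lra.
Qed.

Lemma survives_exit t w : 0 <= t -> survives t w -> (t%:E < exit_time D w)%E.
Proof.
move=> t0 [k h].
(* At the next level the inequality is strict, so the path stays in [D] a little beyond [t]; this
   gives the strict inequality for the exit time. *)
have kt : k.+2%:R^-1 < gap (~` D) (w t).
  apply: lt_le_trans (h t _); last by rewrite t0 lexx.
  by rewrite ltf_pV2 ?posrE// ltr_nat.
have [|d d0 hd] := survives_extend t0 kt.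
  by move=> r /andP[r0 rt]; apply: (gap_ge_mono (leqnSn k)); apply: h; rewrite r0 ltW.
apply: (@lt_le_trans _ _ (t + d)%:E); first by rewrite lte_fin; lra.
apply: le_ereal_inf_tmp => _ [s [s0 nD] <-]; rewrite lee_fin leNgt; apply/negP => sd.
by apply/nD/(@gap_geD k.+1)/hd; rewrite sd (ltW s0).
Qed.

Lemma survives_time t w : 0 <= t -> survives t w -> survival_time t w = t.
Proof.
move=> t0 h; have /andP[l0 lt] := life_itv (fun r => survives r w) t0.
apply/eqP; rewrite eq_le lt/=; apply/life_geP; first by rewrite t0 lexx.
by move=> r /andP[r0 /ltW rt]; exact: (survives_mono rt).
Qed.

Lemma before_survival_time t w r : 0 <= t -> 0 <= r < survival_time t w -> D (w r).
Proof.
move=> t0 /andP[r0 rl]; have lt := life_itv (fun r => survives r w) t0.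
have [|k h] := (life_geP _ lt).1 (lexx _) r; first by rewrite r0.
by apply/(@gap_geD k)/h; rewrite r0 lexx.
Qed.

Lemma exit_survival_time t w : 0 <= t -> D (w 0) ->
  ~ D (w (survival_time t w)) -> exit_time D w = (survival_time t w)%:E.
Proof.
move=> t0 D0 nD; have /andP[l0 lt] := life_itv (fun r => survives r w) t0.
rewrite -/(survival_time t w) in l0 lt.
apply/eqP; rewrite eq_le; apply/andP; split.
  apply: ereal_inf_lbound; exists (survival_time t w) => //; split=> //.
  (* The exit time ranges over positive times only; a zero survival time would put the starting
     point off [D]. *)
  by rewrite lt_neqAle l0 andbT; apply/eqP => l; rewrite -l in nD.
apply: le_ereal_inf_tmp => _ [s [s0 nDs] <-]; rewrite lee_fin leNgt; apply/negP => sd.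
by apply: nDs; apply: (before_survival_time t0); rewrite (ltW s0).
Qed.

End exit.

(** * Smooth bump functions *)

Section pospart.
Context {R : realType}.
Implicit Types (a b s z : R) (k : nat) (h g : R -> R).

(** Truncated powers; the third one is twice continuously differentiable, as test functions in [Cb2]
    have to be. *)
Definition pospart k z : R := Num.max z 0 ^+ k.

Lemma pospart_ge0 k z : 0 <= pospart k z.
Proof. by rewrite exprn_ge0// le_max lexx orbT. Qed.

Lemma pospart_eq0 k z : z <= 0 -> pospart k.+1 z = 0.
Proof. by move=> z0; rewrite /pospart max_r// expr0n. Qed.

Lemma pospart_gt0 k z : 0 < z -> 0 < pospart k z.
Proof. by move=> z0; rewrite /pospart max_l ?ltW// exprn_gt0. Qed.

Lemma pospart_le k z c : 0 <= c -> z <= c -> pospart k z <= c ^+ k.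
Proof. by move=> c0 zc; rewrite lerXn2r ?nnegrE// ?le_max ?lexx ?orbT// ge_max zc. Qed.

Lemma is_derive_pospart k z :
  is_derive z 1 (pospart k.+2) (k.+2%:R * pospart k.+1 z).
Proof.
have [z0|z0|->] := ltgtP z 0.
- rewrite pospart_eq0 ?ltW// mulr0.
  apply: (@near_eq_is_derive _ _ _ (cst 0)).
    by apply: filterS (lt_nbhsl z0) => y y0; rewrite pospart_eq0// ltW.
- have H : is_derive z 1 (fun y : R => y ^+ k.+2) (k.+2%:R * pospart k.+1 z).
    have := @is_deriveX R R id k.+2 z 1 1 (is_derive_id z (1 : R)).
    rewrite (_ : (id : R -> R) ^+ k.+2 = fun y => y ^+ k.+2); last first.
      by apply/funext => y; rewrite exprfctE.
    by rewrite /GRing.scale/= mulr1 /pospart max_l ?ltW.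
  apply: near_eq_is_derive H.
  by apply: filterS (lt_nbhsr z0) => y y0; rewrite /pospart max_l// ltW.
- rewrite pospart_eq0// mulr0.
  (* At 0 the difference quotient vanishes on the left and, the exponent being at least 2, is at
     most [h] on the right when [h <= 1]. *)
  have cv : h^-1 *: ((pospart k.+2 \o shift 0) (h *: (1:R)) - pospart k.+2 0) @[h --> 0^'] --> (0:R).
    apply/cvgrPdist_le => e e0; near=> h.
    rewrite /= addr0 [h *: 1]mulr1 (@pospart_eq0 k.+1 0)// subr0 sub0r normrN.
    have h0 : h != 0 by near: h; exact: nbhs_dnbhs_neq.
    have he : `|h| <= Num.min e 1.
      near: h; apply: dnbhs0_le; by rewrite lt_min e0 ltr01.
    rewrite normrM normfV ler_pdivrMl ?normr_gt0//.
    have [hn|hp] := leP h 0; first by rewrite pospart_eq0// normr0 mulr_ge0// ltW.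
    rewrite /pospart (max_l (ltW hp)) normrX gtr0_norm// exprS ler_pM2l//.
    move: he; rewrite gtr0_norm// le_min => /andP[he h1].
    by rewrite exprS (le_trans _ he)// (ler_piMr (ltW hp))// exprn_ile1// (ltW hp).
  by apply: DeriveDef; [apply/cvg_ex; exists 0|apply/cvg_lim].
Unshelve. all: by end_near. Qed.

Lemma pospart_continuous k : continuous (pospart k).
Proof.
move=> z; apply: (@continuous_comp R R R (fun y => Num.max y 0) (fun y => y ^+ k) z).
  apply: (@lip1_continuous R R^o) => x y; rewrite /Num.max.
  have := ler_norm (x - y); have := ler_norm (y - x); rewrite (distrC y x) => h1 h2.
  have h3 : 0 <= `|x - y| by [].
  by have [x0|x0] := ltP x 0; have [y0|y0] := ltP y 0; rewrite ler_norml; lra.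
exact: exprn_continuous.
Qed.
End pospart.

(** * Bounded functions of class C2 on the line *)

Section C2b.
Context {R : realType}.
Implicit Types (a b s z : R) (h g : R -> R).

Definition C2b h h1 h2 :=
  [/\ forall x : R, is_derive x 1 h (h1 x), forall x : R, is_derive x 1 h1 (h2 x),
      continuous h2 & exists M, forall x, [/\ `|h x| <= M, `|h1 x| <= M & `|h2 x| <= M]].

Lemma is_derive_continuous h h1 : (forall x : R, is_derive x 1 h (h1 x)) -> continuous h.
Proof.
by move=> H x; apply/differentiable_continuous/derivable1_diffP; case: (H x).
Qed.

Lemma C2b_cst a : C2b (cst a) (cst 0) (cst 0).
Proof.
split => [x|x|x|]; [exact: is_derive_cst..|exact: cvg_cst|].
by exists `|a| => x; rewrite /= normr0.
Qed.

Lemma C2b_sub h h1 h2 g g1 g2 : C2b h h1 h2 -> C2b g g1 g2 ->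
  C2b (fun x => h x - g x) (fun x => h1 x - g1 x) (fun x => h2 x - g2 x).
Proof.
move=> [a1 a2 a3 [M aM]] [b1 b2 b3 [N bN]]; split.
- by move=> x; apply: is_deriveB.
- by move=> x; apply: is_deriveB.
- by move=> x; apply: cvgB; [exact: a3|exact: b3].
exists (M + N) => x; have [? ? ?] := aM x; have [? ? ?] := bN x.
by split; apply: le_trans (ler_normB _ _) _; exact: lerD.
Qed.

Lemma C2b_mul h h1 h2 g g1 g2 : C2b h h1 h2 -> C2b g g1 g2 ->
  C2b (fun x => h x * g x) (fun x => h x * g1 x + h1 x * g x)
    (fun x => (h x * g2 x + h1 x * g1 x) + (h1 x * g1 x + h2 x * g x)).
Proof.
move=> [a1 a2 a3 [M aM]] [b1 b2 b3 [N bN]].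
have dM (f f' k k' : R -> R) : (forall x : R, is_derive x 1 f (f' x)) -> (forall x : R, is_derive x 1 k (k' x)) ->
    forall x : R, is_derive x 1 (fun x => f x * k x) (f x * k' x + f' x * k x).
  move=> F K x; have := is_deriveM (F x) (K x) => H; apply: is_derive_eq.
  by rewrite /GRing.scale/= [k x * _]mulrC.
have ch := is_derive_continuous a1; have ch1 := is_derive_continuous a2.
have cg := is_derive_continuous b1; have cg1 := is_derive_continuous b2.
split.
- exact: dM.
- by move=> x; apply: is_deriveD; exact: dM.
- by move=> x; apply: cvgD; apply: cvgD; apply: cvgM;
    [exact: ch|exact: b3|exact: ch1|exact: cg1|exact: ch1|exact: cg1|exact: a3|exact: cg].
exists (M * N + M * N + (M * N + M * N)) => x; have [A0 A1 A2] := aM x; have [B0 B1 B2] := bN x.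
have p u v : `|u| <= M -> `|v| <= N -> `|u * v| <= M * N.
  by move=> uM vN; rewrite normrM ler_pM.
have MN : 0 <= M * N by rewrite mulr_ge0// (le_trans (normr_ge0 _) A0, le_trans (normr_ge0 _) B0).
split; first by apply: le_trans (p _ _ A0 B0) _; lra.
  apply: le_trans (ler_normD _ _) _; have := p _ _ A0 B1; have := p _ _ A1 B0; lra.
apply: le_trans (ler_normD _ _) _; apply: lerD; apply: le_trans (ler_normD _ _) _;
 apply: lerD; exact: p.
Qed.

Definition isC2b h := exists h1 h2, C2b h h1 h2.

Lemma isC2b_cst a : isC2b (cst a).
Proof. by exists (cst 0), (cst 0); exact: C2b_cst. Qed.

Lemma isC2b_sub h g : isC2b h -> isC2b g -> isC2b (fun x => h x - g x).
Proof. by move=> [h1 [h2 H]] [g1 [g2 G]]; eexists; eexists; exact: C2b_sub H G. Qed.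

Lemma isC2b_mul h g : isC2b h -> isC2b g -> isC2b (fun x => h x * g x).
Proof. by move=> [h1 [h2 H]] [g1 [g2 G]]; eexists; eexists; exact: C2b_mul H G. Qed.

Lemma isC2b_exp h k : isC2b h -> isC2b (fun x => h x ^+ k).
Proof.
move=> hC; elim: k => [|k IH]; first exact: isC2b_cst.
by under eq_fun do rewrite exprS; exact: isC2b_mul.
Qed.

(** The factors are unbounded, so [isC2b_mul] does not apply. Every term of the derivatives still
    contains a positive power of both factors, hence vanishes off ]a, b[ and is bounded by a power
    of [b - a]. *)
Lemma isC2b_bump a b : isC2b (fun s => pospart 3 (s - a) * pospart 3 (b - s)).
Proof.
pose L k s := pospart k (s - a); pose U k s : R := pospart k (b - s).
have dL k s : is_derive s 1 (L k.+2) (k.+2%:R * L k.+1 s).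
  have h : is_derive s 1 (fun s => s - a) (1 - 0) by apply: is_deriveB.
  have := @is_derive1_comp R _ (fun s => s - a) s _ _ (is_derive_pospart k (s - a)) h.
  by rewrite subr0 mulr1.
have dU k s : is_derive s 1 (U k.+2) (- (k.+2%:R * U k.+1 s)).
  have h : is_derive s 1 (fun s => b - s) (0 - 1) by apply: is_deriveB.
  have := @is_derive1_comp R _ (fun s => b - s) s _ _ (is_derive_pospart k (b - s)) h.
  by rewrite sub0r mulrN1.
have cL k : continuous (L k).
  move=> s; apply: (@continuous_comp _ _ _ (fun s => s - a)); last exact: pospart_continuous.
  by apply: cvgB; [exact: cvg_id|exact: cvg_cst].
have cU k : continuous (U k).
  move=> s; apply: (@continuous_comp _ _ _ (fun s => b - s)); last exact: pospart_continuous.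
  by apply: cvgB; [exact: cvg_cst|exact: cvg_id].
have LU j k s : `|L j.+1 s * U k.+1 s| <= `|b - a| ^+ (j.+1 + k.+1).
  rewrite ger0_norm ?mulr_ge0 ?pospart_ge0//.
  have [sa|sa] := leP (s - a) 0; first by rewrite /L pospart_eq0// mul0r exprn_ge0.
  have [sb|sb] := leP (b - s) 0; first by rewrite /U pospart_eq0// mulr0 exprn_ge0.
  have ab : `|b - a| = b - a by rewrite ger0_norm; lra.
  by rewrite exprD ler_pM ?pospart_ge0// ab pospart_le; lra.
have dM (f k : R -> R) (f' k' x : R) : is_derive x 1 f f' -> is_derive x 1 k k' ->
    is_derive x 1 (fun x => f x * k x) (f x * k' + f' * k x).
  move=> F K; have := is_deriveM F K => H; apply: is_derive_eq.
  by rewrite /GRing.scale/= [k x * _]mulrC.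
exists (fun s => 3 * (L 2 s * U 3 s) - 3 * (L 3 s * U 2 s)).
exists (fun s => 6 * (L 1 s * U 3 s) - 18 * (L 2 s * U 2 s) + 6 * (L 3 s * U 1 s)).
split=> [s|s|s|].
- have := dM _ _ _ _ _ (dL 1%N s) (dU 1%N s).
  by move=> H; apply: is_derive_eq; ring.
- have d1 := dM _ _ _ _ _ (dL 0%N s) (dU 1%N s).
  have d2 := dM _ _ _ _ _ (dL 1%N s) (dU 0%N s).
  have e1 := @is_deriveZ _ _ _ _ 3 s 1 _ d1.
  have e2 := @is_deriveZ _ _ _ _ 3 s 1 _ d2.
  have H := is_deriveB e1 e2.
  by apply: is_derive_eq; rewrite /GRing.scale/=; ring.
- apply: cvgD; [apply: cvgB|]; (apply: cvgM; [exact: cvg_cst|]); apply: cvgM;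
   by [exact: cL|exact: cU].
pose m j k := `|b - a| ^+ (j + k).
have m0 j k : 0 <= m j k by exact: exprn_ge0.
exists (m 3%N 3%N + 3 * m 2%N 3%N + 3 * m 3%N 2%N + 6 * m 1%N 3%N + 18 * m 2%N 2%N + 6 * m 3%N 1%N) => s.
have := LU 2%N 2%N s; have := LU 1%N 2%N s; have := LU 2%N 1%N s.
have := LU 0%N 2%N s; have := LU 1%N 1%N s; have := LU 2%N 0%N s.
rewrite -!/(m _ _).
have := m0 3%N 3%N; have := m0 2%N 3%N; have := m0 3%N 2%N; have := m0 1%N 3%N;
  have := m0 2%N 2%N; have := m0 3%N 1%N.
by rewrite !ler_norml -!/(L _ s) -!/(U _ s); split; lra.
Qed.

(* The powers turn a bump positive on ]a, b[ into functions increasing to the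
   indicator of ]a, b[. *)
Definition bump a b s : R :=
  pospart 3 (s - a) * pospart 3 (b - s) * (`|b - a| ^+ 6 + 1)^-1.

Definition smooth_ind a b (m : nat) s : R := 1 - (1 - bump a b s) ^+ m.+1.

Lemma isC2b_smooth_ind a b m : isC2b (smooth_ind a b m).
Proof.
apply: (isC2b_sub (isC2b_cst 1)); apply: isC2b_exp; apply: (isC2b_sub (isC2b_cst 1)).
by apply: isC2b_mul; [exact: isC2b_bump|exact: isC2b_cst].
Qed.

(** On ]a, b[ each truncated cube is at most the cube of [b - a], which explains the sixth power in
    the normalization; the added 1 keeps the denominator positive when [a = b]. *)
Lemma bump_itv a b s : 0 <= bump a b s <= 1.
Proof.
have q : 0 < `|b - a| ^+ 6 + 1 by rewrite ltr_wpDl// exprn_ge0.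
apply/andP; split; first by rewrite mulr_ge0 ?invr_ge0 ?(ltW q)// mulr_ge0 ?pospart_ge0.
rewrite /bump ler_pdivrMr// mul1r.
have [sa|sa] := leP (s - a) 0; first by rewrite pospart_eq0// mul0r ltW.
have [sb|sb] := leP (b - s) 0; first by rewrite (@pospart_eq0 _ 2 (b - s))// mulr0 ltW.
apply: (@le_trans _ _ (`|b - a| ^+ 6)); last by rewrite lerDl.
have ab : `|b - a| = b - a by rewrite ger0_norm; lra.
by rewrite (exprD _ 3 3) ler_pM ?pospart_ge0// ab pospart_le; lra.
Qed.

Lemma bump_gt0 a b s : (0 < bump a b s) = (a < s < b).
Proof.
have q : 0 < (`|b - a| ^+ 6 + 1)^-1 by rewrite invr_gt0 ltr_wpDl// exprn_ge0.
apply/idP/idP => [|/andP[sa sb]]; last first.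
  by rewrite mulr_gt0// mulr_gt0// pospart_gt0// subr_gt0.
apply: contraLR; rewrite negb_and -!leNgt => /orP[sa|sb].
  by rewrite /bump pospart_eq0 ?subr_le0// !mul0r.
by rewrite /bump (@pospart_eq0 _ 2 (b - s)) ?subr_le0// mulr0 mul0r.
Qed.

Lemma smooth_ind_itv a b m s : 0 <= smooth_ind a b m s <= 1.
Proof.
have /andP[b0 b1] := bump_itv a b s.
have h0 : 0 <= 1 - bump a b s by lra.
have h1 : 1 - bump a b s <= 1 by lra.
by rewrite /smooth_ind; have := exprn_ile1 m.+1 h0 h1; have := exprn_ge0 m.+1 h0; lra.
Qed.

Lemma smooth_ind_out a b m s : ~~ (a < s < b) -> smooth_ind a b m s = 0.
Proof.
rewrite -bump_gt0 -leNgt => b0; have /andP[b1 _] := bump_itv a b s.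
have -> : smooth_ind a b m s = 1 - (1 - 0) ^+ m.+1.
  by congr (1 - (1 - _) ^+ _); apply/eqP; rewrite eq_le b0.
by rewrite subr0 expr1n subrr.
Qed.

Lemma smooth_ind_gt0 a b m s : a < s < b -> 0 < smooth_ind a b m s.
Proof.
rewrite -bump_gt0 => b0; have /andP[_ b1] := bump_itv a b s.
have h0 : 0 <= 1 - bump a b s by lra.
have h1 : 1 - bump a b s < 1 by lra.
by rewrite subr_gt0 exprn_ilt1.
Qed.

Lemma smooth_ind_mono a b s : nondecreasing_seq (fun m => smooth_ind a b m s).
Proof.
move=> m k mk; rewrite lerB// ler_wiXn2l//.
- by have := bump_itv a b s; lra.
- by have := bump_itv a b s; lra.
Qed.

Lemma smooth_ind_cvg a b s : a < s < b -> smooth_ind a b m s @[m --> \oo] --> (1 : R).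
Proof.
rewrite -bump_gt0 => b0; have /andP[_ b1] := bump_itv a b s.
rewrite -[X in _ --> X]subr0; apply: cvgB; first exact: cvg_cst.
rewrite (cvg_shiftS (fun m => (1 - bump a b s) ^+ m)).
by apply: cvg_expr; rewrite ger0_norm; lra.
Qed.
End C2b.

(** * Products of functions of one coordinate and smoothed boxes *)

Section product_functions.
Context {R : realType} {n : nat}.
Implicit Types (h : 'I_n -> R -> R) (x : 'rV[R]_n).

Lemma is_derive_line (V : normedModType R) (f : V -> R) (x v : V) (df : R) :
  is_derive (0 : R) 1 (fun s => f (s *: v + x)) df -> is_derive x v f df.
Proof.
move=> [dv <-]; apply: DeriveDef; first exact/derivable1P.
rewrite /derive; set g1 := fun t => t^-1 *: _; set g2 := fun t => t^-1 *: _.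
suff -> : g1 = g2 by [].
rewrite funeqE /g1 /g2 => s /=.
by rewrite addr0 scale0r add0r [_%:A]mulr1.
Qed.

Definition prodf h x : R := \prod_i h i (x 0 i).

Lemma is_derive_prodf h (j : 'I_n) (k : R -> R) x :
  (forall s : R, is_derive s 1 (h j) (k s)) ->
  is_derive x (delta_mx 0 j) (prodf h) (prodf (fun i => if i == j then k else h i) x).
Proof.
move=> hk; apply: (@is_derive_line 'rV[R]_n).
pose K := \prod_(i | i != j) h i (x 0 i).
have -> : (fun s : R => prodf h (s *: delta_mx 0 j + x)) = (fun s => K * h j (s + x 0 j)).
  apply/funext => s; rewrite /prodf (bigD1 j)//= !mxE !eqxx mulr1 mulrC; congr (_ * _).
  by apply: eq_bigr => i ij; rewrite !mxE (negbTE ij) andbF mulr0 add0r.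
have d1 : is_derive (0 : R) 1 (fun s => s + x 0 j) 1.
  by have := @is_deriveD R R R id (cst (x 0 j)) 0 1 1 0 _ _; rewrite addr0; apply.
have := @is_derive1_comp R (h j) (fun s => s + x 0 j) 0 _ _ (hk _) d1.
move=> /(@is_deriveZ R R R _ K 0 1 _) d2.
apply: is_derive_eq d2 _.
rewrite /GRing.scale/= add0r mulr1 /prodf (bigD1 j)//= eqxx mulrC; congr (_ * _).
by apply: eq_bigr => i /negbTE ->.
Qed.

Lemma bounded_continuous_prodf h :
  (forall i, continuous (h i) /\ exists M, forall s, `|h i s| <= M) ->
  bounded_continuous (prodf h).
Proof.
move=> H; split.
  rewrite /prodf; elim: (index_enum _) => [|i s IH] x.
    under eq_fun do rewrite big_nil.
    exact: cst_continuous.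
  under eq_fun do rewrite big_cons.
  apply: (@continuousM R 'rV[R]_n); last exact: IH.
  have : {for x, continuous (h i \o (fun x : 'rV[R]_n => x 0 i))}.
    apply: continuous_comp; first exact: coord_continuous.
    exact: (H i).1.
  exact.
have [M HM] := choice (fun i => (H i).2).
exists (\prod_i M i) => x; rewrite /prodf normr_prod; apply: ler_prod => i _.
by rewrite normr_ge0 HM.
Qed.

(** A partial derivative replaces one factor by its derivative, so that all those of order at most
    two are again products of bounded continuous factors. *)
Lemma Cb2_prodf h : (forall i, isC2b (h i)) -> Cb2 (prodf h).
Proof.
move=> /choice[h1 /choice[h2 H]].
have b0 i : continuous (h i) /\ exists M, forall s, `|h i s| <= M.
  have [a1 a2 _ [M aM]] := H i; split; first exact: is_derive_continuous a1.
  by exists M => s; have [] := aM s.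
have b1 i : continuous (h1 i) /\ exists M, forall s, `|h1 i s| <= M.
  have [a1 a2 _ [M aM]] := H i; split; first exact: is_derive_continuous a2.
  by exists M => s; have [] := aM s.
have b2 i : continuous (h2 i) /\ exists M, forall s, `|h2 i s| <= M.
  have [a1 a2 a3 [M aM]] := H i; split; first exact: a3.
  by exists M => s; have [] := aM s.
pose hj j i := if i == j then h1 j else h i.
have d1 j x : is_derive x (delta_mx 0 j) (prodf h) (prodf (hj j) x).
  by apply: is_derive_prodf => s; have [] := H j.
have p1 j : partial j (prodf h) = prodf (hj j).
  by apply/funext => x; case: (d1 j x).
(* What the second differentiation puts in place [i]: it meets the factor already differentiated
   when [i = j], and a fresh one otherwise. *)
pose k j i := if i == j then h2 j else h1 i.
have d2 i j x : is_derive x (delta_mx 0 i) (prodf (hj j))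
    (prodf (fun l => if l == i then k j i else hj j l) x).
  apply: is_derive_prodf => s; rewrite /hj /k; case: eqP => _.
    by have [] := H j.
  by have [] := H i.
have p2 i j : partial i (prodf (hj j)) = prodf (fun l => if l == i then k j i else hj j l).
  by apply/funext => x; case: (d2 i j x).
split; first exact: bounded_continuous_prodf.
  move=> j; rewrite p1; split; first by move=> x; case: (d1 j x).
  by apply: bounded_continuous_prodf => i; rewrite /hj; case: ifP.
move=> i j; rewrite !p1; split; first by move=> x; case: (d2 i j x).
rewrite p2; apply: bounded_continuous_prodf => l; rewrite /k /hj.
by case: ifP => _; case: ifP.
Qed.

Definition smooth_box (a b : 'rV[R]_n) (m : nat) : 'rV[R]_n -> R :=
  prodf (fun i => smooth_ind (a 0 i) (b 0 i) m).

Lemma Cb2_smooth_box a b m : Cb2 (smooth_box a b m).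
Proof. by apply: Cb2_prodf => i; exact: isC2b_smooth_ind. Qed.

Lemma smooth_box_itv a b m x : 0 <= smooth_box a b m x <= 1.
Proof.
have h i : 0 <= smooth_ind (a 0 i) (b 0 i) m (x 0 i) <= 1 by exact: smooth_ind_itv.
apply/andP; split; first by apply: prodr_ge0 => i _; case/andP: (h i).
by apply: prodr_ile1 => i _; exact: h.
Qed.

Lemma smooth_box_out a b m x : ~ box a b x -> smooth_box a b m x = 0.
Proof.
move=> /existsNP[i /negP abx]; rewrite /smooth_box /prodf (bigD1 i)//=.
by rewrite smooth_ind_out// mul0r.
Qed.

Lemma smooth_box_gt0 a b m x : box a b x -> 0 < smooth_box a b m x.
Proof. by move=> abx; apply: prodr_gt0 => i _; exact: smooth_ind_gt0. Qed.

Lemma smooth_box_mono a b x : nondecreasing_seq (fun m => smooth_box a b m x).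
Proof.
move=> m k mk; apply: ler_prod => i _; rewrite smooth_ind_mono// andbT.
by case/andP: (smooth_ind_itv (a 0 i) (b 0 i) m (x 0 i)).
Qed.

Lemma smooth_box_cvg a b x :
  smooth_box a b m x @[m --> \oo] --> (\1_(box a b) x : R).
Proof.
have [xb|xb] := pselect (box a b x); last first.
  rewrite indicE memNset//; apply: (@cvg_trans _ (cst 0 @ \oo)); last exact: cvg_cst.
  by apply: near_eq_cvg; apply: nearW => m /=; rewrite smooth_box_out.
rewrite indicE mem_set//= /smooth_box /prodf.
elim: (index_enum _) => [|i s IH].
  under eq_fun do rewrite big_nil.
  exact: cvg_cst.
under eq_fun do rewrite big_cons.
have := @cvgM _ _ _ _ _ _ _ _ (smooth_ind_cvg (xb i)) IH; rewrite mulr1; exact.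
Qed.

End product_functions.

(** * The generator *)

Section taylor.
Context {R : realType} {n : nat}.
Implicit Types (x y z : 'rV[R]_n) (f : 'rV[R]_n -> R).

Lemma is_derive_along f z (v : 'rV[R]_n) (s : R) : derivable f (s *: v + z) v ->
  is_derive s 1 (fun s => f (s *: v + z)) ('D_v f (s *: v + z)).
Proof.
have E : (fun t : R => t^-1 *: ((f \o shift (s *: v + z)) (t *: v) - f (s *: v + z))) =
    (fun t : R => t^-1 *: (((fun s => f (s *: v + z)) \o shift s) (t *: 1) - f (s *: v + z))).
  by apply/funext => t /=; rewrite addrA -scalerDl [t%:A]mulr1.
by rewrite /derivable /derive E => H; apply: DeriveDef.
Qed.

Lemma MVT_along f z (v : 'rV[R]_n) (s : R) : (forall x, derivable f x v) ->
  exists2 t : R, `|t| <= `|s| & f (s *: v + z) - f z = s * 'D_v f (t *: v + z).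
Proof.
move=> df; pose g (s : R) := f (s *: v + z); pose g' (s : R) := 'D_v f (s *: v + z).
have dg t : is_derive t (1 : R) g (g' t) by exact: is_derive_along.
have cg : continuous g by exact: is_derive_continuous dg.
have -> : f z = g 0 by rewrite /g scale0r add0r.
have [s0|s0|->] := ltgtP s 0; last first.
- by exists 0; rewrite // mul0r /g scale0r add0r subrr.
- have [t] := @MVT R g g' _ _ s0 (fun r _ => dg r) (continuous_subspaceT cg).
  rewrite in_itv/= => /andP[t0 ts] E; exists t; last by rewrite E subr0 mulrC.
  by rewrite !gtr0_norm// ltW.
- have [t] := @MVT R g g' _ _ s0 (fun r _ => dg r) (continuous_subspaceT cg).
  rewrite in_itv/= => /andP[t0 ts] E; exists t; last first.
    by rewrite -/(g s) -[LHS]opprB E sub0r mulrN opprK mulrC.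
  by rewrite !ltr0_norm// lerN2 ltW.
Qed.

Definition trunc_rV y (k : nat) : 'rV[R]_n := \row_i (if (i < k)%N then y 0 i else 0).

Lemma ler_norm_rV x (c : R) : 0 <= c -> (forall i, `|x 0 i| <= c) -> `|x| <= c.
Proof.
move=> c0 h; rewrite [leLHS]mx_normrE; apply: bigmax_le => // -[i j] _ /=.
by rewrite ord1 h.
Qed.

Lemma coord_norm_le x i : `|x 0 i| <= `|x|.
Proof.
rewrite [leRHS]mx_normrE.
exact: (le_bigmax _ (fun j : 'I_1 * 'I_n => `|x j.1 j.2|) (0, i)).
Qed.

(* [x] is joined to [x + y] by changing one coordinate at a time. *)
Lemma MVT_coordinates f x y : (forall i x, derivable f x (delta_mx 0 i)) ->
  exists xi : 'I_n -> 'rV[R]_n, (forall k, `|xi k| <= `|y|) /\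
    f (x + y) - f x = \sum_k y 0 k * partial k f (x + xi k).
Proof.
move=> df.
have step (k : 'I_n) : exists t : 'rV[R]_n, `|t| <= `|y| /\
    f (x + trunc_rV y k.+1) - f (x + trunc_rV y k) = y 0 k * partial k f (x + t).
  have [t ts E] := @MVT_along f (x + trunc_rV y k) (delta_mx 0 k) (y 0 k) (df k).
  (* Coordinate [k] of [trunc_rV y k] is 0, so the two summands have disjoint supports and the
     maximum norm stays below that of [y]. *)
  exists (t *: delta_mx 0 k + trunc_rV y k); split.
    apply: ler_norm_rV => // i; rewrite !mxE eqxx/=.
    have [->|ik] := eqVneq i k; first by rewrite ltnn addr0 mulr1 (le_trans ts)// coord_norm_le.
    by rewrite mulr0 add0r; case: ifP; rewrite ?normr0 ?coord_norm_le.
  rewrite addrCA; move: E; rewrite /partial => <-; congr (f _ - _).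
  apply/rowP => i; rewrite !mxE eqxx/=; have [->|ik] := eqVneq i k.
    by rewrite ltnn leqnn addr0 mulr1 addrC.
  by rewrite mulr0 add0r ltnS leq_eqVlt (negbTE (ik : i != k :> nat)).
have {step}[xi H] := choice step; exists xi; split=> [k|]; first by case: (H k).
under eq_bigr do rewrite -(H _).2.
pose F k := f (x + trunc_rV y k).
rewrite -(big_mkord xpredT (fun k => F k.+1 - F k)) telescope_sumr//.
congr (f _ - f _); last by apply/rowP => i; rewrite !mxE ltn0 addr0.
by apply/rowP => i; rewrite !mxE ltn_ord.
Qed.

Lemma lipschitz_partial f (M : R) x y : 0 <= M ->
  (forall i x, derivable f x (delta_mx 0 i)) -> (forall i x, `|partial i f x| <= M) ->
  `|f (x + y) - f x| <= n%:R * M * `|y|.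
Proof.
move=> M0 df pM; have [xi [_ ->]] := MVT_coordinates x y df.
apply: le_trans (ler_norm_sum _ _ _) _.
rewrite -[n in n%:R]card_ord -[#|_|]sum1_card natr_sum mulr_suml mulr_suml.
apply: ler_sum => k _; rewrite mul1r normrM mulrC.
by apply: ler_pM => //; exact: coord_norm_le.
Qed.

Lemma sqnorm_ge y : `|y| ^+ 2 <= sqnorm y.
Proof.
have [->|y0] := eqVneq y 0; first by rewrite normr0 expr0n/= /sqnorm /dotp; apply: sumr_ge0 => i _; rewrite mxE mul0r.
have y1 : mx_norm y != 0 by rewrite -[mx_norm y]/(`|y|) normr_eq0.
have [[i j] E] := mx_norm_neq0 y1.
have {}E : `|y| = `|y 0 j| by rewrite [LHS]E/= ord1.
rewrite E /sqnorm /dotp (bigD1 j)//= -expr2 real_normK ?num_real// lerDl.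
by apply: sumr_ge0 => k _; rewrite -expr2 sqr_ge0.
Qed.

Lemma sqnorm_ge0 y : 0 <= sqnorm y.
Proof. by apply: le_trans (sqnorm_ge y); rewrite exprn_ge0. Qed.

Lemma dotp_le y z (M : R) : 0 <= M -> (forall i, `|z 0 i| <= M) -> `|dotp y z| <= n%:R * M * `|y|.
Proof.
move=> M0 zM; apply: le_trans (ler_norm_sum _ _ _) _.
rewrite -[n in n%:R]card_ord -[#|_|]sum1_card natr_sum mulr_suml mulr_suml.
apply: ler_sum => k _; rewrite mul1r normrM mulrC.
by apply: ler_pM => //; exact: coord_norm_le.
Qed.

Lemma Cb2_bound f : Cb2 f -> exists M, [/\ 0 <= M, forall x, `|f x| <= M,
  forall i x, `|partial i f x| <= M & forall i j x, `|partial i (partial j f) x| <= M].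
Proof.
move=> [[_ [M0 H0]] H1 H2].
have /choice[M1 {}H1] : forall i, exists M, forall x, `|partial i f x| <= M.
  by move=> i; have [_ []] := H1 i.
have /choice[M2 {}H2] : forall ij : 'I_n * 'I_n, exists M, forall x, `|partial ij.1 (partial ij.2 f) x| <= M.
  by move=> [i j]; have [_ []] := H2 i j.
pose S1 := \sum_i `|M1 i|; pose S2 := \sum_ij `|M2 ij|.
have S10 : 0 <= S1 by exact: sumr_ge0.
have S20 : 0 <= S2 by exact: sumr_ge0.
exists (`|M0| + S1 + S2); split.
- by rewrite !addr_ge0.
- move=> x; have := H0 x; have := ler_norm M0; lra.
- move=> i x; have : `|M1 i| <= S1 by rewrite /S1 (bigD1 i)//= lerDl sumr_ge0.
  by have := H1 i x; have := ler_norm (M1 i); have := normr_ge0 M0; lra.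
- move=> i j x; have : `|M2 (i, j)| <= S2 by rewrite /S2 (bigD1 (i, j))//= lerDl sumr_ge0.
  by have := H2 (i, j) x; have := ler_norm (M2 (i, j)); have := normr_ge0 M0; rewrite /=; lra.
Qed.

Definition jump_term f x y : R := f (x + y) - f x - dotp y (grad f x) / (1 + sqnorm y).

(** The right-hand side is what [levy_kernel] integrates uniformly. Large jumps use that [f] and the
    compensator are bounded, small ones a Taylor expansion of order two. *)
Lemma jump_term_bound f : Cb2 f ->
  exists2 C, 0 <= C & forall x y, `|jump_term f x y| <= C * Num.min 1 (sqnorm y).
Proof.
move=> Cf; have [M [M0 B0 B1 B2]] := Cb2_bound Cf; case: (Cf) => _ d1 d2.
have n0 : 0 <= n%:R :> R by [].
(* The summands bound the Taylor remainder of small jumps, the compensator in both regimes, and the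
   increment of [f] over large jumps. *)
pose C : R := n%:R * (n%:R * M) + n%:R * M + 2 * M.
have nM : 0 <= n%:R * M by rewrite mulr_ge0.
have nnM : 0 <= n%:R * (n%:R * M) by rewrite mulr_ge0.
exists C; first by rewrite /C; lra.
move=> x y; have q0 := sqnorm_ge0 y; have Nq := sqnorm_ge y.
have N0 := normr_ge0 y; pose q := sqnorm y; pose N := `|y|.
rewrite -/q -/N in q0 Nq N0.
have gB : `|dotp y (grad f x)| <= n%:R * M * N by apply: dotp_le => // i; rewrite mxE B1.
have iq : 0 < 1 + q by lra.
have [q1|q1] := ltP 1 q.
  rewrite mulr1; apply: le_trans (ler_normB _ _) _.
  have h1 : `|f (x + y) - f x| <= 2 * M.
    by apply: le_trans (ler_normB _ _) _; have := B0 (x + y); have := B0 x; lra.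
  suff h2 : `|dotp y (grad f x) / (1 + sqnorm y)| <= n%:R * M by rewrite /C; lra.
  rewrite normrM normfV -/q (gtr0_norm iq) ler_pdivrMr//.
  apply: le_trans gB _; rewrite ler_wpM2l//; nra.
have h1 : `|f (x + y) - f x - dotp y (grad f x)| <= n%:R * (n%:R * M) * q.
  have [xi [xiy E]] := MVT_coordinates x y (fun i => (d1 i).1).
  rewrite E /dotp -sumrB; apply: le_trans (ler_norm_sum _ _ _) _.
  apply: (@le_trans _ _ (n%:R * (n%:R * M) * (N * N))); last by rewrite ler_wpM2l// -expr2.
  rewrite -[n in n%:R * _ * _]card_ord -[#|_|]sum1_card natr_sum mulr_suml mulr_suml.
  apply: ler_sum => k _; rewrite mul1r mxE -mulrBr normrM mulrCA.
  apply: ler_pM => //; first exact: coord_norm_le.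
  apply: le_trans (_ : _ <= n%:R * M * `|xi k|) _; last by rewrite ler_wpM2l// xiy.
  apply: lipschitz_partial => // i z; first exact: (d2 i k).1.
(* The compensator is not the plain first-order term; the two differ by the factor [q / (1 + q)],
   which is of order two in [y]. *)
have h2 : `|dotp y (grad f x) - dotp y (grad f x) / (1 + q)| <= n%:R * M * q.
  have -> : dotp y (grad f x) - dotp y (grad f x) / (1 + q) = dotp y (grad f x) * (q / (1 + q)).
    by field; lra.
  rewrite normrM; apply: le_trans (_ : _ <= n%:R * M * N * q) _.
    apply: ler_pM => //; rewrite ger0_norm ?divr_ge0 ?(ltW iq)// ler_pdivrMr//; nra.
  rewrite -mulrA ler_wpM2l//; nra.
rewrite /jump_term.
have -> : f (x + y) - f x - dotp y (grad f x) / (1 + sqnorm y) =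
  (f (x + y) - f x - dotp y (grad f x)) + (dotp y (grad f x) - dotp y (grad f x) / (1 + q)) by rewrite addrA subrK.
apply: le_trans (ler_normD _ _) _; rewrite /C.
have : 0 <= M * q by rewrite mulr_ge0.
by rewrite !mulrDl; lra.
Qed.

End taylor.

(** * Restricted kernels and s-finiteness *)

Section kernel_restriction.
Context d d' (X : measurableType d) (Y : measurableType d') (R : realType).
Variables (k : R.-ker X ~> Y) (E : set Y) (mE : measurable E).

Definition krestr (x : X) : {measure set Y -> \bar R} := mrestr (k x) mE.

Let measurable_krestr U : measurable U -> measurable_fun setT (krestr ^~ U).
Proof. by move=> mU; apply: measurable_kernel; exact: measurableI. Qed.

HB.instance Definition _ := isKernel.Build _ _ X Y R krestr measurable_krestr.

End kernel_restriction.

Section sfinite.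
Context d d' (X : measurableType d) (Y : measurableType d') (R : realType).

(** Restricting [k] to the disjoint pieces [seqDU E i] gives kernels with sum [k], each bounded
    uniformly in [x]; sigma-finiteness of every single [k x] would not provide such uniform
    bounds. *)
Lemma sfinite_kernel_bigcup (k : R.-ker X ~> Y) (E : (set Y)^nat) :
  (forall i, measurable (E i)) ->
  (forall i, exists r : R, forall x, (k x (E i) < r%:E)%E) ->
  (forall x, k x (~` \bigcup_i E i) = 0%E) ->
  exists k' : R.-sfker X ~> Y, forall x, k' x = k x.
Proof.
move=> mE bE k0.
have mD i : measurable (seqDU E i) by exact: seqDU_measurable.
pose s i : R.-ker X ~> Y := krestr k (mD i).
have us i : measure_fam_uub (s i).
  have [r kr] := bE i; exists r => x; apply: le_lt_trans (kr x).
  rewrite /s/= /krestr /mrestr/= setTI le_measure ?inE//.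
  exact: subset_seqDU.
have ks x U : measurable U -> k x U = kseries s x U.
  move=> mU; rewrite /kseries/= /mseries.
  have mUE : measurable (\bigcup_i E i) by exact: bigcupT_measurable.
  rewrite (measureDI (k x) mU mUE) (_ : _ (U `\` _) = 0%E) ?add0e; last first.
    apply: (@subset_measure0 _ _ _ (k x) _ (~` \bigcup_i E i)); [|exact: measurableC| |exact: k0].
      exact: measurableD.
    by move=> y [].
  rewrite seqDU_bigcup_eq setI_bigcupr.
  apply: (@measure_semi_bigcup _ _ _ (k x) (fun i => U `&` seqDU E i)).
  - by move=> i; exact: measurableI.
  - apply: trivIset_setIl; exact: trivIset_seqDU.
  - by apply: bigcupT_measurable => i; exact: measurableI.
pose mx := isSFiniteKernel_subdef.Build _ _ X Y R k (ex_intro2 _ _ s us ks).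
pose K : R.-sfker X ~> Y := HB.pack (k : X -> {measure set Y -> \bar R}) k mx.
by exists K.
Qed.

End sfinite.

(** * Measurability, boundedness and locality of the generator *)

Section generator.
Context {R : realType} {n : nat}.
Variables (Q : 'rV[R]_n -> 'M[R]_n) (b : 'rV[R]_n -> 'rV[R]_n).
Variable N : R.-ker 'rV[R]_n ~> 'rV[R]_n.
Hypotheses (hQ : diffusion_coefficient Q) (hb : drift_coefficient b)
  (hN : levy_kernel N).

Lemma measurable_coord_rV i : measurable_fun setT (fun x : 'rV[R]_n => x 0 i).
Proof. by move: i; apply/measurable_fun_rV; exact: measurable_id. Qed.

Lemma measurable_dotp d (T : measurableType d) (f g : T -> 'rV[R]_n) :
  measurable_fun setT f -> measurable_fun setT g ->
  measurable_fun setT (fun t => dotp (f t) (g t)).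
Proof.
move=> /measurable_fun_rV mf /measurable_fun_rV mg; rewrite /dotp.
apply: measurable_sum => i; apply: measurable_funM; [exact: mf|exact: mg].
Qed.

Lemma measurable_sqnorm : measurable_fun setT (@sqnorm R n).
Proof. by apply: measurable_dotp; exact: measurable_id. Qed.

Lemma levy_bound : exists2 K : R, 0 <= K &
  forall x, (\int[N x]_y (Num.min 1 (sqnorm y))%:E <= K%:E)%E.
Proof.
case: hN => _; set S := [set _ | _ in _] => hS.
have i0 x : (0 <= \int[N x]_y (Num.min 1 (sqnorm y))%:E)%E.
  by apply: integral_ge0 => y _; rewrite lee_fin le_min ler01 sqnorm_ge0.
have ub x : (\int[N x]_y (Num.min 1 (sqnorm y))%:E <= ereal_sup S)%E.
  by apply: ereal_sup_ubound; exists x.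
have fS : ereal_sup S \is a fin_num.
  by rewrite ge0_fin_numE//; exact: le_trans (i0 0) (ub 0).
exists (fine (ereal_sup S)); last by move=> x; rewrite fineK.
by rewrite fine_ge0//; exact: le_trans (i0 0) (ub 0).
Qed.

(** Markov's inequality, with a bound uniform in the starting point. *)
Lemma levy_tail (e : R) (E : set 'rV[R]_n) : 0 < e -> measurable E ->
  (forall y, E y -> e <= Num.min 1 (sqnorm y)) ->
  exists2 K : R, 0 <= K & forall x, (N x E <= K%:E)%E.
Proof.
move=> e0 mE eE; have [K K0 HK] := levy_bound.
have iE0 : 0 <= e^-1 by rewrite invr_ge0 ltW.
exists (e^-1 * K); first by rewrite mulr_ge0.
move=> x; rewrite -(setIT E) -integral_indic//.
apply: (@le_trans _ _ (\int[N x]_y (e^-1%:E * (Num.min 1 (sqnorm y))%:E))%E).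
  apply: ge0_le_integral => //.
  - exact/measurable_EFinP/measurable_indic.
  - apply/measurable_EFinP; apply: measurable_funM => //.
    by apply: measurable_minr => //; exact: measurable_sqnorm.
  - move=> y _; rewrite -EFinM lee_fin indicE.
    have [yE|yE] := boolP (y \in E); last by rewrite mulr_ge0// le_min ler01 sqnorm_ge0.
    by rewrite mulrC ler_pdivlMr// mul1r eE//; rewrite inE in yE.
rewrite ge0_integralZl_EFin//.
- by rewrite EFinM lee_wpmul2l.
- by move=> y _; rewrite lee_fin le_min ler01 sqnorm_ge0.
- by apply/measurable_EFinP; apply: measurable_minr => //; exact: measurable_sqnorm.
Qed.

(** Jumps of size bounded below exhaust the punctured space, and 0 carries no mass. This makes
    integrals against [N x] measurable in [x]. *)
Lemma levy_sfinite : exists N' : R.-sfker 'rV[R]_n ~> 'rV[R]_n, forall x, N' x = N x.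
Proof.
pose E i := [set y : 'rV[R]_n | i.+1%:R^-1 <= sqnorm y].
have mE i : measurable (E i).
  rewrite -[X in measurable X]setTI.
  by have := measurable_sqnorm measurableT (measurable_itv `[i.+1%:R^-1, +oo[);
    rewrite set_itvE.
apply: (@sfinite_kernel_bigcup _ _ _ _ _ N E) => //.
  move=> i; have i0 : 0 < i.+1%:R^-1 :> R by rewrite invr_gt0.
  have [y Ey|K K0 HK] := levy_tail i0 (mE i).
    by rewrite le_min Ey andbT invf_le1// ler1n.
  by exists (K + 1) => x; apply: le_lt_trans (HK x) _; rewrite lte_fin ltrDl.
move=> x; have [/(_ x)[_ N0] _] := hN.
suff -> : ~` (\bigcup_i E i) = ~` ~` [set 0] by [].
congr (~` _); apply/seteqP; split=> [y [i _] Ei y0|y y0].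
  move: Ei; rewrite /E/= y0 leNgt => /negP; apply.
  by rewrite (_ : sqnorm 0 = 0) ?invr_gt0// /sqnorm /dotp big1// => k _; rewrite mxE mul0r.
have q0 : 0 < sqnorm y.
  by apply: lt_le_trans (sqnorm_ge y); rewrite exprn_gt0// normr_gt0; exact/eqP.
have [k _ kq] := near_infty_natSinv_lt (PosNum q0).
by exists k => //; exact/ltW/(kq k)/leqnn.
Qed.

Lemma measurable_integral_levy (g : 'rV[R]_n * 'rV[R]_n -> \bar R) :
  (forall z, (0 <= g z)%E) -> measurable_fun setT g ->
  measurable_fun setT (fun x => \int[N x]_y g (x, y))%E.
Proof.
move=> g0 mg; have [N' HN'] := levy_sfinite.
have -> : (fun x => \int[N x]_y g (x, y))%E = (fun x => \int[N' x]_y g (x, y))%E.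
  by apply/funext => x; rewrite HN'.
exact: measurable_fun_integral_sfinite_kernel.
Qed.

Lemma measurable_addrV :
  measurable_fun setT (fun z : 'rV[R]_n * 'rV[R]_n => z.1 + z.2).
Proof.
apply/measurable_fun_rV => i.
under eq_fun do rewrite mxE.
apply: measurable_funD.
- by apply: (measurableT_comp (measurable_coord_rV i)); exact: measurable_fst.
- by apply: (measurableT_comp (measurable_coord_rV i)); exact: measurable_snd.
Qed.

Lemma measurable_grad (f : 'rV[R]_n -> R) : Cb2 f -> measurable_fun setT (grad f).
Proof.
move=> [_ h _]; apply/measurable_fun_rV => i; under eq_fun do rewrite mxE.
by apply: continuous_rV_measurable; have [_ []] := h i.
Qed.

Lemma measurable_jump_term (f : 'rV[R]_n -> R) : Cb2 f ->
  measurable_fun setT (fun z : 'rV[R]_n * 'rV[R]_n => jump_term f z.1 z.2).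
Proof.
move=> Cf; case: (Cf) => -[cf _] _ _.
have mf := continuous_rV_measurable cf.
apply: measurable_funB; first apply: measurable_funB.
- by apply: (measurableT_comp mf); exact: measurable_addrV.
- by apply: (measurableT_comp mf); exact: measurable_fst.
apply: measurable_funM.
- apply: measurable_dotp; first exact: measurable_snd.
  by apply: (measurableT_comp (measurable_grad Cf)); exact: measurable_fst.
(* The absolute value, harmless as [sqnorm] is nonnegative, removes the pole at [q = -1] and makes
   the function continuous on the whole line. *)
have h : measurable_fun setT (fun q : R => (1 + `|q|)^-1).
  apply: continuous_measurable_fun => q; apply: cvgV.
    by rewrite gt_eqF// ltr_pwDl.
  by apply: cvgD; [exact: cvg_cst|apply: cvg_norm; exact: cvg_id].
have -> : (fun z : 'rV[R]_n * 'rV[R]_n => (1 + sqnorm z.2)^-1) =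
    (fun q : R => (1 + `|q|)^-1) \o (@sqnorm R n \o snd).
  by apply/funext => z /=; rewrite ger0_norm// sqnorm_ge0.
by apply: (measurableT_comp h); apply: (measurableT_comp measurable_sqnorm); exact: measurable_snd.
Qed.

Lemma measurable_Rintegral_jump (f : 'rV[R]_n -> R) : Cb2 f ->
  measurable_fun setT (fun x => \int[N x]_y jump_term f x y).
Proof.
move=> Cf; have mj := measurable_jump_term Cf.
have mjE : measurable_fun setT (EFin \o (fun z : 'rV[R]_n * 'rV[R]_n => jump_term f z.1 z.2)).
  exact/measurable_EFinP.
apply: (measurableT_comp (fine_measurable measurableT)).
under eq_fun do rewrite integralE.
apply: emeasurable_funB.
- have := measurable_integral_levy (fun z => funepos_ge0 _ z) (measurable_funepos mjE).
  congr (measurable_fun _ _); apply/funext => x.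
  by apply: eq_integral => y _; rewrite !funeposE.
- have := measurable_integral_levy (fun z => funeneg_ge0 _ z) (measurable_funeneg mjE).
  congr (measurable_fun _ _); apply/funext => x.
  by apply: eq_integral => y _; rewrite !funenegE.
Qed.

Lemma generator_measurable (f : 'rV[R]_n -> R) : Cb2 f -> measurable_fun setT (generator Q b N f).
Proof.
move=> Cf; case: (Cf) => _ _ h2; case: hQ => _ _ mQ.
apply: measurable_funD; last exact: measurable_Rintegral_jump.
apply: measurable_funD.
  apply: measurable_funM => //; rewrite /mxtrace.
  apply: measurable_sum => i; under eq_fun do rewrite mxE.
  apply: measurable_sum => j; apply: measurable_funM; first by have [] := mQ i j.
  under eq_fun do rewrite mxE.
  by apply: continuous_rV_measurable; have [_ []] := h2 j i.
apply: measurable_dotp; last exact: measurable_grad.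
by apply/measurable_fun_rV => i; have [] := hb i.
Qed.

Lemma generator_bounded (f : 'rV[R]_n -> R) : Cb2 f -> exists2 C, 0 <= C & forall x, `|generator Q b N f x| <= C.
Proof.
move=> Cf; have [M [M0 B0 B1 B2]] := Cb2_bound Cf; have [C C0 HC] := jump_term_bound Cf.
have [K K0 HK] := levy_bound.
have [_ _ mQ] := hQ.
have /choice[MQ HMQ] : forall ij : 'I_n * 'I_n, exists M : R, forall x, `|Q x ij.1 ij.2| <= M.
  by move=> [i j]; have [_ [L HL]] := mQ i j; exists L => x; exact: HL.
have /choice[Mb HMb] : forall i, exists M : R, forall x, `|b x 0 i| <= M.
  by move=> i; have [_ [L HL]] := hb i; exists L => x; exact: HL.
have j x : `|\int[N x]_y jump_term f x y| <= C * K.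
  have mj : measurable_fun setT (EFin \o jump_term f x).
    apply/measurable_EFinP.
    exact: (measurableT_comp (measurable_jump_term Cf) (measurable_pair1 x)).
  have bnd : (\int[N x]_y `|(jump_term f x y)%:E| <= (C * K)%:E)%E.
    apply: (@le_trans _ _ (\int[N x]_y (C%:E * (Num.min 1 (sqnorm y))%:E))%E).
      apply: ge0_le_integral => //.
      - exact: measurableT_comp.
      - apply/measurable_EFinP; apply: measurable_funM => //.
        by apply: measurable_minr => //; exact: measurable_sqnorm.
      - by move=> y _; rewrite -EFinM lee_fin HC.
    rewrite ge0_integralZl_EFin//.
    - by rewrite EFinM lee_wpmul2l.
    - by move=> y _; rewrite lee_fin le_min ler01 sqnorm_ge0.
    - by apply/measurable_EFinP; apply: measurable_minr => //; exact: measurable_sqnorm.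
  have ij : (N x).-integrable setT (EFin \o jump_term f x).
    by apply/integrableP; split => //; exact: le_lt_trans bnd (ltry _).
  apply: le_trans (le_normr_Rintegral _ ij) _ => //.
  rewrite /Rintegral -lee_fin fineK//.
  rewrite ge0_fin_numE ?integral_ge0//; exact: le_lt_trans bnd (ltry _).
pose S := \sum_i \sum_j (`|MQ (i, j)| * M) + \sum_i (`|Mb i| * M) + C * K.
exists S; first by rewrite !addr_ge0// ?mulr_ge0//; do ?(apply: sumr_ge0 => ? _); rewrite ?mulr_ge0.
move=> x; apply: le_trans (ler_normD _ _) _; apply: lerD; last exact: j.
apply: le_trans (ler_normD _ _) _; apply: lerD; last first.
  apply: le_trans (ler_norm_sum _ _ _) _; apply: ler_sum => i _; rewrite normrM.
  by apply: ler_pM => //; [exact: le_trans (HMb i x) (ler_norm _)|rewrite mxE B1].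
rewrite normrM.
apply: (@le_trans _ _ (`|\tr (Q x *m hess f x)|)).
  by rewrite ler_piMl// ger0_norm ?invr_ge0// invf_le1 ?ler1n.
apply: le_trans (ler_norm_sum _ _ _) _; apply: ler_sum => i _; rewrite mxE.
apply: le_trans (ler_norm_sum _ _ _) _; apply: ler_sum => k _; rewrite normrM.
by apply: ler_pM => //; [exact: le_trans (HMQ (i, k) x) (ler_norm _)|rewrite mxE B2].
Qed.

(** [f] is locally zero around [x], so its derivatives vanish there, and with them the compensator:
    only the jumps out of [D] remain. *)
Lemma generator_local (D : set 'rV[R]_n) f x : open D -> D x ->
  (forall y, D y -> f y = 0) ->
  generator Q b N f x = \int[N x]_y f (x + y).
Proof.
move=> oD Dx f0.
have dz (g : 'rV[R]_n -> R) i y : (forall z, D z -> g z = 0) -> D y -> partial i g y = 0.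
  move=> g0 Dy; rewrite /partial (@near_eq_derive R _ _ g (cst 0)) ?derive_cst//.
  by apply: filterS (open_nbhs_nbhs (conj oD Dy)) => z /g0.
have g0 y : D y -> grad f y = 0.
  by move=> Dy; apply/rowP => i; rewrite !mxE dz.
have h0 : hess f x = 0.
  by apply/matrixP => i j; rewrite !mxE dz// => z Dz; rewrite dz.
rewrite /generator h0 g0// mulmx0 mxtrace0 mulr0 add0r.
have d0 z : dotp z 0 = 0 :> R by rewrite /dotp big1// => i _; rewrite mxE mulr0.
rewrite d0 add0r; apply: eq_Rintegral => y _.
by rewrite (f0 x Dx) d0 mul0r !subr0.
Qed.

End generator.

(** * Stopping and Dynkin's formula *)

Section bounded_functions.
Context d (T : measurableType d) (R : realType) (mu : {measure set T -> \bar R}).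
Hypothesis mufin : (mu setT < +oo)%E.

Lemma bounded_fun_integrable (D : set T) (f : T -> R) (K : R) : measurable D ->
  measurable_fun D f -> (forall x, D x -> `|f x| <= K) -> mu.-integrable D (EFin \o f).
Proof.
move=> mD mf fK; apply: measurable_bounded_integrable => //.
  by apply: le_lt_trans mufin; apply: le_measure; rewrite ?inE.
by exists K; split; rewrite ?num_real// => M KM x Dx; exact: le_trans (fK x Dx) (ltW KM).
Qed.

Lemma bounded_convergence_on (D : set T) (f_ : nat -> T -> R) (f : T -> R) (K : R) :
  measurable D ->
  (forall k, measurable_fun D (f_ k)) -> (forall k x, D x -> `|f_ k x| <= K) ->
  (forall x, D x -> f_ k x @[k --> \oo] --> f x) ->
  (\int[mu]_(x in D) (f_ k x)%:E @[k --> \oo] --> \int[mu]_(x in D) (f x)%:E)%E.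
Proof.
move=> mD mf fK cf.
have ig : mu.-integrable D (EFin \o cst K).
  by apply: (@bounded_fun_integrable _ _ `|K|).
have [|||||_ _ //] := @dominated_convergence _ T R mu D mD (fun k x => (f_ k x)%:E)
    (fun x => (f x)%:E) (EFin \o cst K).
- by move=> k; exact/measurable_EFinP.
- by apply/measurable_EFinP; apply: measurable_fun_cvg => // x Dx; exact: cf.
- by apply: aeW => x Dx; apply: cvg_EFin; [exact: nearW|exact: cf].
- exact: ig.
- by apply: aeW => x k Dx; rewrite lee_fin; exact: fK.
Qed.

Lemma bounded_convergence (f_ : nat -> T -> R) (f : T -> R) (K : R) :
  (forall k, measurable_fun setT (f_ k)) -> (forall k x, `|f_ k x| <= K) ->
  (forall x, f_ k x @[k --> \oo] --> f x) ->
  (\int[mu]_x (f_ k x)%:E @[k --> \oo] --> \int[mu]_x (f x)%:E)%E.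
Proof. by move=> mf fK cf; exact: (@bounded_convergence_on _ _ _ K). Qed.

End bounded_functions.

(** * Optional stopping for bounded right-continuous martingales *)

Section optional_stopping.
Context {R : realType} {n : nat}.
Variables (t : R) (T : cadlag_path R n -> R).
Hypotheses (t0 : 0 < t) (T0 : forall w, 0 <= T w <= t).
Hypothesis mT : forall s, 0 <= s <= t -> filtration s [set w | s <= T w].
Implicit Types (w : cadlag_path R n) (Y : R -> cadlag_path R n -> R).

Let delta m : R := t / m.+1%:R.

Let delta_gt0 m : 0 < delta m.
Proof. by rewrite /delta divr_gt0. Qed.

(** Rounds [T] to the grid point strictly after it, capped at [t]. Step [k] is then taken exactly
    when [k%:R * delta m <= T w], an event that [mT] places in the sigma-algebra at the beginning of
    the step. *)
Let index m w : nat := minn m.+1 (Num.truncn (T w / delta m)).+1.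

Let disc m w : R := (index m w)%:R * delta m.

Let le_index m w k : (k < m.+1)%N -> (k%:R * delta m <= T w) = (k < index m w)%N.
Proof.
move=> km; rewrite /index leq_min km/= ltnS truncn_ge_nat; last first.
  by rewrite divr_ge0// ?(ltW (delta_gt0 m))//; case/andP: (T0 w).
by rewrite ler_pdivlMr.
Qed.

Let disc_itv m w : T w <= disc m w <= Num.min t (T w + delta m).
Proof.
have /andP[T1 T2] := T0 w; have d0 := delta_gt0 m.
have mt : m.+1%:R * delta m = t by rewrite /delta mulrC divfK.
have q0 : 0 <= T w / delta m by rewrite divr_ge0// ltW.
have /andP[h1 h2] := truncn_itv q0.
rewrite /disc /index /minn; case: ifPn => [mT'|].
  rewrite mt T2/= le_min lexx/=.
  rewrite ler_pdivlMr// in h1; rewrite -mt.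
  have : m.+1%:R * delta m <= (Num.truncn (T w / delta m))%:R * delta m + delta m.
    by rewrite -[X in _ + X]mul1r -mulrDl ler_pM2r// natr1 ler_nat ltnW.
  lra.
rewrite -leqNgt => mT'; rewrite ltr_pdivrMr// in h2; rewrite (ltW h2)/=.
rewrite le_min -mt ler_pM2r// ler_nat mT'/=.
by rewrite ler_pdivlMr// in h1; rewrite -natr1 mulrDl mul1r lerD2r.
Qed.

Let disc_cvg Y w : (forall s, 0 <= s <= t -> forall e, 0 < e -> exists2 d, 0 < d &
    forall r, s <= r < s + d -> r <= t -> `|Y s w - Y r w| < e) ->
  Y (disc m w) w @[m --> \oo] --> Y (T w) w.
Proof.
move=> rY; apply/cvgrPdist_lt => e e0; have [d d0 h] := rY _ (T0 w) e e0.
have dt : 0 < d / t by rewrite divr_gt0.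
have [k _ kd] := near_infty_natSinv_lt (PosNum dt).
exists k => // m km /=; have /andP[h1] := disc_itv m w; rewrite le_min => /andP[h2 h3].
apply: h => //; rewrite h1/=; apply: le_lt_trans h3 _; rewrite ltrD2l.
by have := kd m km; rewrite /= ltr_pdivlMr// mulrC.
Qed.

Let step Y m k w : R := (k%:R * delta m <= T w)%R%:R * (Y (k.+1%:R * delta m) w - Y (k%:R * delta m) w).

Let disc_sum Y m w : Y (disc m w) w = Y 0 w + \sum_(0 <= k < m.+1) step Y m k w.
Proof.
have -> : \sum_(0 <= k < m.+1) step Y m k w =
   \sum_(0 <= k < index m w) (Y (k.+1%:R * delta m) w - Y (k%:R * delta m) w).
  have im : (index m w <= m.+1)%N by exact: geq_minl.
  rewrite (@big_cat_nat _ _ _ (index m w) 0 m.+1)//= [X in _ + X = _]big_nat_cond [X in _ + X = _]big1 ?addr0; last first.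
    by move=> k /andP[/andP[ik km] _]; rewrite /step le_index// ltnNge ik mul0r.
  rewrite !big_nat; apply: eq_bigr => k /andP[_ ki].
  by rewrite /step le_index ?ki ?mul1r// (leq_trans ki).
by rewrite (telescope_sumr (fun k => Y (k%:R * delta m) w))// mul0r addrC subrK.
Qed.

Lemma filtration_delta m k : (k < m.+1)%N -> filtration (k%:R * delta m) [set w | k%:R * delta m <= T w].
Proof.
move=> km; apply: mT; rewrite mulr_ge0 ?(ltW (delta_gt0 m))//=.
have -> : t = m.+1%:R * delta m by rewrite /delta mulrC divfK.
by rewrite ler_pM2r// ler_nat ltnW.
Qed.

Let mult_itv m k : (k <= m.+1)%N -> 0 <= k%:R * delta m <= t.
Proof.
move=> km; rewrite mulr_ge0 ?(ltW (delta_gt0 m))//=.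
have -> : t = m.+1%:R * delta m by rewrite /delta mulrC divfK.
by rewrite ler_pM2r// ler_nat.
Qed.

Let measurable_step Y m k : (k < m.+1)%N ->
  (forall s, 0 <= s <= t -> measurable_fun setT (Y s)) -> measurable_fun setT (step Y m k).
Proof.
move=> km mY; apply: measurable_funM.
  have := @measurable_indic _ _ R setT _ (filtration_measurable (filtration_delta km)).
  congr measurable_fun; apply/funext => w; rewrite indicE; congr (nat_of_bool _)%:R.
  by apply/idP/idP => [/set_mem//|/mem_set].
by apply: measurable_funB; apply: mY; apply: mult_itv => //; exact: ltnW.
Qed.

Let measurable_disc Y m :
  (forall s, 0 <= s <= t -> measurable_fun setT (Y s)) ->
  measurable_fun setT (fun w => Y (disc m w) w).
Proof.
move=> mY; under eq_fun do rewrite disc_sum.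
apply: measurable_funD; first by apply: mY; rewrite lexx ltW.
under eq_fun do rewrite big_mkord.
by apply: measurable_sum => k; exact: measurable_step.
Qed.

Lemma measurable_stopped Y :
  (forall s, 0 <= s <= t -> measurable_fun setT (Y s)) ->
  (forall w s, 0 <= s <= t -> forall e, 0 < e -> exists2 d, 0 < d &
    forall r, s <= r < s + d -> r <= t -> `|Y s w - Y r w| < e) ->
  measurable_fun setT (fun w => Y (T w) w).
Proof.
move=> mY rY; apply: (@measurable_fun_cvg _ _ _ _ (fun m w => Y (disc m w) w)).
  by move=> m; exact: measurable_disc.
by move=> w _; apply: disc_cvg => s st e e0; exact: rY.
Qed.

Variables (P : {measure set (cadlag_path R n) -> \bar R}) (M : R -> cadlag_path R n -> R) (K : R).
Hypotheses (P1 : P setT = 1%E) (MP : martingale P M)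
  (MK : forall s w, 0 <= s <= t -> `|M s w| <= K)
  (rM : forall w s, 0 <= s <= t -> forall e, 0 < e -> exists2 d, 0 < d &
    forall r, s <= r < s + d -> r <= t -> `|M s w - M r w| < e).

Let Pfin : (P setT < +oo)%E.
Proof. by rewrite P1 ltry. Qed.

Let mM s : 0 <= s <= t -> measurable_fun setT (M s).
Proof.
by move=> /andP[s0 _]; case: MP => _ /(_ _ s0)/integrableP[/measurable_EFinP].
Qed.

Let integrable_M s : 0 <= s <= t -> P.-integrable setT (EFin \o M s).
Proof. by move=> /andP[s0 _]; case: MP => _ /(_ _ s0). Qed.

Let step_mean m k : (k < m.+1)%N -> (\int[P]_w (step M m k w)%:E = 0)%E.
Proof.
move=> km; pose S := [set w | k%:R * delta m <= T w].
have fS : filtration (k%:R * delta m) S by exact: filtration_delta.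
have mS := filtration_measurable fS.
have k0 := mult_itv (ltnW km); have k1 := mult_itv km.
transitivity (\int[P]_(w in S) ((M (k.+1%:R * delta m) w)%:E - (M (k%:R * delta m) w)%:E))%E.
  rewrite [RHS]integral_mkcond; apply: eq_integral => w _; rewrite patchE /step.
  case: ifPn => [/set_mem/= ->|/negP wS]; first by rewrite mul1r.
  rewrite (_ : (k%:R * delta m <= T w) = false) ?mul0r//.
  by apply/negP => h; apply: wS; exact: mem_set.
have i0 : P.-integrable S (EFin \o M (k%:R * delta m)).
  by apply: integrableS (integrable_M k0).
have i1 : P.-integrable S (EFin \o M (k.+1%:R * delta m)).
  by apply: integrableS (integrable_M k1).
rewrite integralB_EFin//; case: MP => _ _ h.
rewrite (h (k%:R * delta m) (k.+1%:R * delta m))//.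
  by rewrite subee//; exact: integrable_fin_num i0.
case/andP: k0 => -> _ /=; by rewrite ler_pM2r// ler_nat.
Qed.

(** Along the grid the stopped increment is a finite sum of martingale increments, each over an
    event known at its left end and hence of mean 0. As the discretized times approach [T] from the
    right, bounded convergence concludes. *)
Lemma optional_stopping : (\int[P]_w (M (T w) w - M 0 w)%:E = 0)%E.
Proof.
have mD m := measurable_disc m mM.
have z0 : 0 <= (0 : R) <= t by rewrite lexx ltW.
have dt m w : 0 <= disc m w <= t.
  have /andP[h1] := disc_itv m w; rewrite le_min => /andP[h2 h3].
  by rewrite h2 andbT (le_trans _ h1)//; case/andP: (T0 w).
have E m : (\int[P]_w (M (disc m w) w - M 0 w)%:E = 0)%E.
  transitivity (\int[P]_w (\sum_(k < m.+1) (step M m k w)%:E))%E.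
    apply: eq_integral => w _.
    by rewrite disc_sum addrC addKr big_mkord -sumEFin.
  rewrite integral_sum//; first by apply: big1 => k _; rewrite step_mean.
  move=> k; apply: (@bounded_fun_integrable _ _ _ P Pfin _ _ (K + K)) => //.
    exact: measurable_step.
  move=> w _; rewrite /step normrM; apply: (@le_trans _ _ (1 * (K + K))); last by rewrite mul1r.
  have k0 := mult_itv (ltnW (ltn_ord k)); have k1 := mult_itv (ltn_ord k).
  have b1 (c : bool) : `|c%:R| <= 1 :> R by case: c; rewrite ?normr1 ?normr0.
  apply: ler_pM => //; apply: le_trans (ler_normB _ _) _.
  by apply: lerD; apply: MK.
have := @bounded_convergence _ _ _ P Pfin (fun m w => M (disc m w) w - M 0 w)
  (fun w => M (T w) w - M 0 w) (K + K).
have -> : (fun m => \int[P]_w (M (disc m w) w - M 0 w)%:E)%E = cst 0%E.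
  by apply/funext => m; rewrite E.
move=> h; rewrite -(cvg_lim (@ereal_hausdorff R) (h _ _ _)) ?lim_cst//.
- by move=> m; apply: measurable_funB => //; exact: mM.
- by move=> m w; apply: le_trans (ler_normB _ _) _; apply: lerD; apply: MK.
- move=> w; apply: cvgB; last exact: cvg_cst.
  by apply: disc_cvg => s st e e0; exact: rM.
Qed.

End optional_stopping.

Lemma itv_lty {R : realType} (b1 b2 : bool) (s r : R) :
  (lebesgue_measure [set` Interval (BSide b1 s) (BSide b2 r)] < +oo)%E.
Proof. by rewrite lebesgue_measure_itv; case: ifP => _; rewrite ?ltry. Qed.

(** * Time integrals along a path *)

Section time_integral.
Context {R : realType} {n : nat}.
Variables (g : 'rV[R]_n -> R) (C : R).
Hypotheses (mg : measurable_fun setT g) (C0 : 0 <= C) (gC : forall x, `|g x| <= C).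
Implicit Types w : cadlag_path R n.

Definition time_integral s w : R := \int[lebesgue_measure]_(r in `[0, s]) g (w r).

Lemma measurable_along w : measurable_fun setT (fun r => g (w r)).
Proof. exact: (measurableT_comp mg (path_measurable w)). Qed.

Lemma itv_integrable w (b1 b2 : bool) (s r : R) :
  lebesgue_measure.-integrable [set` Interval (BSide b1 s) (BSide b2 r)] (EFin \o (fun r => g (w r))).
Proof.
apply: measurable_bounded_integrable => //.
- exact: itv_lty.
- by apply: measurable_funTS; exact: measurable_along.
- by exists C; split; rewrite ?num_real// => M KM x Dx; exact: le_trans (gC _) (ltW KM).
Qed.

Lemma time_integral_lip w s r : 0 <= s <= r ->
  `|time_integral r w - time_integral s w| <= C * (r - s).
Proof.
move=> /andP[s0 sr]; rewrite /time_integral Rintegral_itvB ?bnd_simp//; last exact: itv_integrable.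
apply: le_trans (le_normr_Rintegral _ _) _ => //; first exact: itv_integrable.
apply: (@le_trans _ _ (\int[lebesgue_measure]_(x in `]s, r]) C)).
  apply: le_Rintegral => //.
  - exact: integrable_norm (itv_integrable _ _ _ _ _).
  - apply: measurable_bounded_integrable => //.
    + exact: itv_lty.
    + by exists C; split; rewrite ?num_real// => M KM x Dx; rewrite /= ger0_norm// ltW.
have E : lebesgue_measure `]s, r]%classic = (r - s)%:E.
  rewrite lebesgue_measure_itv/= lte_fin; case: ltP => // rs.
  by rewrite (@le_anti _ _ s r) ?subrr// sr.
by rewrite Rintegral_cst//; move: E => /= ->.
Qed.

Lemma time_integral0 w : time_integral 0 w = 0.
Proof. by rewrite /time_integral set_itv1 Rintegral_set1. Qed.

Lemma time_integral_le w s : 0 <= s -> `|time_integral s w| <= C * s.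
Proof.
move=> s0; have := @time_integral_lip w 0 s; rewrite lexx s0 time_integral0 !subr0.
exact.
Qed.

Lemma time_integral_right w t s : 0 <= s <= t -> forall e : R, 0 < e -> exists2 d, 0 < d &
    forall r, s <= r < s + d -> r <= t -> `|time_integral s w - time_integral r w| < e.
Proof.
move=> /andP[s0 _] e e0; exists (e / (C + 1)); first by rewrite divr_gt0// ltr_wpDl.
move=> r /andP[sr rd] _; rewrite distrC; apply: le_lt_trans (time_integral_lip _ _) _.
  by rewrite s0.
apply: (@le_lt_trans _ _ (C * (e / (C + 1)))).
  by rewrite ler_wpM2l//; lra.
by rewrite mulrA ltr_pdivrMr ?ltr_wpDl//; nra.
Qed.

End time_integral.

(** * Dynkin's formula *)

Section dynkin_formula.
Context {R : realType} {n : nat}.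
Variables (t : R) (T : cadlag_path R n -> R).
Hypotheses (t0 : 0 < t) (T0 : forall w, 0 <= T w <= t).
Hypothesis mT : forall s, 0 <= s <= t -> filtration s [set w | s <= T w].
Variables (f g : 'rV[R]_n -> R) (B C : R).
Hypotheses (cf : continuous f) (fB : forall x, `|f x| <= B).
Hypotheses (mg : measurable_fun setT g) (C0 : 0 <= C) (gC : forall x, `|g x| <= C).
Implicit Types w : cadlag_path R n.

Lemma path_function_right w s : 0 <= s <= t -> forall e : R, 0 < e -> exists2 d, 0 < d &
    forall r, s <= r < s + d -> r <= t -> `|f (w s) - f (w r)| < e.
Proof.
move=> _ e e0; have /= := @cf (w s); move=> /cvgrPdist_lt/(_ e e0)/nbhs_ballP[d d0 h].
have [d' d'0 h'] := path_right w s d0; exists d' => // r sr _.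
exact/h/h'.
Qed.

Lemma measurable_stopped_path : measurable_fun setT (fun w => w (T w)).
Proof.
apply/measurable_fun_rV => i.
apply: (measurable_stopped t0 T0 mT (Y := fun s w => w s 0 i)).
  move=> s /andP[s0 _]; exact: (measurableT_comp (measurable_coord_rV i) (measurable_coord s0)).
move=> w s _ e e0; have [d d0 h] := path_right w s e0; exists d => // r sr _.
by have /(ball_rV _ _ e0)/(_ i) := h r sr.
Qed.

Variables (P : {measure set (cadlag_path R n) -> \bar R}).
Hypotheses (P1 : P setT = 1%E)
  (MP : martingale P (fun s w => f (w s) - f (w 0) - time_integral g s w)).

Lemma measurable_stopped_integral : measurable_fun setT (fun w => time_integral g (T w) w).
Proof.
have mf := continuous_rV_measurable cf.
apply: (measurable_stopped t0 T0 mT (Y := fun s w => time_integral g s w)); last first.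
  by move=> w s st e e0; exact: (time_integral_right mg C0 gC).
move=> s /andP[s0 _].
(* Measurability in [w] of the time integral is read off the martingale, which is measurable as part
   of its integrability. *)
have -> : (fun w => time_integral g s w) =
    (fun w => (f (w s) - f (w 0)) - (f (w s) - f (w 0) - time_integral g s w)).
  by apply/funext => w; rewrite opprB addrC subrK.
apply: measurable_funB.
  by apply: measurable_funB; apply: (measurableT_comp mf); exact: measurable_coord.
by case: MP => _ /(_ _ s0)/integrableP[/measurable_EFinP].
Qed.

Lemma dynkin_formula :
  (\int[P]_w (f (w (T w)))%:E = \int[P]_w (f (w 0) + time_integral g (T w) w)%:E)%E.
Proof.
have mf := continuous_rV_measurable cf.
have Pfin : (P setT < +oo)%E by rewrite P1 ltry.
have B0 : 0 <= B by apply: le_trans (fB 0).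
have := @optional_stopping _ _ _ _ t0 T0 mT _ _ (B + B + C * t) P1 MP.
have h w : f (w (T w)) - f (w 0) - time_integral g (T w) w - (f (w 0) - f (w 0) - time_integral g 0 w) =
   f (w (T w)) - (f (w 0) + time_integral g (T w) w).
  by rewrite time_integral0; ring.
under eq_integral do rewrite h EFinB.
have Tw w : `|time_integral g (T w) w| <= C * t.
  have /andP[T1 T2] := T0 w.
  by apply: le_trans (time_integral_le mg C0 gC w T1) _; rewrite ler_wpM2l.
have z0 : 0 <= (0 : R) by [].
have i1 : P.-integrable setT (EFin \o (fun w => f (w (T w)))).
  apply: (@bounded_fun_integrable _ _ _ P Pfin _ _ B) => //.
  exact: (measurableT_comp mf measurable_stopped_path).
have i2 : P.-integrable setT (EFin \o (fun w => f (w 0) + time_integral g (T w) w)).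
  apply: (@bounded_fun_integrable _ _ _ P Pfin _ _ (B + C * t)) => //.
    apply: measurable_funD; last exact: measurable_stopped_integral.
    exact: (measurableT_comp mf (measurable_coord z0)).
  by move=> w _; apply: le_trans (ler_normD _ _) _; rewrite lerD.
rewrite integralB_EFin// => H.
have f2 : (\int[P]_w (f (w 0) + time_integral g (T w) w)%:E)%E \is a fin_num.
  exact: integrable_fin_num i2.
rewrite -[LHS](subeK _ f2) H ?add0e//.
- move=> s w /andP[s0 st]; apply: le_trans (ler_normB _ _) _; apply: lerD.
    by apply: le_trans (ler_normB _ _) _; rewrite lerD.
  by apply: le_trans (time_integral_le mg C0 gC w s0) _; rewrite ler_wpM2l.
- move=> w s st e e0.
  have e20 : 0 < e / 2 by rewrite divr_gt0.
  have [d1 d10 h1] := path_function_right w st e20.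
  have [d2 d20 h2] := time_integral_right mg C0 gC w st e20.
  exists (Num.min d1 d2); first by rewrite lt_min d10.
  move=> r /andP[sr]; rewrite -ltrBlDl lt_min !ltrBlDl => /andP[r1 r2] rt.
  have H1 := h1 r; have H2 := h2 r; rewrite sr r1 in H1; rewrite sr r2 in H2.
  have -> : f (w s) - f (w 0) - time_integral g s w - (f (w r) - f (w 0) - time_integral g r w) =
    (f (w s) - f (w r)) - (time_integral g s w - time_integral g r w) by ring.
  apply: le_lt_trans (ler_normB _ _) _; rewrite [X in _ < X](splitr e).
  by apply: ltrD; [exact: H1|exact: H2].
Qed.

End dynkin_formula.

(** * The position at the exit *)

Section null_sets.
Context d (T : measurableType d) (R : realType) (mu : {measure set T -> \bar R}).

Lemma integral0_null (h : T -> R) : (forall x, 0 <= h x) -> measurable_fun setT h ->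
  (\int[mu]_x (h x)%:E = 0)%E -> mu [set x | 0 < h x] = 0%E.
Proof.
move=> h0 mh ih; have mh' : measurable_fun setT (EFin \o h) by exact/measurable_EFinP.
have m0 : measurable [set x | 0 < h x].
  have := mh measurableT _ (measurable_itv `]0, +oo[); rewrite setTI.
  by congr measurable; apply/seteqP; split=> x /=; rewrite in_itv/= andbT.
have /(ae_eq_integral_abs mu measurableT mh').1 : (\int[mu]_x `|(EFin \o h) x| = 0)%E.
  by rewrite -[RHS]ih; apply: eq_integral => x _; rewrite /= ger0_norm.
move=> /negligibleS H; apply/negligibleP => //; apply: H => x /= hx /(_ I) h0'.
by move: h0' => [] /eqP; rewrite gt_eqF.
Qed.

Lemma null_bigcup_countable (I : countType) (S : set I) (F : I -> set T) :
  (forall i, S i -> mu.-negligible (F i)) -> mu.-negligible (\bigcup_(i in S) F i).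
Proof.
move=> F0; pose G k := if unpickle k is Some i then (if i \in S then F i else set0) else set0.
apply: (@negligibleS _ _ _ mu (\bigcup_k G k)).
  move=> x [i Si Fx]; exists (pickle i) => //; rewrite /G pickleK.
  by rewrite mem_set.
apply: negligible_bigcup => k; rewrite /G; case: unpickle => [i|]; last exact: negligible_set0.
by case: ifPn => [/set_mem/F0//|_]; exact: negligible_set0.
Qed.
End null_sets.

(** * The position at the end of survival is almost surely off [D] *)

Section exit_position.
Context {R : realType} {n : nat}.
Variables (D : set 'rV[R]_n).
Variables (Q : 'rV[R]_n -> 'M[R]_n) (b : 'rV[R]_n -> 'rV[R]_n).
Variable N : R.-ker 'rV[R]_n ~> 'rV[R]_n.
Hypotheses (oD : open D) (hQ : diffusion_coefficient Q) (hb : drift_coefficient b)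
  (hN : levy_kernel N).
Variables (P : {measure set (cadlag_path R n) -> \bar R}).
Hypotheses (P1 : P setT = 1%E) (MP : forall f, Cb2 f ->
  martingale P (fun s w => f (w s) - f (w 0) - time_integral (generator Q b N f) s w)).
Variables (t : R) (t0 : 0 < t).
Implicit Types w : cadlag_path R n.

Local Notation T := (survival_time D t).
Local Notation T_ k := (level_time D k t).

Lemma survival_time_itv w : 0 <= T w <= t.
Proof. by apply: life_itv; exact: ltW. Qed.

Lemma level_time_itv k w : 0 <= T_ k w <= t.
Proof. by apply: life_itv; exact: ltW. Qed.

Lemma filtration_survival s : 0 <= s <= t -> filtration s [set w : cadlag_path R n | s <= T w].
Proof. exact: filtration_survival_time. Qed.

Lemma filtration_level k s : 0 <= s <= t -> filtration s [set w : cadlag_path R n | s <= T_ k w].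
Proof. exact: filtration_level_time. Qed.

Lemma measurable_survives s : 0 <= s -> measurable (@survives R n D s).
Proof. by move=> s0; apply: filtration_measurable; exact: filtration_survives. Qed.

Lemma measurable_exit_position : measurable_fun setT (fun w => w (T w)).
Proof. exact: measurable_stopped_path t0 survival_time_itv filtration_survival. Qed.

(* At the hitting times [T_ k] the path is in the closed set where [gap <= 1/k],
   on which [f] vanishes: hence [f (w (T_ k w))] tends to [f (w t)] on the event
   of survival and to 0 off it, whereas [T_ k] increases to [T]. *)
Lemma exit_position_box (a c : 'rV[R]_n) (k0 : nat) : box a c `<=` gap_ge (~` D) k0 ->
  P (~` survives D t `&` [set w : cadlag_path R n | box a c (w (T w))]) = 0%E.
Proof.
move=> abD; pose f := smooth_box a c 0.
have Cf : Cb2 f by exact: Cb2_smooth_box.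
have Pfin : (P setT < +oo)%E by rewrite P1 ltry.
case: (Cf) => -[cf _] _ _; have mf := continuous_rV_measurable cf.
have f01 y : 0 <= f y <= 1 by exact: smooth_box_itv.
have fB y : `|f y| <= 1 by have := f01 y; rewrite ler_norml; lra.
have mg := generator_measurable hQ hb hN Cf.
have [C C0 gC] := generator_bounded hQ hb hN Cf.
set g := generator Q b N f in mg gC.
have dT := dynkin_formula t0 survival_time_itv filtration_survival cf fB mg C0 gC P1 (MP Cf).
have dk k := dynkin_formula t0 (level_time_itv k) (@filtration_level k) cf fB mg C0 gC P1 (MP Cf).
have mA := measurable_survives (ltW t0).
have mX := measurableT_comp mf measurable_exit_position.
have mI : measurable_fun setT (\1_(survives D t) : cadlag_path R n -> R) by exact: measurable_indic.
pose h (w : cadlag_path R n) : R := f (w (T w)) * \1_(survives D t) w.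
have mh : measurable_fun setT h by apply: measurable_funM.
have I01 (w : cadlag_path R n) : (0 : R) <= \1_(survives D t) w <= (1 : R) by rewrite indicE ler0n lern1 leq_b1.
have h01 w : 0 <= h w <= f (w (T w)).
  have := f01 (w (T w)); have := I01 w; rewrite /h => /andP[i0 i1] /andP[f0 f1].
  by rewrite mulr_ge0//= ler_piMr.
have z0 : 0 <= (0 : R) by [].
have TwB (T' : cadlag_path R n -> R) w : 0 <= T' w <= t -> `|time_integral g (T' w) w| <= C * t.
  move=> /andP[T1 T2].
  by apply: le_trans (time_integral_le mg C0 gC w T1) _; rewrite ler_wpM2l.
have lim1 : (\int[P]_w (f (w (T_ k w)))%:E @[k --> \oo] --> \int[P]_w (h w)%:E)%E.
  apply: (@bounded_convergence _ _ _ P Pfin _ _ 1) => //.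
    move=> k; apply: (measurableT_comp mf).
    exact: measurable_stopped_path t0 (level_time_itv k) (@filtration_level k).
  move=> w; have [A|A] := pselect (survives D t w).
    rewrite /h indicE mem_set// mulr1 survives_time// ?ltW//.
    case: (A) => k1 hk1; apply: cvg_near_cst; exists k1 => // k /= k1k.
    rewrite (_ : T_ k w = t)//; have /andP[l1 l2] := level_time_itv k w.
    apply/eqP; rewrite eq_le l2/=; apply/life_geP; first by rewrite ltW//=.
    by move=> r /andP[r0 /ltW rt]; apply: (gap_ge_mono k1k); apply: hk1; rewrite r0.
  rewrite /h indicE memNset// mulr0.
  (* Starting one level after [k0] makes the gap at the level time strictly smaller than the gap on
     the box. *)
  apply: cvg_near_cst; exists k0.+1 => // k /= k0k.
  apply: smooth_box_out => /abD; rewrite /gap_ge/= leNgt => /negP; apply.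
  have lg := level_time_gap k (ltW t0) A; apply: le_lt_trans lg _.
  by rewrite ltf_pV2 ?posrE// ltr_nat.
have mJ k := measurable_stopped_integral t0 (level_time_itv k) (@filtration_level k) cf mg C0 gC (MP Cf).
(* The path may jump at [T], so [f] along it need not converge; Dynkin's formula replaces it by time
   integrals, which are Lipschitz in their upper bound. *)
have lim2 : (\int[P]_w (f (w (T_ k w)))%:E @[k --> \oo] --> \int[P]_w (f (w (T w)))%:E)%E.
  rewrite dT; under eq_cvg do rewrite dk.
  apply: (@bounded_convergence _ _ _ P Pfin _ _ (1 + C * t)).
  - move=> k; apply: measurable_funD; first exact: (measurableT_comp mf (measurable_coord z0)).
    exact: mJ.
  - by move=> k w; apply: le_trans (ler_normD _ _) _; rewrite lerD// TwB// level_time_itv.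
  - move=> w; apply: cvgD; first exact: cvg_cst.
    have cT := @cvg_level_time _ _ D t w (ltW t0).
    apply/cvgrPdist_le => e e0; move/cvgrPdist_le : cT.
    have e1 : 0 < e / (C + 1) by rewrite divr_gt0// ltr_wpDl.
    move=> /(_ _ e1); apply: filterS => k ke.
    have /andP[l1 l2] := level_time_itv k w; have lT := @level_time_le _ _ D k t w (ltW t0).
    apply: le_trans (time_integral_lip mg C0 gC _ _) _; first by rewrite l1.
    rewrite ger0_norm ?subr_ge0// in ke.
    apply: le_trans (ler_wpM2l C0 ke) _; rewrite mulrA ler_pdivrMr ?ltr_wpDl//; nra.
have E : (\int[P]_w (h w)%:E = \int[P]_w (f (w (T w)))%:E)%E.
  by rewrite -(cvg_lim _ lim1)// -(cvg_lim _ lim2).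
(* The difference is nonnegative with mean 0; it is positive exactly on the event of the
   statement. *)
have : P [set w : cadlag_path R n | 0 < f (w (T w)) - h w] = 0%E.
  apply: integral0_null.
  - by move=> w; rewrite subr_ge0; case/andP: (h01 w).
  - exact: measurable_funB.
  - under eq_integral do rewrite EFinB.
    have if1 : P.-integrable setT (EFin \o (fun w => f (w (T w)))).
      exact: (@bounded_fun_integrable _ _ _ P Pfin _ _ 1).
    have if2 : P.-integrable setT (EFin \o h).
      apply: (@bounded_fun_integrable _ _ _ P Pfin _ _ 1) => // w _.
      by have := h01 w; have := f01 (w (T w)); rewrite ler_norml; lra.
    by rewrite integralB_EFin// E subee//; exact: integrable_fin_num if1.
congr (P _ = _); apply/seteqP; split=> w /=.
  rewrite /h indicE; have [A|A] := pselect (survives D t w).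
    by rewrite mem_set// mulr1 subrr ltxx.
  rewrite memNset// mulr0 subr0 => f0; split=> //.
  by apply: contrapT => /(smooth_box_out 0); rewrite -/f; move: f0 => /[swap] ->; rewrite ltxx.
move=> [A bT]; rewrite /h indicE memNset// mulr0 subr0; exact: smooth_box_gt0.
Qed.

(** Excludes the paths whose left limit reaches the boundary while they jump back into [D] at that
    instant. Countably many rational boxes, each inside one level of the gap, cover [D]. *)
Lemma exit_position_out : P.-negligible (~` survives D t `&` [set w : cadlag_path R n | D (w (T w))]).
Proof.
pose S := [set q : 'rV[rat]_n * 'rV[rat]_n | exists k, @ratbox R n q `<=` gap_ge (~` D) k].
apply: (@negligibleS _ _ _ P (\bigcup_(q in S)
    (~` survives D t `&` [set w : cadlag_path R n | ratbox q (w (T w))]))).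
  move=> w [A Dw].
  have g0 : 0 < gap (~` D) (w (T w)) by exact/gap_gt0D.
  have g20 : 0 < gap (~` D) (w (T w)) / 2 by rewrite divr_gt0.
  have [q [qw qe]] := ratbox_ball (w (T w)) g20.
  exists q => //; have [k _ kg] := near_infty_natSinv_lt (PosNum g20).
  exists k => y qy; have : ball (w (T w)) (gap (~` D) (w (T w)) / 2) y.
    apply: qe => i; have := qy i; rewrite !mxE => /andP[/ltW-> /ltW->//].
  rewrite mx_norm_ball /ball_/= /gap_ge/=; have := gap_lip (~` D) (w (T w)) y.
  have := kg k (leqnn k); rewrite /=; move: (k.+1%:R^-1) => u; lra.
apply: null_bigcup_countable => q [k qk].
apply/negligibleP; last exact: exit_position_box qk.
apply: measurableI; first by apply: measurableC; exact: measurable_survives (ltW t0).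
have := measurable_exit_position measurableT (open_rV_measurable (@box_open R n (map_mx ratr q.1) (map_mx ratr q.2))).
rewrite setTI; exact.
Qed.

End exit_position.

(** * Boxes as a generating class stable under intersection *)

Section borel_boxes.
Context {R : realType} {n : nat}.

Lemma boxI (a b c e : 'rV[R]_n) : box a b `&` box c e =
  box (\row_i Num.max (a 0 i) (c 0 i)) (\row_i Num.min (b 0 i) (e 0 i)).
Proof.
apply/seteqP; split=> [x [h1 h2] i|x h].
  case/andP: (h1 i) => h3 h4; case/andP: (h2 i) => h5 h6.
  by rewrite !mxE gt_max lt_min h3 h4 h5 h6.
by split=> i; have := h i; rewrite !mxE gt_max lt_min => /andP[/andP[h1 h2] /andP[h3 h4]];
  apply/andP.
Qed.

Lemma measurable_boxE :
  @measurable _ 'rV[R]_n = <<s [set B | exists a b : 'rV[R]_n, B = box a b] >>.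
Proof.
apply/seteqP; split; apply: smallest_sub.
- exact: smallest_sigma_algebra.
- move=> U oU; rewrite (open_ratbox oU).
  set S := (X in \bigcup_(q in X) _).
  pose F q := if q \in S then ratbox q else set0 : set 'rV[R]_n.
  have -> : \bigcup_(q in S) ratbox q = \bigcup_k (if unpickle k is Some q then F q else set0).
    apply/seteqP; split=> [x [q Sq Fq]|x [k _]].
      by exists (pickle q) => //; rewrite pickleK /F mem_set.
    by case: unpickle => // q; rewrite /F; case: ifPn => // /set_mem Sq qx; exists q.
  apply: sigma_algebra_bigcup => k; case: unpickle => [q|]; last exact: sigma_algebra0.
  rewrite /F; case: ifP => _; last exact: sigma_algebra0.
  by apply: sub_sigma_algebra; exists (map_mx ratr q.1), (map_mx ratr q.2).
- exact: sigma_algebra_measurable.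
- by move=> _ [a [b ->]]; apply: open_rV_measurable; exact: box_open.
Qed.
End borel_boxes.

(** * The Levy system formula at the exit *)

Section exit_jump.
Context {R : realType} {n : nat}.
Variables (D : set 'rV[R]_n).
Variables (Q : 'rV[R]_n -> 'M[R]_n) (b : 'rV[R]_n -> 'rV[R]_n).
Variable N : R.-ker 'rV[R]_n ~> 'rV[R]_n.
Hypotheses (oD : open D) (hQ : diffusion_coefficient Q) (hb : drift_coefficient b)
  (hN : levy_kernel N).
Variables (P : {measure set (cadlag_path R n) -> \bar R}).
Hypotheses (P1 : P setT = 1%E) (MP : forall f, Cb2 f ->
  martingale P (fun s w => f (w s) - f (w 0) - time_integral (generator Q b N f) s w)).
Hypothesis P0 : P.-negligible [set w : cadlag_path R n | ~ D (w 0)].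
Variables (t : R) (t0 : 0 < t).
Implicit Types (w : cadlag_path R n) (B : set 'rV[R]_n).

Local Notation T := (survival_time D t).

Variables (v v' : 'rV[R]_n) (K : R).
Let V := box v v'.
Hypotheses (VD : V `&` D = set0) (K0 : 0 <= K)
  (VK : forall x, D x -> (N x [set y | V (x + y)%R] <= K%:E)%E).

(** The rate of jumps from [x] into [B] within [V]. It is set to 0 off [D], so that the bound [K]
    holds everywhere. *)
Definition jump_rate B : 'rV[R]_n -> \bar R :=
  (fun x => N x [set y | (B `&` V) (x + y)]) \_ D.

Definition jump_mean B w : \bar R :=
  (\int[lebesgue_measure]_(r in `[0%R, T w]) jump_rate B (w r))%E.

Let mV : measurable V.
Proof. by apply: open_rV_measurable; exact: box_open. Qed.

Let measurable_shift B x : measurable B -> measurable [set y : 'rV[R]_n | B (x + y)].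
Proof.
move=> mB; have := measurableT_comp measurable_addrV (measurable_pair1 x).
by move=> /(_ measurableT B mB); rewrite setTI.
Qed.

Let indic_shift B x : measurable B ->
  (\int[N x]_y (\1_[set y | (B `&` V) (x + y)%R] y)%:E)%E = N x [set y | (B `&` V) (x + y)].
Proof.
by move=> mB; rewrite integral_indic ?setIT//; exact: (measurable_shift x (measurableI _ _ mB mV)).
Qed.

Lemma jump_rate_ge0 B x : (0 <= jump_rate B x)%E.
Proof. by rewrite /jump_rate patchE; case: ifP. Qed.

Lemma jump_rate_le B x : measurable B -> (jump_rate B x <= K%:E)%E.
Proof.
move=> mB; rewrite /jump_rate patchE; case: ifPn => [/set_mem Dx|_]; last by rewrite lee_fin.
apply: le_trans (VK Dx); apply: le_measure; rewrite ?inE.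
- exact: (measurable_shift x (measurableI _ _ mB mV)).
- exact: (measurable_shift x mV).
- by move=> y [].
Qed.

Lemma jump_rate_measurable B : measurable B -> measurable_fun setT (jump_rate B).
Proof.
move=> mB; apply/(measurable_restrictT _ (open_rV_measurable oD)).
apply: measurable_funTS.
pose S := [set z : 'rV[R]_n * 'rV[R]_n | (B `&` V) (z.1 + z.2)].
have mS : measurable S.
  have := @measurable_addrV R n measurableT _ (measurableI _ _ mB mV).
  by rewrite setTI.
have := @measurable_integral_levy R n N hN (fun z => (\1_S z)%:E).
have -> : (fun x => \int[N x]_y (\1_S (x, y))%:E)%E = (fun x => N x [set y | (B `&` V) (x + y)]).
  by apply/funext => x; rewrite -indic_shift//; apply: eq_integral => y _; rewrite !indicE.
apply; first by move=> z; rewrite lee_fin indicE.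
by apply/measurable_EFinP; exact: measurable_indic.
Qed.

Lemma jump_rate_along B w : measurable B -> measurable_fun setT (fun r => jump_rate B (w r)).
Proof. by move=> mB; exact: (measurableT_comp (jump_rate_measurable mB) (path_measurable w)). Qed.

Lemma jump_mean_ge0 B w : (0 <= jump_mean B w)%E.
Proof. by apply: integral_ge0 => r _; exact: jump_rate_ge0. Qed.

Lemma jump_mean_fin B w : measurable B -> jump_mean B w \is a fin_num.
Proof.
move=> mB; rewrite ge0_fin_numE ?jump_mean_ge0//.
apply: (@le_lt_trans _ _ (\int[lebesgue_measure]_(r in `[0%R, T w]) K%:E)%E).
  apply: ge0_le_integral => //.
  - by move=> r _; exact: jump_rate_ge0.
  - by apply: measurable_funTS; exact: jump_rate_along.
  - by move=> r _; exact: jump_rate_le.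
by rewrite integral_cst// lte_mul_pinfty// itv_lty.
Qed.

Let exits B : set (cadlag_path R n) := [set w : cadlag_path R n | (B `&` V) (w (T w))].

Let measurable_exits B : measurable B -> measurable (exits B).
Proof.
move=> mB; have := measurable_exit_position D t0 measurableT (measurableI _ _ mB mV).
by rewrite setTI.
Qed.

Let levy_identity B := measurable_fun setT (jump_mean B) /\
  P (exits B) = (\int[P]_w jump_mean B w)%E.

(* Dynkin's formula for bumps supported in [V]: as [V] is off [D], only the jump
   part of the generator is left on [D]. *)
Let levy_identity_box (a c : 'rV[R]_n) B : measurable B -> B `&` V = box a c -> levy_identity B.
Proof.
move=> mB BV; pose f m := smooth_box a c m.
have Cf m : Cb2 (f m) by exact: Cb2_smooth_box.
have fc m : continuous (f m) by case: (Cf m) => -[].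
have mf m := continuous_rV_measurable (fc m).
have f01 m y : 0 <= f m y <= 1 by exact: smooth_box_itv.
have fB m y : `|f m y| <= 1 by have := f01 m y; rewrite ler_norml; lra.
have fD m y : D y -> f m y = 0.
  move=> Dy; apply: smooth_box_out; rewrite -BV => -[_ Vy].
  by have : (V `&` D) y by []; rewrite VD.
have mshift (x : 'rV[R]_n) m : measurable_fun setT (fun y : 'rV[R]_n => (f m (x + y)%R)%:E).
  apply/measurable_EFinP; apply: (measurableT_comp (mf m)).
  exact: (measurableT_comp measurable_addrV (measurable_pair1 x)).
pose k m : 'rV[R]_n -> \bar R := (fun x => \int[N x]_y (f m (x + y)%R)%:E)%E \_ D.
have k0 m x : (0 <= k m x)%E.
  rewrite /k patchE; case: ifP => // _; apply: integral_ge0 => y _.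
  by rewrite lee_fin; case/andP: (f01 m (x + y)).
have mk m : measurable_fun setT (k m).
  apply/(measurable_restrictT _ (open_rV_measurable oD)).
  apply: measurable_funTS.
  apply: (@measurable_integral_levy R n N hN (fun z => (f m (z.1 + z.2))%:E)).
    by move=> z; rewrite lee_fin; case/andP: (f01 m (z.1 + z.2)).
  by apply/measurable_EFinP; apply: (measurableT_comp (mf m)); exact: measurable_addrV.
have kmono x : nondecreasing_seq (fun m => k m x).
  move=> m m' mm'; rewrite /k !patchE; case: ifP => // _.
  apply: ge0_le_integral => //.
  - by move=> y _; rewrite lee_fin; case/andP: (f01 m (x + y)).
  - by move=> y _; rewrite lee_fin; exact: smooth_box_mono.
have klim x : (k m x @[m --> \oo] --> jump_rate B x)%E.
  rewrite /k /jump_rate !patchE; case: ifP => Dx; last first.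
    under eq_fun do rewrite patchE Dx.
    exact: cvg_cst.
  under eq_fun do rewrite patchE Dx.
  have -> : N x [set y | (B `&` V) (x + y)] = (\int[N x]_y (\1_(box a c) (x + y)%R)%:E)%E.
    by rewrite -indic_shift//; apply: eq_integral => y _; rewrite !indicE -BV.
  have -> : (\int[N x]_y (\1_(box a c) (x + y)%R)%:E = \int[N x]_y (limn (fun m => (f m (x + y)%R)%:E)))%E.
    apply: eq_integral => y _; apply/esym/cvg_lim => //.
    by apply: cvg_EFin; [exact: nearW|exact: smooth_box_cvg].
  apply: cvg_monotone_convergence => //.
  - by move=> m y _; rewrite lee_fin; case/andP: (f01 m (x + y)).
  - by move=> y _ m m' mm'; rewrite lee_fin; exact: smooth_box_mono.
have kfin m x : D x -> (\int[N x]_y (f m (x + y)%R)%:E)%E \is a fin_num.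
  move=> Dx; rewrite ge0_fin_numE; last first.
    by apply: integral_ge0 => y _; rewrite lee_fin; case/andP: (f01 m (x + y)).
  apply: le_lt_trans (_ : _ <= K%:E)%E _; last exact: ltry.
  apply: le_trans (VK Dx); have mVx := measurable_shift x mV.
  rewrite -[X in (_ <= N x X)%E]setIT -integral_indic//.
  apply: ge0_le_integral => //.
  - by move=> y _; rewrite lee_fin; case/andP: (f01 m (x + y)).
  - by apply/measurable_EFinP; exact: measurable_indic.
  - move=> y _; rewrite lee_fin indicE; have [xyV|xyV] := pselect (V (x + y)).
      by rewrite mem_set//; case/andP: (f01 m (x + y)).
    rewrite memNset// /f smooth_box_out// -BV => -[_]; exact: xyV.
pose g m := generator Q b N (f m).
have mg m : measurable_fun setT (g m) by exact: generator_measurable.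
have /choice[C HC] : forall m, exists C : R, 0 <= C /\ forall x, `|g m x| <= C.
  by move=> m; have [C C0 gC] := generator_bounded hQ hb hN (Cf m); exists C.
(* Before [T] the path is in [D], where the generator reduces to its jump part. The end point is
   dropped from both integrals because [w (T w)] may lie off [D]. *)
have IE m w : (time_integral (g m) (T w) w)%:E =
    (\int[lebesgue_measure]_(r in `[0%R, T w]) k m (w r))%E.
  have [Cm gm] := HC m; have mgw := measurable_along (mg m) w.
  have mkw : measurable_fun setT (fun r => k m (w r)).
    exact: (measurableT_comp (mk m) (path_measurable w)).
  rewrite /time_integral /Rintegral fineK; last first.
    by apply: integrable_fin_num => //; exact: (itv_integrable (mg m) gm).
  rewrite -integral_itv_bndo_bndc; last by apply/measurable_EFinP; exact: measurable_funTS.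
  rewrite -[RHS]integral_itv_bndo_bndc; last exact: measurable_funTS.
  apply: eq_integral => r; rewrite inE/= in_itv/= => rT.
  have Dr : D (w r) := before_survival_time oD (ltW t0) rT.
  rewrite /k patchE mem_set// [g m (w r)](generator_local Q b N oD Dr (fD m)) /Rintegral fineK//.
  exact: kfin.
have kint_mono w m m' : (m <= m')%N ->
    (\int[lebesgue_measure]_(r in `[0%R, T w]) k m (w r) <=
     \int[lebesgue_measure]_(r in `[0%R, T w]) k m' (w r))%E.
  move=> mm'; apply: ge0_le_integral.
  - exact: measurable_itv.
  - by move=> r _; exact: k0.
  - by apply: measurable_funTS; exact: (measurableT_comp (mk m) (path_measurable w)).
  - by apply: measurable_funTS; exact: (measurableT_comp (mk m') (path_measurable w)).
  - by move=> r _; exact: kmono.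
have mI m : measurable_fun setT (fun w => time_integral (g m) (T w) w).
  exact: (measurable_stopped_integral t0 (survival_time_itv D t0) (@filtration_survival _ _ D t)
    (fc m) (mg m) (HC m).1 (HC m).2 (MP (Cf m))).
have Jlim w : ((time_integral (g m) (T w) w)%:E @[m --> \oo] --> jump_mean B w)%E.
  under eq_cvg do rewrite IE.
  have -> : jump_mean B w = (\int[lebesgue_measure]_(r in `[0%R, T w]) limn (fun m => k m (w r)))%E.
    by apply: eq_integral => r _; apply/esym/cvg_lim => //; exact: klim.
  apply: cvg_monotone_convergence => //.
  by move=> m; apply: measurable_funTS; exact: (measurableT_comp (mk m) (path_measurable w)).
have mJ : measurable_fun setT (jump_mean B).
  apply: (@emeasurable_fun_cvg _ _ _ _ (fun m w => (time_integral (g m) (T w) w)%:E)) => //.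
  by move=> m; exact/measurable_EFinP.
split => //.
have mX := measurable_exit_position D t0.
have Pfin : (P setT < +oo)%E by rewrite P1 ltry.
have [Z [mZ Z0 ZD]] := P0.
(* The initial term of Dynkin's formula disappears: the paths almost surely start in [D], where
   [f m] is 0. *)
have E m : (\int[P]_w (f m (w (T w)))%:E = \int[P]_w (time_integral (g m) (T w) w)%:E)%E.
  rewrite (dynkin_formula t0 (survival_time_itv D t0) (@filtration_survival _ _ D t)
    (fc m) (fB m) (mg m) (HC m).1 (HC m).2 P1 (MP (Cf m))).
  apply: (integral_eq_off_null mZ Z0) => w Zw; rewrite !patchE !in_setT fD ?add0r//.
  by apply: contrapT => /ZD.
have L1 : (\int[P]_w (f m (w (T w)))%:E @[m --> \oo] --> P (exits B))%E.
  have -> : P (exits B) = (\int[P]_w (\1_(exits B) w)%:E)%E.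
    by rewrite integral_indic ?setIT//; exact: measurable_exits.
  apply: (@bounded_convergence _ _ _ P Pfin _ _ 1) => //.
    by move=> m; exact: (measurableT_comp (mf m) mX).
  move=> w; have := @smooth_box_cvg _ _ a c (w (T w)).
  by rewrite -BV !indicE.
have L2 : (\int[P]_w (f m (w (T w)))%:E @[m --> \oo] --> \int[P]_w jump_mean B w)%E.
  under eq_cvg do rewrite E.
  have -> : (\int[P]_w jump_mean B w = \int[P]_w limn (fun m => (time_integral (g m) (T w) w)%:E))%E.
    by apply: eq_integral => w _; apply/esym/cvg_lim => //; exact: Jlim.
  apply: cvg_monotone_convergence => //.
  - by move=> m; exact/measurable_EFinP.
  - by move=> m w _; rewrite IE; apply: integral_ge0 => r _.
  - by move=> w _ m m' mm'; move: (kint_mono w m m' mm'); rewrite -(IE m w) -(IE m' w).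
by rewrite -(cvg_lim _ L1)// -(cvg_lim _ L2).
Qed.

(** A monotone class argument from the boxes. Measurability of [jump_mean B] is carried along, since
    the passage to countable unions integrates a series term by term. *)
Lemma levy_exit B : measurable B -> measurable_fun setT (jump_mean B) /\
  P (exits B) = (\int[P]_w jump_mean B w)%E.
Proof.
move=> mB; rewrite -/(levy_identity B).
have [mJT ET] : levy_identity setT by apply: (levy_identity_box (a := v) (c := v')); rewrite ?setTI.
move: (mB); rewrite measurable_boxE; move: B mB => B _.
apply: (dynkin_induction measurable_boxE) => //.
- by move=> _ _ [a [c ->]] [a' [c' ->]]; rewrite boxI; do 2 eexists.
- move=> _ [a [c ->]]; apply: levy_identity_box (boxI _ _ _ _).
  by apply: open_rV_measurable; exact: box_open.
(* Complements are taken within [V], by subtraction from the identity for [setT]; the bound [K]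
   makes the subtracted means finite. *)
- move=> S mS [mJ ES]; have mS' := measurableC mS.
  have kE x : (jump_rate setT x = jump_rate S x + jump_rate (~` S) x)%E.
    rewrite /jump_rate !patchE; case: ifP => _; rewrite ?adde0//.
    have mSV := measurable_shift x (measurableI _ _ mS mV).
    have mSV' := measurable_shift x (measurableI _ _ mS' mV).
    rewrite -measureU//; last by apply/seteqP; split=> // y [[]] ? ? [].
    congr (N x _); apply/seteqP; split=> [y [_ Vy]|y [[]|[]]//].
    by have [Sy|Sy] := pselect (S (x + y)); [left|right].
  have JE w : (jump_mean setT w = jump_mean S w + jump_mean (~` S) w)%E.
    rewrite /jump_mean -ge0_integralD//.
    - by apply: eq_integral => r _; rewrite kE.
    - by move=> r _; exact: jump_rate_ge0.
    - by apply: measurable_funTS; exact: jump_rate_along.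
    - by move=> r _; exact: jump_rate_ge0.
    - by apply: measurable_funTS; exact: jump_rate_along.
  have mJ' : measurable_fun setT (jump_mean (~` S)).
    have -> : jump_mean (~` S) = (fun w => jump_mean setT w - jump_mean S w)%E.
      by apply/funext => w; rewrite JE addeAC subee ?add0e// jump_mean_fin.
    exact: emeasurable_funB.
  split=> //.
  have PE : P (exits setT) = (P (exits S) + P (exits (~` S)))%E.
    have mS1 := measurable_exits mS; have mS2 := measurable_exits mS'.
    rewrite -measureU//; last by apply/seteqP; split=> // w [[]] ? ? [].
    congr (P _); apply/seteqP; split=> [w [_ Vw]|w [[]|[]]//].
    by have [Sw|Sw] := pselect (S (w (T w))); [left|right].
  have IE : (\int[P]_w jump_mean setT w = \int[P]_w jump_mean S w + \int[P]_w jump_mean (~` S) w)%E.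
    under eq_integral do rewrite JE.
    by rewrite ge0_integralD// => w _; exact: jump_mean_ge0.
  have Pf : P (exits S) \is a fin_num.
    rewrite ge0_fin_numE//; apply: (@le_lt_trans _ _ (P setT)); last by rewrite P1 ltry.
    by apply: le_measure; rewrite ?inE//; exact: measurable_exits.
  move: PE; rewrite ET IE -ES => /esym.
  by move/(congr1 (fun z => z - P (exits S))%E); rewrite ![(P (exits S) + _)%E]addeC !addeK.
move=> F mF tF HF.
have kE x : jump_rate (\bigcup_k F k) x = (\sum_(i <oo) jump_rate (F i) x)%E.
  rewrite /jump_rate !patchE; case: ifP => Dx; last first.
    by under eq_eseriesr do rewrite patchE Dx; rewrite eseries0.
  under eq_eseriesr do rewrite patchE Dx.
  rewrite -measure_semi_bigcup.
  - by congr (N x _); rewrite setI_bigcupl; apply/seteqP; split.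
  - by move=> i; exact: (measurable_shift x (measurableI _ _ (mF i) mV)).
  - move=> i j _ _ [y [[Fi _] [Fj _]]]; apply: tF => //; by exists (x + y).
  - apply: bigcupT_measurable => i; exact: (measurable_shift x (measurableI _ _ (mF i) mV)).
have JE w : jump_mean (\bigcup_k F k) w = (\sum_(i <oo) jump_mean (F i) w)%E.
  rewrite /jump_mean -integral_nneseries//.
  - by apply: eq_integral => r _; rewrite kE.
  - by move=> i; apply: measurable_funTS; exact: jump_rate_along.
  - by move=> i r _; exact: jump_rate_ge0.
split.
  have -> : jump_mean (\bigcup_k F k) = (fun w => \sum_(i <oo) jump_mean (F i) w)%E by exact/funext.
  apply: ge0_emeasurable_sum => [i w _ _|i _]; first exact: jump_mean_ge0.
  exact: (HF i).1.
under eq_integral do rewrite JE.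
rewrite integral_nneseries//.
- under eq_eseriesr do rewrite -(HF _).2.
  rewrite -measure_semi_bigcup.
  + by congr (P _); rewrite /exits setI_bigcupl; apply/seteqP; split.
  + by move=> i; exact: measurable_exits.
  + move=> i j _ _ [w [[Fi _] [Fj _]]]; apply: tF => //; by exists (w (T w)).
  + by apply: bigcupT_measurable => i; exact: measurable_exits.
- by move=> i; exact: (HF i).1.
- by move=> i w _; exact: jump_mean_ge0.
Qed.

Lemma exit_null B : measurable B -> (forall x, D x -> N x [set y | (B `&` V) (x + y)] = 0%E) ->
  P (exits B) = 0%E.
Proof.
move=> mB NB; have [_ ->] := levy_exit mB.
apply: integral0_eq => w _; apply: integral0_eq => r _.
by rewrite /jump_rate patchE; case: ifPn => // /set_mem/NB.
Qed.

End exit_jump.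

(** * The complement of the support *)

Section support.
Context {R : realType} {n : nat}.

(** By second countability, the complement of the support is covered by countably many rational
    boxes of measure 0. *)
Lemma msuppC_negligible (mu : {measure set 'rV[R]_n -> \bar R}) : mu.-negligible (~` msupp mu).
Proof.
pose S := [set q : 'rV[rat]_n * 'rV[rat]_n | mu (@ratbox R n q) = 0%E].
apply: (@negligibleS _ _ _ mu (\bigcup_(q in S) ratbox q)).
  move=> x /existsNP[U /not_implyP[oU /not_implyP[Ux /negP]]].
  rewrite -leNgt => U0; rewrite (open_ratbox oU) in Ux.
  case: Ux => q qU qx; exists q => //.
  apply/eqP; rewrite -measure_le0; apply: le_trans U0; apply: le_measure; rewrite ?inE//.
    by apply: open_rV_measurable; exact: box_open.
  exact: open_rV_measurable.
apply: null_bigcup_countable => q q0; apply/negligibleP => //.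
by apply: open_rV_measurable; exact: box_open.
Qed.
End support.

(** * The exit takes place through the extended closure *)

Section exit_value.
Context {R : realType} {n : nat}.
Variables (D : set 'rV[R]_n).
Variables (Q : 'rV[R]_n -> 'M[R]_n) (b : 'rV[R]_n -> 'rV[R]_n).
Variable N : R.-ker 'rV[R]_n ~> 'rV[R]_n.
Hypotheses (oD : open D) (hQ : diffusion_coefficient Q) (hb : drift_coefficient b)
  (hN : levy_kernel N).
Variables (P : {measure set (cadlag_path R n) -> \bar R}).
Hypotheses (P1 : P setT = 1%E) (MP : forall f, Cb2 f ->
  martingale P (fun s w => f (w s) - f (w 0) - time_integral (generator Q b N f) s w)).
Hypothesis P0 : P.-negligible [set w : cadlag_path R n | ~ D (w 0)].
Variables (t : R) (t0 : 0 < t).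
Local Notation T := (survival_time D t).

(** The extended closure involves an uncountable union of supports, whence the formulation by Borel
    sets that avoid it. Such a set misses the closure of [D], so rational boxes at positive distance
    from [D] cover it; the rate of jumps from [D] into each of them is bounded, as [exit_null]
    requires. *)
Lemma exit_ext_closure (B : set 'rV[R]_n) : measurable B -> B `&` ext_closure N D = set0 ->
  P.-negligible [set w : cadlag_path R n | B (w (T w))].
Proof.
move=> mB BS.
have BD y : B y -> ~ closure D y.
  move=> By cDy; have : (B `&` ext_closure N D) y; last by rewrite BS.
  split=> //; have [Dy|nDy] := pselect (D y); [by left|right; left].
  by split=> // /interior_subset.
have NB x : D x -> N x [set y | B (x + y)] = 0%E.
  move=> Dx; have mBx : measurable [set y : 'rV[R]_n | B (x + y)].
    have := measurableT_comp measurable_addrV (measurable_pair1 x).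
    by move=> /(_ measurableT B mB); rewrite setTI.
  apply/negligibleP => //; apply: negligibleS (msuppC_negligible (N x)) => y By Ny.
  have : (B `&` ext_closure N D) (x + y); last by rewrite BS.
  split=> //; have [Dxy|nDxy] := pselect (D (x + y)); [by left|right; right].
  by split=> //; exists x => //; exists y.
pose S := [set q : 'rV[rat]_n * 'rV[rat]_n | exists2 e : R, 0 < e &
  forall x z, D x -> @ratbox R n q z -> e <= `|z - x|].
apply: (@negligibleS _ _ _ P (\bigcup_(q in S)
    [set w : cadlag_path R n | (B `&` ratbox q) (w (T w))])).
  move=> w Bw; have : open_nbhs (w (T w)) (~` closure D).
    by split; [exact/closed_openC/closed_closure|exact: BD].
  move=> /open_nbhs_nbhs/nbhs_ballP[/= e e0 eD].
  have e20 : 0 < e / 2 by rewrite divr_gt0.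
  have [q [qw qe]] := ratbox_ball (w (T w)) e20; exists q => //.
  exists (e / 2) => // x z Dx qz.
  have : ball (w (T w)) (e / 2) z.
    by apply: qe => i; have := qz i; rewrite !mxE => /andP[/ltW-> /ltW->].
  rewrite mx_norm_ball /ball_/= => wz; rewrite leNgt; apply/negP => zx.
  apply: (eD x); last exact: subset_closure.
  rewrite mx_norm_ball /ball_/=.
  rewrite -(subrKA z) [e]splitr; apply: le_lt_trans (ler_normD _ _) _; exact: ltrD.
apply: null_bigcup_countable => q [e e0 qe].
have e2 : 0 < Num.min 1 (e ^+ 2) by rewrite lt_min ltr01 exprn_gt0.
(* A jump from [D] into the box has maximum norm at least [e], hence belongs to [E], on which
   [levy_tail] gives the rate [K]. *)
pose E := [set y : 'rV[R]_n | Num.min 1 (e ^+ 2) <= Num.min 1 (sqnorm y)].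
have mE : measurable E.
  have mm : measurable_fun setT (fun y : 'rV[R]_n => Num.min 1 (sqnorm y)).
    by apply: measurable_minr => //; exact: measurable_sqnorm.
  have := mm measurableT _ (measurable_itv `[Num.min 1 (e ^+ 2), +oo[); rewrite setTI.
  by congr measurable; apply/seteqP; split=> x /=; rewrite in_itv/= andbT.
have [K K0 HK] := levy_tail hN e2 mE (fun y Ey => Ey).
have mq : measurable (@ratbox R n q) by apply: open_rV_measurable; exact: box_open.
apply/negligibleP.
  have := measurable_exit_position D t0 measurableT (measurableI _ _ mB mq).
  by rewrite setTI.
apply: (@exit_null R n D Q b N oD hQ hb hN P P1 MP P0 t t0 _ _ K) => //.
- apply/seteqP; split=> // x [qx Dx]; have := qe x x Dx qx.
  by rewrite subrr normr0 leNgt e0.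
- move=> x Dx; apply: le_trans (HK x); apply: le_measure; rewrite ?inE//.
    have := measurableT_comp measurable_addrV (measurable_pair1 x).
    by move=> /(_ measurableT _ mq); rewrite setTI.
  move=> y qxy; rewrite /E/= le_min !ge_min lexx/=; apply/orP; right.
  have := qe x (x + y) Dx qxy; rewrite addrC addKr => ey.
  by apply: le_trans (sqnorm_ge y); rewrite lerXn2r ?nnegrE// ltW.
- move=> x Dx; apply/eqP; rewrite -measure_le0 -(NB x Dx); apply: le_measure; rewrite ?inE.
  + have := measurableT_comp measurable_addrV (measurable_pair1 x).
    by move=> /(_ measurableT _ (measurableI _ _ mB mq)); rewrite setTI.
  + have := measurableT_comp measurable_addrV (measurable_pair1 x).
    by move=> /(_ measurableT _ mB); rewrite setTI.
  + by move=> y [].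
Qed.

(* [exit_time D] is only measurable for the completion of [P]; [T] is measurable. *)
Lemma exit_null_set (u : 'rV[R]_n -> R) : bounded_borel setT u ->
  exists Z, [/\ measurable Z, P Z = 0%E & forall w : cadlag_path R n, ~ Z w ->
    (survives D t w /\ (t%:E < exit_time D w)%E) \/
    [/\ ~ survives D t w, exit_time D w = (T w)%:E, T w <= t &
       u (w (T w)) <= sup_on (ext_closure N D) u]].
Proof.
move=> [mu [M uM]]; pose B := [set x | sup_on (ext_closure N D) u < u x].
have mB : measurable B.
  have := mu measurableT _ (measurable_itv `]sup_on (ext_closure N D) u, +oo[); rewrite setTI.
  by congr measurable; apply/seteqP; split=> x /=; rewrite in_itv/= andbT.
have BS : B `&` ext_closure N D = set0.
  apply/seteqP; split=> // x [Bx Sx]; move: Bx; rewrite /B/= ltNge => /negP; apply.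
  apply: ub_le_sup; last by exists x.
  by exists M => _ [y _ <-]; exact: le_trans (ler_norm _) (uM _ I).
have N1 := exit_ext_closure mB BS.
have N2 := exit_position_out oD hQ hb hN P1 MP t0.
have [Z [mZ Z0 HZ]] := negligibleU P0 (negligibleU N1 N2).
exists Z; split=> // w Zw.
have D0 : D (w 0) by apply: contrapT => nD; apply/Zw/HZ; left.
have [A|A] := pselect (survives D t w).
  by left; split=> //; exact: survives_exit (ltW t0) A.
right; have nD : ~ D (w (T w)) by move=> DT; apply/Zw/HZ; right; right.
split=> //.
- exact: exit_survival_time (ltW t0) D0 nD.
- by case/andP: (survival_time_itv D t0 w).
- by rewrite leNgt; apply/negP => Bw; apply/Zw/HZ; right; left.
Qed.

End exit_value.

(** * The killed semigroup *)

Section markov.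
Context {R : realType} {n : nat}.
Variable P : R.-pker 'rV[R]_n ~> cadlag_path R n.
Hypotheses (SM : strong_markov P)
  (start : forall x, P x [set w : cadlag_path R n | w 0 = x] = 1%E).
Implicit Types (w : cadlag_path R n) (x y : 'rV[R]_n) (s h t : R) (g : 'rV[R]_n -> R)
  (C : set (cadlag_path R n)) (M : R).

Lemma pker1 x : P x setT = 1%E.
Proof. exact: prob_kernel. Qed.

Lemma pker_fin x : (P x setT < +oo)%E.
Proof. by rewrite pker1 ltry. Qed.

Lemma start_negligible x : (P x).-negligible [set w | w 0 <> x].
Proof.
have cx : closed [set x].
  by apply: accessible_closed_set1; apply: hausdorff_accessible; exact: norm_hausdorff.
have mx : measurable [set w : cadlag_path R n | w 0 = x].
  have := measurable_coord (lexx (0 : R)) measurableT (closed_rV_measurable cx).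
  by rewrite setTI.
have mx' : measurable [set w : cadlag_path R n | w 0 <> x] by exact: measurableC.
apply/negligibleP => //.
have : (P x setT = P x [set w : cadlag_path R n | w 0%R = x] + P x [set w : cadlag_path R n | w 0%R <> x])%E.
  rewrite -measureU//; last by apply/seteqP; split=> // w [].
  by congr (P x _); apply/seteqP; split=> // w _; exact: EM.
rewrite pker1 start => E.
have p0 (p : \bar R) : (0 <= p -> 1 = 1 + p -> p = 0)%E.
  by case: p => //= r _ [] /eqP; rewrite -subr_eq0 opprD addrA subrr add0r oppr_eq0 => /eqP ->.
exact: p0.
Qed.

Definition mean (F : cadlag_path R n -> R) y : R := fine (\int[P y]_w (F w)%:E).

Lemma meanE M (F : cadlag_path R n -> R) y : measurable_fun setT F -> (forall w, 0 <= F w <= M) ->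
  (mean F y)%:E = (\int[P y]_w (F w)%:E)%E.
Proof.
move=> mF FM; rewrite /mean fineK//; apply: integrable_fin_num => //.
apply: (bounded_fun_integrable (pker_fin y) (K := M)) => //.
by move=> w _; have /andP[F0 F1] := FM w; rewrite ger0_norm.
Qed.

Lemma mean_itv M (F : cadlag_path R n -> R) y : measurable_fun setT F -> (forall w, 0 <= F w <= M) -> 0 <= mean F y <= M.
Proof.
move=> mF FM; rewrite -!lee_fin (meanE _ mF FM); apply/andP; split.
  by apply: integral_ge0 => w _; rewrite lee_fin; case/andP: (FM w).
have -> : M%:E = (\int[P y]_w (cst M%:E) w)%E by rewrite integral_cst// pker1 mule1.
apply: ge0_le_integral => //.
- by move=> w _; rewrite lee_fin; case/andP: (FM w).
- exact/measurable_EFinP.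
- by move=> w _; rewrite lee_fin; case/andP: (FM w).
Qed.

Lemma mean_measurable M (F : cadlag_path R n -> R) : measurable_fun setT F -> (forall w, 0 <= F w <= M) ->
  measurable_fun setT (mean F).
Proof.
move=> mF FM; apply: (measurableT_comp (fine_measurable measurableT)).
apply: measurable_fun_integral_kernel.
- by move=> U mU; exact: measurable_kernel.
- by move=> w; rewrite lee_fin; case/andP: (FM w).
- exact/measurable_EFinP.
Qed.

Lemma measurable_at g s : 0 <= s -> measurable_fun setT g ->
  measurable_fun setT (fun w => g (w s)).
Proof. by move=> s0 mg; exact: (measurableT_comp mg (measurable_coord s0)). Qed.

Lemma simple_markov x s h C g M : 0 <= s -> 0 <= h -> filtration s C ->
  measurable_fun setT g -> (forall y, 0 <= g y <= M) ->
  (\int[P x]_(w in C) (g (w (s + h)))%:E =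
   \int[P x]_(w in C) (mean (fun w' => g (w' h)) (w s))%:E)%E.
Proof.
move=> s0 h0 fC mg gM.
have sT : stopping_time (fun _ : cadlag_path R n => s%:E).
  split=> [w|t _]; first by rewrite lee_fin.
  have [st|ts] := leP s t.
    rewrite (_ : [set w | _] = setT); first exact: filtrationT.
    by apply/seteqP; split=> w //= _; rewrite lee_fin.
  rewrite (_ : [set w | _] = set0); first exact: sigma_algebra0.
  by apply/seteqP; split=> w //=; rewrite lee_fin leNgt ts.
have sC : stopped_sigma_algebra (fun _ : cadlag_path R n => s%:E) C.
  split; first exact: filtration_measurable fC.
  move=> t _; have [st|ts] := leP s t.
    rewrite (_ : [set w | _] = setT) ?setIT; first exact: filtration_mono st fC.
    by apply/seteqP; split=> w //= _; rewrite lee_fin.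
  rewrite (_ : [set w | _] = set0) ?setI0; first exact: sigma_algebra0.
  by apply/seteqP; split=> w //=; rewrite lee_fin leNgt ts.
have bg : bounded_borel setT g.
  by split=> //; exists M => y _; have /andP[g0 g1] := gM y; rewrite ger0_norm.
have := SM x sT sC h0 bg.
have -> : C `&` [set w : cadlag_path R n | s%:E < +oo]%E = C.
  by apply/seteqP; split=> w; [case|split=> //=; rewrite ltry].
rewrite /= => ->; apply: eq_integral => w _.
by rewrite (@meanE M)//; exact: measurable_at.
Qed.

(* [F s w] stands for a functional of the path shifted by [s]. *)
Definition markov_functional (F : R -> cadlag_path R n -> R) :=
  forall x s C, 0 <= s -> filtration s C ->
  (\int[P x]_(w in C) (F s w)%:E = \int[P x]_(w in C) (mean (F 0) (w s))%:E)%E.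

(** Bounded convergence is used twice on the right-hand side: under the law started at [w s], then
    under [P x]. *)
Lemma markov_functional_cvg M (F_ : nat -> R -> cadlag_path R n -> R) (F : R -> cadlag_path R n -> R) :
  (forall m s, 0 <= s -> measurable_fun setT (F_ m s)) ->
  (forall m s w, 0 <= s -> 0 <= F_ m s w <= M) ->
  (forall m, markov_functional (F_ m)) ->
  (forall s w, 0 <= s -> F_ m s w @[m --> \oo] --> F s w) ->
  [/\ forall s, 0 <= s -> measurable_fun setT (F s),
      forall s w, 0 <= s -> 0 <= F s w <= M & markov_functional F].
Proof.
move=> mF FM HF cF.
have z0 : 0 <= (0 : R) by [].
have mF' s : 0 <= s -> measurable_fun setT (F s).
  by move=> s0; apply: (@measurable_fun_cvg _ _ _ _ (fun m => F_ m s)) => [m|w _]; [exact: mF|exact: cF].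
have FM' s w : 0 <= s -> 0 <= F s w <= M.
  move=> s0; apply/andP; split.
    by apply: (cvgr_to_ge (cF s w s0)); apply: nearW => m; case/andP: (FM m s w s0).
  by apply: (cvgr_to_le (cF s w s0)); apply: nearW => m; case/andP: (FM m s w s0).
split=> // x s C s0 fC; have mC := filtration_measurable fC.
have nF m r w : 0 <= r -> `|F_ m r w| <= M.
  by move=> r0; have /andP[F0 F1] := FM m r w r0; rewrite ger0_norm.
have L1 := @bounded_convergence_on _ _ _ (P x) (pker_fin x) C (fun m w => F_ m s w) (fun w => F s w) M mC
  (fun m => measurable_funTS (mF m s s0)) (fun m w _ => nF m s w s0) (fun w _ => cF s w s0).
have L2 : (\int[P x]_(w in C) (mean (F_ m 0) (w s))%:E @[m --> \oo] -->
    \int[P x]_(w in C) (mean (F 0) (w s))%:E)%E.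
  apply: (@bounded_convergence_on _ _ _ (P x) (pker_fin x) C _ _ M mC).
  - move=> m; apply: measurable_funTS; apply: measurable_at => //.
    by apply: (@mean_measurable M) => [|w]; [exact: mF|exact: FM].
  - move=> m w _; have /andP[m0 m1] := mean_itv (w s) (mF m 0 z0) (fun w' => FM m 0 w' z0).
    by rewrite ger0_norm.
  - move=> w _; apply: fine_cvg.
    rewrite (meanE _ (mF' 0 z0) (fun w' => FM' 0 w' z0)).
    exact: (@bounded_convergence _ _ _ (P (w s)) (pker_fin _) (F_ ^~ 0) (F 0) M
      (fun m => mF m 0 z0) (fun m w' => nF m 0 w' z0) (fun w' => cF 0 w' z0)).
have E : (fun m => \int[P x]_(w in C) (F_ m s w)%:E)%E =
    (fun m => \int[P x]_(w in C) (mean (F_ m 0) (w s))%:E)%E.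
  by apply/funext => m; exact: HF.
by rewrite -(cvg_lim _ L1)// -(cvg_lim _ L2)// E.
Qed.

Section discrete.
Variables (B : set 'rV[R]_n) (delta : R).
Hypotheses (mB : measurable B) (d0 : 0 <= delta).

Definition killed_step g x : R := \1_B x * mean (fun w => g (w delta)) x.

(** The set [B] is tested at the [k] grid times before the last one only; a test at the last time
    has to be put into [g]. *)
Definition killed_steps (k : nat) g s w : R :=
  \prod_(0 <= j < k) \1_B (w (s + j%:R * delta)) * g (w (s + k%:R * delta)).

Lemma killed_step_itv M g : measurable_fun setT g -> (forall y, 0 <= g y <= M) ->
  measurable_fun setT (killed_step g) /\ (forall y, 0 <= killed_step g y <= M).
Proof.
move=> mg gM.
have mgd : measurable_fun setT (fun w : cadlag_path R n => g (w delta)) by exact: measurable_at.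
split=> [|y].
  apply: measurable_funM; first exact: measurable_indic.
  exact: (mean_measurable mgd (fun w => gM (w delta))).
have /andP[m0 m1] := mean_itv y mgd (fun w => gM (w delta)).
rewrite /killed_step indicE; case: (_ \in _); rewrite ?mul1r ?mul0r ?m0 ?m1//.
by rewrite lexx (le_trans m0).
Qed.

Lemma iter_killed_step_itv M g k : measurable_fun setT g -> (forall y, 0 <= g y <= M) ->
  measurable_fun setT (iter k killed_step g) /\ (forall y, 0 <= iter k killed_step g y <= M).
Proof. by move=> mg gM; elim: k => //= k [m i]; exact: killed_step_itv. Qed.

(** The first indicator is absorbed into the event [C], the induction hypothesis is applied from
    [s + delta], and the one-time Markov property brings the result back to [s]. *)
Lemma killed_steps_iter M g k x s C : measurable_fun setT g -> (forall y, 0 <= g y <= M) ->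
  0 <= s -> filtration s C ->
  (\int[P x]_(w in C) (killed_steps k g s w)%:E =
   \int[P x]_(w in C) (iter k killed_step g (w s))%:E)%E.
Proof.
move=> mg gM; elim: k s C => [|k IH] s C s0 fC.
  by apply: eq_integral => w _; rewrite /killed_steps big_nil mul1r mul0r addr0.
have sd0 : 0 <= s + delta by exact: addr_ge0.
have fB : filtration s (C `&` [set w : cadlag_path R n | B (w s)]).
  by apply: filtrationI => //; apply: filtration_coord => //; rewrite s0 lexx.
have fB' : filtration (s + delta) (C `&` [set w : cadlag_path R n | B (w s)]).
  by apply: filtration_mono fB; rewrite lerDl.
have [mk ik] := iter_killed_step_itv k mg gM.
transitivity (\int[P x]_(w in C `&` [set w : cadlag_path R n | B (w s)])
    (killed_steps k g (s + delta) w)%:E)%E.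
  rewrite integral_mkcondr; apply: eq_integral => w _; rewrite patchE.
  have E j : s + j.+1%:R * delta = s + delta + j%:R * delta by rewrite -natr1; ring.
  rewrite /killed_steps big_nat_recl// mul0r addr0 E; under eq_bigr do rewrite E.
  rewrite [in LHS]indicE; case: (pselect (B (w s))) => Bw.
    by rewrite !mem_set// mul1r.
  by rewrite !memNset// !mul0r.
rewrite IH// (simple_markov x s0 d0 fB mk ik) integral_mkcondr.
apply: eq_integral => w _; rewrite patchE /= /killed_step indicE.
case: (pselect (B (w s))) => Bw; first by rewrite !mem_set// mul1r.
by rewrite !memNset// mul0r.
Qed.

Lemma killed_steps_measurable k g s : 0 <= s -> measurable_fun setT g ->
  measurable_fun setT (killed_steps k g s).
Proof.
move=> s0 mg; apply: measurable_funM; last first.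
  by apply: measurable_at => //; rewrite addr_ge0// mulr_ge0.
elim: k => [|k IH]; first by under eq_fun do rewrite big_nil; exact: measurable_cst.
under eq_fun do rewrite big_nat_recr//=.
apply: measurable_funM => //; apply: (@measurable_at (\1_B)); last exact: measurable_indic.
by rewrite addr_ge0// mulr_ge0.
Qed.

Lemma killed_steps_itv M k g s w : (forall y, 0 <= g y <= M) -> 0 <= killed_steps k g s w <= M.
Proof.
move=> gM; have /andP[g0 g1] := gM (w (s + k%:R * delta)); rewrite /killed_steps.
have p0 : 0 <= \prod_(0 <= j < k) (\1_B (w (s + j%:R * delta)) : R) by apply: prodr_ge0 => j _; rewrite indicE.
have p1 : \prod_(0 <= j < k) (\1_B (w (s + j%:R * delta)) : R) <= 1.
  by rewrite big_mkord; apply: prodr_ile1 => j _; rewrite indicE ler0n lern1 leq_b1.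
by rewrite mulr_ge0//= (le_trans _ g1)// ler_piMl.
Qed.

Lemma killed_steps_markov M k g : measurable_fun setT g -> (forall y, 0 <= g y <= M) ->
  markov_functional (killed_steps k g).
Proof.
move=> mg gM x s C s0 fC; rewrite (killed_steps_iter _ _ mg gM)//.
have z0 : 0 <= (0 : R) by [].
apply: eq_integral => w _; set y := w s.
rewrite (@meanE M); [|exact: killed_steps_measurable|by move=> w'; exact: killed_steps_itv].
have fT : filtration (0 : R) (@setT (cadlag_path R n)) by exact: filtrationT.
(* The same identity from time 0 under [P y], where the path almost surely starts at [y], identifies
   the iterated kernel with the mean of the functional. *)
have K : (\int[P y]_w' (killed_steps k g 0 w')%:E =
    \int[P y]_w' (iter k killed_step g (w' 0))%:E)%E.
  by apply: (@killed_steps_iter M).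
rewrite K.
transitivity (\int[P y]_(w' in setT) (cst (iter k killed_step g y)%:E w'))%E.
  by rewrite integral_cst// pker1 mule1.
have [Z [mZ Z0 HZ]] := start_negligible y.
apply: (integral_eq_off_null mZ Z0) => w' Zw'; rewrite !patchE !in_setT /=.
have -> // : w' 0 = y by apply: contrapT => wy; apply/Zw'/HZ.
Qed.

End discrete.
End markov.

(** * The Markov property of the killed process *)

Section killed_semigroup.
Context {R : realType} {n : nat}.
Variable P : R.-pker 'rV[R]_n ~> cadlag_path R n.
Hypotheses (SM : strong_markov P)
  (start : forall x, P x [set w : cadlag_path R n | w 0 = x] = 1%E).
Variables (D : set 'rV[R]_n) (oD : open D).
Implicit Types (w : cadlag_path R n) (x : 'rV[R]_n) (s t : R) (g : 'rV[R]_n -> R).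

Definition killed_fun t g w : R := \1_(survives D t) w * g (w t).

Definition killed_mean t g x : R := mean P (killed_fun t g) x.

Lemma killed_fun_measurable t g : 0 <= t -> measurable_fun setT g ->
  measurable_fun setT (killed_fun t g).
Proof.
move=> t0 mg; apply: measurable_funM; last exact: measurable_at.
by apply: measurable_indic; apply: filtration_measurable; exact: filtration_survives.
Qed.

Lemma killed_fun_itv M t g w : (forall y, 0 <= g y <= M) -> 0 <= killed_fun t g w <= M.
Proof.
move=> gM; have /andP[g0 g1] := gM (w t).
rewrite /killed_fun indicE; case: (_ \in _); rewrite ?mul1r ?mul0r ?g0 ?g1//.
by rewrite lexx (le_trans g0).
Qed.

Let staying (K : set 'rV[R]_n) t s : set (cadlag_path R n) :=
  [set w | forall r, 0 <= r < t -> K (w (s + r))].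

Let cvg_killed_steps (K : set 'rV[R]_n) t g s w : closed K -> 0 < t -> 0 <= s ->
  killed_steps K (t / m.+1%:R) m.+1 g s w @[m --> \oo] -->
  \1_(staying K t s) w * g (w (s + t)).
Proof.
move=> cK t0 s0.
have mt m : m.+1%:R * (t / m.+1%:R) = t by rewrite mulrC divfK.
have d0 m : 0 < t / m.+1%:R by rewrite divr_gt0.
have [h|] := pselect (staying K t s w).
  rewrite indicE mem_set// mul1r; apply: cvg_near_cst; apply: nearW => m.
  rewrite /killed_steps mt big_nat_cond big1 ?mul1r// => j /andP[/andP[_ jm] _].
  rewrite indicE mem_set//; apply: h; rewrite mulr_ge0 ?(ltW (d0 m))//=.
  by rewrite -[X in _ < X](mt m) ltr_pM2r// ltr_nat.
move=> nh; rewrite indicE memNset// mul0r.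
move/existsNP : nh => [r /not_implyP[/andP[r0 rt] nK]].
have [/= e e0 eK] := (nbhs_ballP _ _).1 (open_nbhs_nbhs (conj (closed_openC cK) nK)).
have [d dd0 wd] := path_right w (s + r) e0.
(* A mesh below [d] puts a grid time where the path is still off [K]; a mesh below [t - r] makes it
   one of the times that are tested. *)
have md0 : 0 < Num.min d (t - r) / t by rewrite divr_gt0// lt_min dd0 subr_gt0.
have [k _ km] := near_infty_natSinv_lt (PosNum md0).
apply: cvg_near_cst; exists k => // m /= mk.
have : t / m.+1%:R < Num.min d (t - r).
  by have := km m mk; rewrite /= ltr_pdivlMr// mulrC.
rewrite lt_min => /andP[h1 h2]; set de := t / m.+1%:R in h1 h2 *.
have de0 : 0 < de := d0 m.
pose j := (Num.truncn (r / de)).+1.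
have /andP[q1 q2] := truncn_itv (divr_ge0 r0 (ltW de0)).
rewrite ler_pdivlMr// in q1; rewrite ltr_pdivrMr// in q2.
have q3 : j%:R * de <= r + de by rewrite /j -natr1 mulrDl mul1r lerD2r.
have jm : (j < m.+1)%N.
  by rewrite -(ltr_nat R) -(ltr_pM2r de0) mt; apply: le_lt_trans q3 _; lra.
rewrite /killed_steps (big_cat_nat (n := j))//=; last exact: ltnW.
rewrite (@big_ltn _ _ _ j)// indicE memNset ?mul0r ?mulr0 ?mul0r//.
apply: eK; apply: wd.
have jr : r < j%:R * de by [].
by move: q3 jr; move: (j%:R * de) => z; lra.
Qed.

(* Survival in the closed set [gap_ge (~` D) k] is the limit of survival at the
   times [j * t / m], and [k] is then sent to infinity. *)
Lemma killed_fun_markov M t g : 0 < t -> measurable_fun setT g -> (forall y, 0 <= g y <= M) ->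
  markov_functional P (fun s w =>
    \1_[set w | exists k, forall r, 0 <= r <= t -> gap_ge (~` D) k (w (s + r))] w * g (w (s + t))).
Proof.
move=> t0 mg gM.
pose K k := gap_ge (~` D) k; have cK k : closed (K k) by exact: gap_ge_closed.
have mK k : measurable (K k) by exact: closed_rV_measurable.
(* The grid leaves out the final time, whereas survival includes it; this factor supplies the
   missing test. *)
pose gK k y := \1_(K k) y * g y.
have mgK k : measurable_fun setT (gK k) by apply: measurable_funM => //; exact: measurable_indic.
have gKM k y : 0 <= gK k y <= M.
  have /andP[g0 g1] := gM y; rewrite /gK indicE.
  by case: (_ \in _); rewrite ?mul1r ?mul0r ?g0 ?g1// lexx (le_trans g0).
pose F k s w : R := \1_(staying (K k) t s) w * gK k (w (s + t)).
have H k := @markov_functional_cvg _ _ P M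
  (fun m => killed_steps (K k) (t / m.+1%:R) m.+1 (gK k)) (F k).
have d0 m : 0 <= t / m.+1%:R by rewrite divr_ge0// ltW.
have {}H k : [/\ forall s, 0 <= s -> measurable_fun setT (F k s),
      forall s w, 0 <= s -> 0 <= F k s w <= M & markov_functional P (F k)].
  apply: H.
  - by move=> m s s0; exact: killed_steps_measurable.
  - by move=> m s w s0; exact: killed_steps_itv.
  - by move=> m; exact: (killed_steps_markov SM start (mK k) (d0 m) m.+1 (mgK k) (gKM k)).
  - by move=> s w s0; exact: cvg_killed_steps.
set G := fun s w => _.
have [] := @markov_functional_cvg _ _ P M F G => //.
- by move=> k s s0; have [h _ _] := H k; exact: h.
- by move=> k s w s0; have [_ h _] := H k; exact: h.
- by move=> k; have [] := H k.
move=> s w s0; rewrite /G indicE.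
have [[k0 h]|nh] := pselect (exists k, forall r, 0 <= r <= t -> gap_ge (~` D) k (w (s + r))).
  rewrite mem_set; last by exists k0.
  apply: cvg_near_cst; exists k0 => // k /= k0k.
  rewrite /F /gK !indicE !mem_set ?mul1r//.
    by apply: (gap_ge_mono k0k); apply: h; rewrite lexx ltW.
  by move=> r /andP[r0 /ltW rt]; apply: (gap_ge_mono k0k); apply: h; rewrite r0.
rewrite memNset// mul0r; apply: cvg_near_cst; apply: nearW => k.
rewrite /F /gK !indicE.
have [h|h] := pselect (staying (K k) t s w); last by rewrite memNset// mul0r.
have -> : (w (s + t) \in K k) = false; last by rewrite mul0r mulr0.
apply/negbTE/negP => /set_mem h'; apply: nh; exists k => r /andP[r0].
by rewrite le_eqVlt => /predU1P[->//|rt]; apply: h; rewrite r0.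
Qed.

Lemma killed_mean_measurable M t g : 0 <= t -> measurable_fun setT g ->
  (forall y, 0 <= g y <= M) -> measurable_fun setT (killed_mean t g).
Proof.
move=> t0 mg gM; apply: (@mean_measurable _ _ P M); first exact: killed_fun_measurable.
by move=> w; exact: killed_fun_itv.
Qed.

Lemma killed_mean_itv M t g x : 0 <= t -> measurable_fun setT g ->
  (forall y, 0 <= g y <= M) -> 0 <= killed_mean t g x <= M.
Proof.
move=> t0 mg gM; apply: mean_itv; first exact: killed_fun_measurable.
by move=> w; exact: killed_fun_itv.
Qed.

Lemma killed_meanE M t g x : 0 <= t -> measurable_fun setT g ->
  (forall y, 0 <= g y <= M) ->
  (killed_mean t g x)%:E = (\int[P x]_w (killed_fun t g w)%:E)%E.
Proof.
move=> t0 mg gM; apply: (meanE _ (M := M)); first exact: killed_fun_measurable.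
by move=> w; exact: killed_fun_itv.
Qed.

Lemma survives_add s t w : 0 <= s -> 0 <= t -> survives D (s + t) w <->
  survives D s w /\ exists k, forall r, 0 <= r <= t -> gap_ge (~` D) k (w (s + r)).
Proof.
move=> s0 t0; split=> [[k h]|[[k1 h1] [k2 h2]]].
  split; exists k => r /andP[r0 rs]; apply: h; first by rewrite r0 (le_trans rs)// lerDl.
  by rewrite addr_ge0//= lerD2l.
exists (maxn k1 k2) => r /andP[r0 rst]; have [rs|sr] := leP r s.
  by apply: (gap_ge_mono (leq_maxl k1 k2)); apply: h1; rewrite r0.
apply: (gap_ge_mono (leq_maxr k1 k2)); rewrite -(subrK s r) addrC; apply: h2.
by rewrite subr_ge0 (ltW sr) lerBlDl.
Qed.

(** Survival up to [s + t] is survival up to [s], an event of the filtration at [s], together with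
    survival of the shifted path up to [t], to which the Markov property applies. *)
Lemma killed_mean_semigroup M s t g x : 0 <= s -> 0 < t -> measurable_fun setT g ->
  (forall y, 0 <= g y <= M) ->
  killed_mean (s + t) g x = killed_mean s (killed_mean t g) x.
Proof.
move=> s0 t0 mg gM; apply: EFin_inj; have st0 : 0 <= s + t by rewrite addr_ge0// ltW.
have mk := killed_mean_measurable (ltW t0) mg gM.
rewrite (killed_meanE _ st0 mg gM).
rewrite (killed_meanE _ s0 mk (fun y => killed_mean_itv y (ltW t0) mg gM)).
pose F s w : R := \1_[set w : cadlag_path R n |
  exists k, forall r, 0 <= r <= t -> gap_ge (~` D) k (w (s + r))] w * g (w (s + t)).
have H : (\int[P x]_(w in survives D s) (F s w)%:E =
    \int[P x]_(w in survives D s) (mean P (F 0) (w s))%:E)%E.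
  exact: (killed_fun_markov t0 mg gM x s0 (filtration_survives D s0)).
have F0 : F 0 = killed_fun t g.
  apply/funext => w; rewrite /F /killed_fun add0r; congr (_ * _).
  rewrite !indicE; congr (nat_of_bool _)%:R; congr (w \in _).
  apply/seteqP; split=> w' [k h]; exists k => r rt; have := h r rt; by rewrite add0r.
rewrite F0 in H.
transitivity (\int[P x]_(w in survives D s) (F s w)%:E)%E.
  rewrite [RHS]integral_mkcond; apply: eq_integral => w _; rewrite patchE /killed_fun /F.
  have [A|A] := pselect (survives D s w); last first.
    rewrite (@memNset _ (survives D s) w)// indicE memNset ?mul0r//.
    by move=> /(survives_add w s0 (ltW t0)) [].
  rewrite (@mem_set _ (survives D s) w)//; congr (_ * _)%:E.
  rewrite !indicE; congr (nat_of_bool _)%:R; apply/idP/idP => /set_mem h; apply/mem_set.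
    by have [_] := (survives_add w s0 (ltW t0)).1 h.
  by apply/(survives_add w s0 (ltW t0)).
rewrite H integral_mkcond; apply: eq_integral => w _; rewrite patchE /killed_fun indicE.
by case: ifPn => _; rewrite ?mul1r ?mul0r.
Qed.

End killed_semigroup.

(** * Subsolutions *)

(** [G] need not be integrable on the half-line, so the two integrals cannot be separated. On the
    block from [k * t] to [(k + 1) * t] the integrand is at most [G (k * t) - G ((k + 2) * t)]; this
    sum telescopes with stride two, whence the factor 2. *)
Lemma integral_decrement (R : realType) (G : R -> R) (t : R) : 0 < t ->
  {homo G : s r /~ r <= s} -> (forall s, 0 <= G s) ->
  (\int[lebesgue_measure]_(s in `[0%R, +oo[) (G s - G (s + t)%R)%:E <= (2 * t * G 0)%:E)%E.
Proof.
move=> t0 Gd G0; pose F (k : nat) : set R := `[k%:R * t, k.+1%:R * t[%classic.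
have kt (k : nat) : k.+1%:R * t = k%:R * t + t by rewrite -natr1 mulrDl mul1r.
have -> : [set` `[0%R, +oo[] = \bigcup_k F k.
  apply/seteqP; split=> [s|s [k _]]; rewrite /F/= !in_itv/= ?andbT.
    move=> s0; have /andP[q1 q2] := truncn_itv (divr_ge0 s0 (ltW t0)).
    by exists (Num.truncn (s / t)) => //=; rewrite in_itv/= -ler_pdivlMr// -ltr_pdivrMr// q1.
  by move=> /andP[h _]; apply: le_trans h; rewrite mulr_ge0// ltW.
have mG := nonincreasing_measurable (@measurableT _ R) Gd.
have mGt : measurable_fun setT (fun s : R => G (s + t)).
  by apply: nonincreasing_measurable => // s r sr; apply: Gd; rewrite lerD2r.
have GG s : 0 <= G s - G (s + t) by rewrite subr_ge0; apply: Gd; rewrite lerDl ltW.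
have tF : trivIset setT F.
  apply/trivIsetP => i j _ _; wlog ij : i j / (i < j)%N => [H|_].
    by rewrite neq_ltn => /orP[] ij; [|rewrite setIC]; apply: H => //; rewrite ltn_eqF.
  apply/seteqP; split=> // s []; rewrite /F/= !in_itv/= => /andP[_ h1] /andP[h2 _].
  by have := le_lt_trans h2 h1; rewrite ltr_pM2r// ltr_nat ltnS leqNgt ij.
have mGG E : measurable_fun E (fun s : R => (G s - G (s + t))%:E).
  by apply/measurable_EFinP; apply: measurable_funTS; exact: measurable_funB.
have mF k : measurable (F k) by exact: measurable_itv.
have := ge0_integral_bigcup lebesgue_measure mF (mGG _) _ tF => /= ->; last first.
  by move=> s _; rewrite lee_fin.
have bound k : (\int[lebesgue_measure]_(s in F k) (G s - G (s + t)%R)%:E <=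
    (t * (G (k%:R * t) - G (k.+2%:R * t)))%:E)%E.
  apply: (@le_trans _ _
    (\int[lebesgue_measure]_(s in F k) ((G (k%:R * t) - G (k.+2%:R * t))%:E))%E).
    apply: le_integral_nonmeas => s; rewrite /F/= in_itv/= => /andP[h1 h2]; rewrite lee_fin lerB//; apply: Gd => //.
      by rewrite kt lerD2r ltW.
  have lF : lebesgue_measure (F k) = t%:E.
    by rewrite /F lebesgue_measure_itv/= lte_fin (kt k) ltrDl t0 -EFinB addrAC subrr add0r.
  by rewrite (integral_cst lebesgue_measure (mF k)); move: lF => /= ->; rewrite -EFinM mulrC.
apply: lime_le; first by apply: is_cvg_nneseries => k _ _; apply: integral_ge0 => s _; rewrite lee_fin.
apply: nearW => m; apply: (@le_trans _ _ (\sum_(0 <= k < m) (t * (G (k%:R * t) - G (k.+2%:R * t)))%:E)%E).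
  by apply: lee_sum => k _; exact: bound.
rewrite sumEFin lee_fin -mulr_sumr.
have -> : \sum_(0 <= k < m) (G (k%:R * t) - G (k.+2%:R * t)) =
    G 0 + G t - G (m%:R * t) - G (m.+1%:R * t).
  elim: m => [|m IH]; first by rewrite big_nil mul0r mul1r; ring.
  by rewrite big_nat_recr//= IH; ring.
have := Gd _ _ (ltW t0); have := G0 (m%:R * t); have := G0 (m.+1%:R * t).
rewrite -/(G 0); move: (G (m.+1%:R * t)) (G (m%:R * t)) (G t) (G 0) => a b cc e h1 h2 h3.
by rewrite -mulrA mulrCA ler_pM2l//; lra.
Qed.

(** * The supermedian function and its defects *)

Section subsolution.
Context {R : realType} {n : nat}.
Variables (D : set 'rV[R]_n) (Q : 'rV[R]_n -> 'M[R]_n) (b : 'rV[R]_n -> 'rV[R]_n).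
Variables (N : R.-ker 'rV[R]_n ~> 'rV[R]_n) (P : R.-pker 'rV[R]_n ~> cadlag_path R n).
Variables (c u : 'rV[R]_n -> R).
Hypotheses (oD : open D) (hQ : diffusion_coefficient Q) (hb : drift_coefficient b)
  (hN : levy_kernel N) (hc : killing_rate D c)
  (SMS : strong_markov_solution (generator Q b N) P)
  (hu : nonneg_sup_subsolution P D c N u).

Local Notation alpha := (sup_on D c).
Local Notation M := (sup_on (ext_closure N D) u).

Lemma exit_null_at x t : D x -> 0 < t ->
  exists Z, [/\ measurable Z, P x Z = 0%E & forall w : cadlag_path R n, ~ Z w ->
    (survives D t w /\ (t%:E < exit_time D w)%E) \/
    [/\ ~ survives D t w, exit_time D w = (survival_time D t w)%:E, survival_time D t w <= t &
       u (w (survival_time D t w)) <= M]].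
Proof.
move=> Dx t0; have [start smp _ _] := SMS; have [P1 _ MP] := smp x.
apply: (exit_null_set oD hQ hb hN P1 MP) => //; last by case: hu => -[].
apply: negligibleS (start_negligible start x) => w /= nD w0; by apply: nD; rewrite w0.
Qed.

Lemma killing_rate_itv x : D x -> 0 <= c x <= alpha.
Proof.
move=> Dx; have [[_ [K cK]] c0] := hc; rewrite c0//=; apply: ub_le_sup; last by exists x.
by exists K => _ [y Dy <-]; exact: le_trans (ler_norm _) (cK y Dy).
Qed.

Lemma subsolution_le_sup x : D x -> u x <= M.
Proof.
move=> Dx; have [[[_ [K uK]] _] _] := hu; apply: ub_le_sup; last by exists x => //; left.
by exists K => _ [y _ <-]; exact: le_trans (ler_norm _) (uK y I).
Qed.

Lemma killing_itv x s (w : cadlag_path R n) : D x -> 0 <= s ->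
  expR (- (alpha * s)) <= killing D c s w <= 1.
Proof.
move=> Dx s0; have a0 : 0 <= alpha by have /andP[] := killing_rate_itv Dx; exact: le_trans.
have e0 y : 0 <= extend0 D c y <= alpha.
  by rewrite /extend0 patchE; case: ifPn => [/set_mem/killing_rate_itv//|_]; rewrite lexx.
have I0 : (0 <= \int[lebesgue_measure]_(r in `[0%R, s]) (extend0 D c (w r))%:E)%E.
  by apply: integral_ge0 => r _; rewrite lee_fin; case/andP: (e0 (w r)).
have I1 : (\int[lebesgue_measure]_(r in `[0%R, s]) (extend0 D c (w r))%:E <= (alpha * s)%:E)%E.
  apply: (@le_trans _ _ (\int[lebesgue_measure]_(r in `[0%R, s]) (alpha%:E))%E).
    by apply: le_integral_nonmeas => r _; rewrite lee_fin; case/andP: (e0 (w r)).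
  rewrite integral_cst//= lebesgue_measure_itv/= lte_fin.
  by case: ltP => h; rewrite ?mule0 ?sube0 -?EFinB ?subr0 ?lee_fin// mulr_ge0.
rewrite /killing /Rintegral -expR0 !ler_expR lerN2 oppr_le0.
rewrite fine_ge0// andbT -lee_fin fineK//.
by rewrite ge0_fin_numE//; exact: le_lt_trans I1 (ltry _).
Qed.

(** The function v of the overview, unrelated to the distance [gap]. It is cut off outside [D]
    because [u] may exceed the supremum off the extended closure. *)
Definition gap_fun y : R := \1_D y * (M - u y).

Lemma gap_fun_in y : D y -> gap_fun y = M - u y.
Proof. by move=> Dy; rewrite /gap_fun indicE mem_set// mul1r. Qed.

Lemma gap_fun_measurable : measurable_fun setT gap_fun.
Proof.
have [[[mu _] _] _] := hu.
apply: measurable_funM; first by apply: measurable_indic; exact: open_rV_measurable.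
exact: measurable_funB.
Qed.

Lemma gap_fun_bounded : exists L, forall y, 0 <= gap_fun y <= L.
Proof.
have [[[_ [K uK]] _] M0] := hu; exists (M + K) => y.
have /andP[h1 h2] : - K <= u y <= K by have := uK y I; rewrite ler_norml.
rewrite /gap_fun indicE; case: (boolP (y \in D)) => [/set_mem Dy|_]; rewrite ?mul1r ?mul0r.
  by rewrite subr_ge0 subsolution_le_sup//= lerD2l lerNl.
by rewrite lexx/= addr_ge0// (le_trans _ (uK y I)).
Qed.

Lemma killed_gap_bound x t : D x -> 0 < t ->
  expR (- (alpha * t)) * killed_mean P D t gap_fun x <= gap_fun x.
Proof.
move=> Dx t0; have [L gL] := gap_fun_bounded; have mg := gap_fun_measurable.
have [Z [mZ Z0 HZ]] := exit_null_at Dx t0.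
have [[_ sub] M0] := hu.
set e := expR _; have e0 : 0 < e by exact: expR_gt0.
have mk := killed_fun_measurable D (ltW t0) mg.
have [q1 q2] : (P x).-integrable setT (EFin \o cst M) /\
    (P x).-integrable setT (EFin \o (fun w => e * killed_fun D t gap_fun w)).
  split; first by apply: (bounded_fun_integrable (pker_fin P x) (K := `|M|)).
  apply: (bounded_fun_integrable (pker_fin P x) (K := e * L)) => //.
    exact: measurable_funM.
  move=> w _; have /andP[k0 k1] := killed_fun_itv D t w gL.
  by rewrite ger0_norm ?ler_pM2l// mulr_ge0// ltW.
rewrite (gap_fun_in Dx) lerBrDr addrC -lerBrDr -lee_fin.
apply: le_trans (sub x t Dx (ltW t0)) _.
have -> : (M - e * killed_mean P D t gap_fun x)%:E =
    (\int[P x]_w (M - e * killed_fun D t gap_fun w)%:E)%E.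
  under eq_integral => w _ do rewrite EFinB.
  rewrite (integralB_EFin measurableT q1 q2).
  rewrite /= integral_cst// pker1 mule1 EFinB; congr (_ - _)%E.
  rewrite EFinM (killed_meanE P D x (ltW t0) mg gL) -integralZl//.
  apply: (bounded_fun_integrable (pker_fin P x) (K := L)) => // w _.
  by have /andP[k0 k1] := killed_fun_itv D t w gL; rewrite ger0_norm.
apply: (integral_le_off_null mZ Z0) => w Zw; rewrite !patch_setT lee_fin.
have [[A lt]|[A -> Tt uT]] := HZ w Zw.
  rewrite (min_idPr (ltW lt))/=.
  have Dw : D (w t) by have [k /(_ t)] := A; rewrite lexx ltW// => /(_ isT); exact: gap_geD.
  rewrite /killed_fun indicE mem_set// mul1r (gap_fun_in Dw).
  have /andP[k0 k1] := killing_itv w Dx (ltW t0); rewrite -/e in k0.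
  have := subsolution_le_sup Dw; move: (killing D c t w) k0 k1 (u (w t)) => k k0 k1 v vM.
  (* This sum equals [M - e * (M - v) - k * v], the difference of the two integrands on survival. *)
  by have : 0 <= (k - e) * (M - v) + (1 - k) * M; [rewrite addr_ge0 ?mulr_ge0; lra | nra].
have T0 : 0 <= survival_time D t w by have /andP[] := life_itv (fun r => survives D r w) (ltW t0).
rewrite -EFin_min (min_idPl Tt)/= /killed_fun indicE memNset// mul0r mulr0 subr0.
have /andP[k0 k1] := killing_itv w Dx T0.
have {}k0 : 0 <= killing D c (survival_time D t w) w by exact: expR_ge0.
(* After the exit, [k * v <= k * M <= M], the last inequality because [M] is nonnegative and
   [k <= 1]. *)
by move: (killing _ _ _ _) k0 k1 (u _) uT => k k0 k1 v vM; nra.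
Qed.

Definition defect t y : R :=
  \1_D y * (gap_fun y - expR (- (alpha * t)) * killed_mean P D t gap_fun y).

Lemma defect_measurable t : 0 < t -> measurable_fun setT (defect t).
Proof.
move=> t0; have [L gL] := gap_fun_bounded; have mg := gap_fun_measurable.
apply: measurable_funM; first by apply: measurable_indic; exact: open_rV_measurable.
apply: measurable_funB => //; apply: measurable_funM => //.
exact: (killed_mean_measurable P D (ltW t0) mg gL).
Qed.

Lemma defect_itv L t y : 0 < t -> (forall z, 0 <= gap_fun z <= L) -> 0 <= defect t y <= L.
Proof.
move=> t0 gL; have mg := gap_fun_measurable; have /andP[g0 g1] := gL y.
rewrite /defect indicE; case: (boolP (y \in D)) => [/set_mem Dy|_]; last first.
  by rewrite mul0r lexx (le_trans g0).
rewrite mul1r subr_ge0 killed_gap_bound//= lerBlDr (le_trans g1)// lerDl.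
rewrite mulr_ge0 ?expR_ge0//.
by have /andP[] := killed_mean_itv P D y (ltW t0) mg gL.
Qed.

Lemma killed_defect s t x : 0 <= s -> 0 < t ->
  killed_mean P D s (defect t) x =
  killed_mean P D s gap_fun x - expR (- (alpha * t)) * killed_mean P D (s + t) gap_fun x.
Proof.
move=> s0 t0; have [L gL] := gap_fun_bounded; have mg := gap_fun_measurable.
have [start _ SM _] := SMS.
have md := defect_measurable t0; have dL y := defect_itv y t0 gL.
have mk := killed_mean_measurable P D (ltW t0) mg gL.
have kL y := killed_mean_itv P D y (ltW t0) mg gL.
rewrite (killed_mean_semigroup SM start D x s0 t0 mg gL).
apply: EFin_inj; rewrite EFinB EFinM (killed_meanE P D x s0 md dL).
rewrite (killed_meanE P D x s0 mg gL) (killed_meanE P D x s0 mk kL).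
have I (g : 'rV[R]_n -> R) : measurable_fun setT g -> (forall y, 0 <= g y <= L) ->
    (P x).-integrable setT (EFin \o killed_fun D s g).
  move=> mg' gL'; apply: (bounded_fun_integrable (pker_fin P x) (K := L)) => //.
    exact: killed_fun_measurable.
  by move=> w _; have /andP[k0 k1] := killed_fun_itv D s w gL'; rewrite ger0_norm.
rewrite -integralZl//; last exact: I.
rewrite -integralB//; first last.
- by apply: integrableZl => //; exact: I.
- exact: I.
apply: eq_integral => w _; rewrite -EFinM -EFinB; congr EFin.
rewrite /killed_fun !indicE; case: (boolP (w \in _)) => [/set_mem A|_]; last first.
  by rewrite !mul0r mulr0 subr0.
rewrite !mul1r /defect indicE mem_set ?mul1r//.
by have [k /(_ s)] := A; rewrite lexx s0 => /(_ isT); exact: gap_geD.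
Qed.

(** Off a null set the events of exit after [s] and of survival up to [s] coincide; from here on the
    exit time can be replaced by the measurable event. *)
Lemma semigroup_killed L s (g : 'rV[R]_n -> R) x : D x -> 0 < s -> measurable_fun setT g ->
  (forall y, 0 <= g y <= L) -> semigroup P D s g x = (killed_mean P D s g x)%:E.
Proof.
move=> Dx s0 mg gL; have [Z [mZ Z0 HZ]] := exit_null_at Dx s0.
rewrite (killed_meanE P D x (ltW s0) mg gL).
apply: (integral_eq_off_null mZ Z0) => w Zw; rewrite patch_setT patchE.
rewrite /killed_fun indicE; have [[A lt]|[A eT Ts _]] := HZ w Zw.
  rewrite !mem_set// mul1r /extend0 patchE mem_set//.
  by have [k /(_ s)] := A; rewrite lexx (ltW s0) => /(_ isT); exact: gap_geD.
rewrite memNset ?[w \in survives D s]memNset ?mul0r//.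
by rewrite /= eT lte_fin ltNge Ts.
Qed.

Lemma resolvent_defect_le t x : D x -> 0 < t ->
  (resolvent P D alpha (defect t) x <= (2 * t * gap_fun x)%:E)%E.
Proof.
move=> Dx t0; have [L gL] := gap_fun_bounded; have mg := gap_fun_measurable.
have md := defect_measurable t0; have dL y := defect_itv y t0 gL.
(* The constant extension to [s <= 0] makes [G] monotone on the whole line: the drop from 0 to a
   positive time is the supermedian inequality itself. *)
pose G s : R := if s <= 0 then gap_fun x else expR (- (alpha * s)) * killed_mean P D s gap_fun x.
have G0 s : 0 <= G s.
  rewrite /G; case: (leP s 0) => s0; first by case/andP: (gL x).
  by rewrite mulr_ge0 ?expR_ge0//; case/andP: (killed_mean_itv P D x (ltW s0) mg gL).
have Gdef s r : 0 < s -> 0 < r ->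
    expR (- (alpha * s)) * killed_mean P D s (defect r) x = G s - G (s + r).
  move=> s0 r0; rewrite (killed_defect x (ltW s0) r0) /G !leNgt s0 addr_gt0//=.
  by rewrite mulrBr mulrA -expRD -opprD -mulrDr.
have Gd : {homo G : s r /~ r <= s}.
  move=> r s sr; have [r0|r0] := leP r 0.
    rewrite {2}/G r0 /G; case: (leP s 0) => // s0; exact: killed_gap_bound.
  have s0 := lt_le_trans r0 sr; move: sr; rewrite le_eqVlt => /predU1P[->//|rs].
  have sr0 : 0 < s - r by rewrite subr_gt0.
  have E : r + (s - r) = s by rewrite addrC subrK.
  (* The decrement from [r] to [s] is the discounted killed mean of the defect of step [s - r],
     which is nonnegative. *)
  rewrite -subr_ge0; have := Gdef r (s - r) r0 sr0; rewrite E => <-; rewrite mulr_ge0 ?expR_ge0//.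
  have mds := defect_measurable sr0; have dsL y := defect_itv y sr0 gL.
  by case/andP: (killed_mean_itv P D x (ltW r0) mds dsL).
have := integral_decrement t0 Gd G0; have -> : G 0 = gap_fun x by rewrite /G lexx.
apply: le_trans.
rewrite /resolvent; apply: (@integral_le_off_null _ _ R lebesgue_measure [set (0 : R)]).
- exact: measurable_set1.
- exact: lebesgue_measure_set1.
move=> s /= /eqP s0.
rewrite !patchE; case: ifPn => // /set_mem/=; rewrite in_itv/= andbT le_eqVlt eq_sym (negbTE s0)/=.
move=> {}s0; rewrite (semigroup_killed Dx s0 md dL) -EFinM lee_fin.
by rewrite Gdef.
Qed.

(** * Minorization and the resulting dichotomy *)

Variables (psi : 'rV[R]_n -> R) (nu : {measure set 'rV[R]_n -> \bar R}).
Hypotheses (psi0 : forall x, D x -> 0 < psi x) (ET : finite_exit_time P D)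
  (mino : minorization P D alpha psi nu).

Lemma defect_mass t x : D x -> 0 < t ->
  ((psi x)%:E * \int[nu]_y (defect t y)%:E <= (2 * t * (M - u x))%:E)%E.
Proof.
move=> Dx t0; have [L gL] := gap_fun_bounded; have dL y := defect_itv y t0 gL.
rewrite -(gap_fun_in Dx); apply: le_trans (resolvent_defect_le Dx t0).
have -> : (\int[nu]_y (defect t y)%:E = \int[nu]_(y in D) (defect t y)%:E)%E.
  rewrite [RHS]integral_mkcond; apply: eq_integral => y _; rewrite patchE /defect indicE.
  by case: (boolP (y \in D)) => _; rewrite ?mul0r.
apply: mino => // [|y Dy]; last by case/andP: (dL y).
split; first by apply: measurable_funTS; exact: defect_measurable.
by exists L => y _; have /andP[d0 d1] := dL y; rewrite ger0_norm.
Qed.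

Lemma survives_prob_cvg0 x : D x -> P x (survives D k.+1%:R) @[k --> \oo] --> 0%E.
Proof.
move=> Dx; have mS k : measurable (survives D k.+1%:R).
  by apply: filtration_measurable; exact: filtration_survives.
have -> : 0%E = P x (\bigcap_k survives D k.+1%:R).
  apply/esym/eqP; rewrite -measure_le0; have [Z [mZ Z0 HZ]] := ET Dx.
  rewrite -Z0; apply: le_measure; rewrite ?inE//; first exact: bigcap_measurable.
  move=> w Sw; apply: HZ => /= fin.
  have h k : (k.+1%:R%:E < exit_time D w)%E by apply: survives_exit => //; exact: Sw.
  have T0 : (0 <= exit_time D w)%E by apply: le_trans (ltW (h 0%N)); rewrite lee_fin.
  have ft : exit_time D w \is a fin_num by rewrite ge0_fin_numE.
  have := h (Num.truncn (fine (exit_time D w))); rewrite -(fineK ft) lte_fin.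
  by rewrite ltNge ltW// truncnS_gt.
apply: nonincreasing_cvg_mu => //.
- by apply: le_lt_trans (pker_fin P x); apply: le_measure; rewrite ?inE.
- exact: bigcap_measurable.
- by move=> k m km; apply/subsetPset; apply: survives_mono; rewrite ler_nat ltnS.
Qed.

(** The discount is only bounded by 1, as [alpha] may be 0; the bound [L] times the probability of
    survival supplies the decay. *)
Lemma gap_fun_vanishes y : D y -> (forall k : nat, defect k.+1%:R y <= 0) -> gap_fun y <= 0.
Proof.
move=> Dy d0; have [L gL] := gap_fun_bounded; have mg := gap_fun_measurable.
have L0 : 0 <= L by have /andP[h1 h2] := gL y; exact: le_trans h2.
have a0 : 0 <= alpha by have /andP[] := killing_rate_itv Dy; exact: le_trans.
have bound k : ((gap_fun y)%:E <= L%:E * P y (survives D k.+1%:R))%E.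
  have mS : measurable (survives D k.+1%:R).
    by apply: filtration_measurable; exact: filtration_survives.
  apply: (@le_trans _ _ (killed_mean P D k.+1%:R gap_fun y)%:E).
    have /andP[m0 _] := killed_mean_itv P D y (ler0n R k.+1) mg gL.
    have := d0 k; rewrite /defect indicE mem_set// mul1r subr_le0 lee_fin => /le_trans; apply.
    by rewrite ler_piMl// -expR0 ler_expR oppr_le0 mulr_ge0.
  rewrite (killed_meanE P D y (ler0n R k.+1) mg gL).
  rewrite -integral_cst// [leRHS]integral_mkcond; apply: le_integral_nonmeas => w _.
  rewrite patchE /killed_fun indicE; case: (w \in _); rewrite ?mul0r// mul1r lee_fin.
  by case/andP: (gL (w k.+1%:R)).
rewrite -lee_fin; have -> : 0%:E = (L%:E * 0)%E by rewrite mule0.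
have cv : (L%:E * P y (survives D k.+1%:R))%E @[k --> \oo] --> (L%:E * 0)%E.
  by apply: cvgeZl => //; exact: survives_prob_cvg0.
rewrite -(cvg_lim _ cv)//; apply: lime_ge; first by apply/cvg_ex; eexists; exact: cv.
by apply: nearW => k; exact: bound.
Qed.

Lemma gap_ratio_or_null x0 : D x0 ->
  (exists2 a, 0 < a & forall x, D x -> a * psi x <= M - u x) \/
  nu [set y | 0 < gap_fun y] = 0%E.
Proof.
move=> Dx0; have [L gL] := gap_fun_bounded.
have d0 (k : nat) y : 0 <= defect k.+1%:R y by have /andP[] := defect_itv y (ltr0Sn R k) gL.
have I0 (k : nat) : (0 <= \int[nu]_y (defect k.+1%:R y)%:E)%E.
  by apply: integral_ge0 => y _; rewrite lee_fin.
have [[k Ik]|none] := pselect (exists k : nat, (0 < \int[nu]_y (defect k.+1%:R y)%:E)%E).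
  left; have k0 := ltr0Sn R k.
  have fI : (\int[nu]_y (defect k.+1%:R y)%:E)%E \is a fin_num.
    (* An infinite integral would contradict the mass bound at [x0], whose right-hand side is finite
       while [psi x0] is positive. *)
    rewrite ge0_fin_numE// ltNge leye_eq; apply/negP => /eqP Iy.
    have := defect_mass Dx0 k0; rewrite Iy gt0_muley ?lte_fin ?psi0//.
  move: fI Ik (fun x Dx => @defect_mass k.+1%:R x Dx k0).
  move=> /fineK <-; set I := fine _; rewrite lte_fin => Ik mass.
  (* The mass bound at time [k + 1], divided by [2 * (k + 1)]; this time does not depend on [x],
     hence neither does the constant. *)
  exists (I / (2 * k.+1%:R)); first by rewrite divr_gt0// mulr_gt0.
  move=> x Dx; rewrite mulrAC ler_pdivrMr ?mulr_gt0// mulrC [leRHS]mulrC.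
  by have := mass x Dx; rewrite -EFinM lee_fin.
right; have null k : nu [set y | 0 < defect k.+1%:R y] = 0%E.
  apply: integral0_null => //; first exact: defect_measurable.
  by apply/eqP; rewrite eq_le I0 andbT leNgt; apply/negP => h; apply: none; exists k.
have ms (g : 'rV[R]_n -> R) : measurable_fun setT g -> measurable [set y : 'rV[R]_n | 0 < g y].
  move=> mg'; have := mg' measurableT _ (measurable_itv `]0, +oo[); rewrite setTI.
  by congr measurable; apply/seteqP; split=> y /=; rewrite in_itv/= andbT.
apply: measure_negligible; first by apply: ms; exact: gap_fun_measurable.
apply: (@negligibleS _ _ _ nu (\bigcup_k [set y | 0 < defect k.+1%:R y])); last first.
  apply: negligible_bigcup => k; have mk := ms _ (defect_measurable (ltr0Sn R k)).
  by exists [set y | 0 < defect k.+1%:R y]; split; [exact: mk | exact: null |].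
move=> y /= gy; have Dy : D y.
  by move: gy; rewrite /gap_fun indicE; case: (boolP (y \in D)) => [/set_mem//|_]; rewrite mul0r ltxx.
have [[k dk]|nd] := pselect (exists k : nat, 0 < defect k.+1%:R y); first by exists k.
have : gap_fun y <= 0.
  by apply: gap_fun_vanishes => // k; rewrite leNgt; apply/negP => h; apply: nd; exists k.
by rewrite leNgt gy.
Qed.

End subsolution.

(** * Conclusion by full support or by absolute continuity *)

Theorem theorem3p2 (R : realType) (d : nat) (D : set 'rV[R]_d)
  (Q : 'rV[R]_d -> 'M[R]_d) (b : 'rV[R]_d -> 'rV[R]_d)
  (N : R.-ker 'rV[R]_d ~> 'rV[R]_d) (c : 'rV[R]_d -> R)
  (P : R.-pker 'rV[R]_d ~> cadlag_path R d)
  (psi : 'rV[R]_d -> R) (nu : {measure set 'rV[R]_d -> \bar R}) :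
  is_domain D ->
  diffusion_coefficient Q -> drift_coefficient b -> levy_kernel N ->
  killing_rate D c ->
  strong_markov_solution (generator Q b N) P ->
  finite_exit_time P D ->
  (forall x, D x -> 0 < psi x) ->
  sigma_finite_on D nu ->
  minorization P D (sup_on D c) psi nu ->
  (msupp nu `&` D = D ->
   forall u : 'rV[R]_d -> R,
     nonneg_sup_subsolution P D c N u ->
     (~ exists k, forall x, D x -> u x = k) ->
     {within D, continuous u} ->
     exists2 a : R, 0 < a &
       forall x, D x -> a * psi x <= sup_on (ext_closure N D) u - u x) /\
  (forall m : {measure set 'rV[R]_d -> \bar R},
     sigma_finite_on D m -> m D != 0%E -> m `<< nu ->
     forall u : 'rV[R]_d -> R,
       nonneg_sup_subsolution P D c N u ->
       (~ exists k, {ae m, forall x, D x -> u x = k}) ->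
       exists2 a : R, 0 < a &
         forall x, D x -> a * psi x <= sup_on (ext_closure N D) u - u x).
Proof.
move=> [oD _] hQ hb hN hc SMS ET psi0 _ mino; split.
- move=> sD u hu ncst cu.
  have [[x0 Dx0]|nD] := pselect (exists x, D x); last first.
    by case: ncst; exists 0 => x Dx; case: nD; exists x.
  have [//|nu0] := gap_ratio_or_null oD hQ hb hN hc SMS hu psi0 ET mino Dx0.
  (* By continuity a point of [D] with [u] below the supremum has a neighbourhood of such points,
     which full support makes of positive measure. A null set of these is thus empty, and [u] is
     constant. *)
  case: ncst; exists (sup_on (ext_closure N D) u) => y Dy; apply/eqP.
  rewrite eq_le (subsolution_le_sup hu Dy)/= leNgt; apply/negP => uM.
  move: cu; rewrite (continuous_open_subspace _ oD) => cu.
  have uy : \forall z \near y, u z < sup_on (ext_closure N D) u.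
    apply: (cu y (mem_set Dy) [set r : R | r < sup_on (ext_closure N D) u]).
    by apply: open_nbhs_nbhs; split; [exact: open_lt | exact: uM].
  have Dn : \forall z \near y, D z by apply: open_nbhs_nbhs.
  have [V [oV Vy] VS] : exists2 V, open_nbhs y V & V `<=` [set z | 0 < gap_fun D N u z].
    have : nbhs y [set z | u z < sup_on (ext_closure N D) u /\ D z] by exact: filterI uy Dn.
    rewrite nbhsE => -[V Vo VS]; exists V => // z /VS[uz Dz].
    by rewrite /= (gap_fun_in N u Dz) subr_gt0.
  have : msupp nu y by move: Dy; rewrite -{1}sD => -[].
  move=> /(_ V oV Vy); rewrite ltNge => /negP; apply; rewrite -nu0.
  apply: le_measure; rewrite ?inE//; first exact: open_rV_measurable.
  have := gap_fun_measurable oD hu measurableT (measurable_itv `]0, +oo[); rewrite setTI.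
  by congr measurable; apply/seteqP; split=> z /=; rewrite in_itv/= andbT.
- move=> m _ mD mnu u hu ncst.
  have [[x0 Dx0]|nD] := pselect (exists x, D x); last first.
    move: mD; have -> : D = set0 by apply/seteqP; split=> // x Dx; apply: nD; exists x.
    by rewrite measure0 eqxx.
  have [//|nu0] := gap_ratio_or_null oD hQ hb hN hc SMS hu psi0 ET mino Dx0.
  have mg : measurable [set z | 0 < gap_fun D N u z].
    have := gap_fun_measurable oD hu measurableT (measurable_itv `]0, +oo[); rewrite setTI.
    by congr measurable; apply/seteqP; split=> z /=; rewrite in_itv/= andbT.
  (* The set of points of [D] where [u] differs from the supremum is null for [nu], hence for
     [m]. *)
  case: ncst; exists (sup_on (ext_closure N D) u).
  exists [set z | 0 < gap_fun D N u z]; split=> //.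
    by apply/(measure0_null_setP m mg); apply: mnu; apply/(measure0_null_setP nu mg).
  move=> y /= /not_implyP[Dy uy]; rewrite (gap_fun_in N u Dy) subr_gt0 lt_neqAle.
  by rewrite (subsolution_le_sup hu Dy) andbT; apply/eqP.
Qed.
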